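(* Let $t,\lambda\in\Bbbk^\times$ with $\lambda^2=t^4$, $V=M(g_a,\rho_{t,\lambda})$ over $\Bbbk G_{\mathcal T}$, $0\ne v_a\in V_{g_a}$, $v_b=g_c\cdot v_a$, $v_c=g_d\cdot v_a$, $v_d=g_b\cdot v_a$. (1) If $t^6\ne1$, then $\langle v_b,\ v_av_b-tv_cv_a+tv_bv_c\rangle$ is a left coideal subalgebra of $\mathcal B(V)$ in the category of $\mathbb N_0$-graded $\Bbbk G_{\mathcal T}$-comodules not generated in degree one. (2) If $(t,\lambda)=(-1,1)$, or $t^2-t+1=0$ and $\lambda=-t^{-1}$, then $\langle v_a,v_b,z\rangle$ with $z=v_cv_bv_a-\lambda v_av_cv_b+\lambda^2v_bv_av_c$ is a left coideal subalgebra in that category not generated in degree one. (3) If $t=1$ and $\lambda=-1$, then the left coideal subalgebra $\langle v_a,v_b\rangle$ has an extension $z$ in degree $11$ with $z\in\langle v_a,v_b,v_c\rangle(11)$. (4) If $t^2+t+1=0$ and $\lambda=-t^{-1}$, then all left coideal subalgebras of $\mathcal B(V)$ in that category are generated in degree one.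
   Context: $\Bbbk$ algebraically closed of characteristic $0$. $\mathcal T=\{a,b,c,d\}$ is the rack (conjugacy class of $(2\,3\,4)$ in $\mathbb A_4$) with $x\triangleright x=x$ and $a\triangleright(b,c,d)=(c,d,b)$, $b\triangleright(a,c,d)=(d,a,c)$, $c\triangleright(a,b,d)=(b,d,a)$, $d\triangleright(a,b,c)=(c,a,b)$. $G_{\mathcal T}=\langle g_x\mid g_xg_y=g_{x\triangleright y}g_x\rangle$; the centralizer $G_{\mathcal T}^{g_a}$ is generated by $g_a$ and $g_bg_d$, and $\rho_{t,\lambda}$ is its character with $g_a\mapsto t$, $g_bg_d\mapsto\lambda$. $M(g,\rho)=\Bbbk G\otimes_{\Bbbk G^g}\Bbbk v$ with left $G$-action and $\deg(h\otimes v)=hgh^{-1}$, a Yetter–Drinfeld module with braiding $c(v\otimes w)=h\cdot w\otimes v$ for $v$ of degree $h$. $\mathcal B(V)$ is the Nichols algebra, $\langle S\rangle$ the subalgebra generated by $S$. Left coideal subalgebra in the category of $\mathbb N_0$-graded $\Bbbk G$-comodules: $\mathbb N_0$-graded $G$-graded subalgebra $C\ni1$ with $\Delta(C)\subseteq\mathcal B(V)\otimes C$; generated in degree one: generated by $C\cap V$; an extension of $C$ in degree $n$ is $x\in\mathcal B(V)(n)\setminus C$ with $\langle C,x\rangle$ again such a left coideal subalgebra. *)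

(* Defs.v *)
From HB Require Import structures.
From mathcomp Require Import all_boot all_order all_algebra.
From Stdlib Require Import ClassicalEpsilon.
Set Implicit Arguments. Unset Strict Implicit. Unset Printing Implicit Defensive.
Import GRing.Theory.
Local Open Scope ring_scope.

Definition rk := 'I_4.
Definition ra : rk := @Ordinal 4 0 isT.
Definition rb : rk := @Ordinal 4 1 isT.
Definition rc : rk := @Ordinal 4 2 isT.
Definition rd : rk := @Ordinal 4 3 isT.

Definition trin (x y : nat) : nat :=
  match x, y with
  | 0, 0 => 0 | 0, 1 => 2 | 0, 2 => 3 | 0, _ => 1
  | 1, 0 => 3 | 1, 1 => 1 | 1, 2 => 0 | 1, _ => 2
  | 2, 0 => 1 | 2, 1 => 3 | 2, 2 => 2 | 2, _ => 0
  | _, 0 => 2 | _, 1 => 0 | _, 2 => 1 | _, _ => 3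
  end.
Definition rtri (x y : rk) : rk := inord (trin x y).

(* ---------- The enveloping group G_T = < g_x | g_x g_y = g_{x|>y} g_x > ----------
   Elements are represented by words in the letters g_x^{+1} (true) and
   g_x^{-1} (false); [geq] is the congruence defining the group. *)
Definition gword := seq (rk * bool).
Inductive geq : gword -> gword -> Prop :=
  | geq_refl w : geq w w
  | geq_sym u v : geq u v -> geq v u
  | geq_trans u v w : geq u v -> geq v w -> geq u w
  | geq_ctx p s u v : geq u v -> geq (p ++ u ++ s) (p ++ v ++ s)
  | geq_invr x : geq [:: (x, true); (x, false)] [::]
  | geq_invl x : geq [:: (x, false); (x, true)] [::]
  | geq_rel x y : geq [:: (x, true); (y, true)] [:: (rtri x y, true); (x, true)].

Definition gdeg (w : seq rk) : gword := map (fun x => (x, true)) w.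

Section Nichols.
Variables (K : fieldType) (t l : K).

(* V = M(g_a, rho_{t,l}) with basis v_x (v_b = g_c.v_a, v_c = g_d.v_a, v_d = g_b.v_a):
   g_x . v_y = qc x y * v_{x |> y}.  (Computed from the relations of G_T, using
   g_a.v_a = t v_a, (g_b g_d).v_a = l v_a and l^2 = t^4.) *)
Definition qcn (x y : nat) : K :=
  match x, y with
  | 0, _ => t
  | 1, 0 => 1 | 1, 1 => t | 1, 2 => l | 1, _ => l / t
  | 2, 0 => 1 | 2, 1 => l / t | 2, 2 => t | 2, _ => l
  | _, 0 => 1 | _, 1 => l | _, 2 => l / t | _, _ => t
  end.
Definition qc (x y : rk) : K := qcn x y.

Definition actw (s : seq rk) (b : rk) : K * rk :=
  foldr (fun x p => (p.1 * qc x p.2, rtri x p.2)) (1, b) s.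

(* Tensor algebra T(V): elements are coefficient functions on words. *)
Definition tens := seq rk -> K.

(* coefficient of the word w in the quantum shuffle product u ⧢ v
   (braiding c(v (x) w) = g_v . w (x) v) *)
Fixpoint shc (u v w : seq rk) {struct w} : K :=
  match w with
  | [::] => if (u == [::]) && (v == [::]) then 1 else 0
  | x :: w' =>
      match u, v with
      | [::], _ => if v == w then 1 else 0
      | _, [::] => if u == w then 1 else 0
      | a :: u', b :: v' =>
          (if x == a then shc u' v w' else 0) +
          (let p := actw u b in if x == p.2 then p.1 * shc u v' w' else 0)
      end
  end.

Definition tone : tens := fun w => if w == [::] then 1 else 0.
Definition tvec (x : rk) : tens := fun w => if w == [:: x] then 1 else 0.
Definition tadd (f g : tens) : tens := fun w => f w + g w.
Definition tscale (k : K) (f : tens) : tens := fun w => k * f w.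
Definition tmul (f g : tens) : tens := fun w =>
  \sum_(i < (size w).+1) \sum_(u : i.-tuple rk) \sum_(v : (size w - i).-tuple rk)
     f u * g v * shc u v w.

Inductive gen (S : tens -> Prop) : tens -> Prop :=
  | gen_one : gen S tone
  | gen_in f : S f -> gen S f
  | gen_add f g : gen S f -> gen S g -> gen S (tadd f g)
  | gen_scale k f : gen S f -> gen S (tscale k f)
  | gen_mul f g : gen S f -> gen S g -> gen S (tmul f g).

(* Nichols algebra B(V): subalgebra of the quantum shuffle algebra generated by V *)
Definition Bnich : tens -> Prop := gen (fun f => exists x, f = tvec x).

Definition homog (n : nat) (f : tens) : Prop := forall w, size w != n -> f w = 0.
Definition nproj (n : nat) (f : tens) : tens :=
  fun w => if size w == n then f w else 0.
Definition gproj (w0 : seq rk) (f : tens) : tens := fun w =>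
  if excluded_middle_informative (geq (gdeg w) (gdeg w0)) then f w else 0.

(* Delta(f) in B(V) (x) C, with Delta the (deconcatenation) coproduct *)
Definition coprod_in (C : tens -> Prop) (f : tens) : Prop :=
  exists s : seq (tens * tens),
    List.Forall (fun p => Bnich p.1 /\ C p.2) s /\
    forall u v, f (u ++ v) = \sum_(p <- s) p.1 u * p.2 v.

Record LCS (C : tens -> Prop) : Prop := {
  lcs_sub : forall f, C f -> Bnich f;
  lcs_one : C tone;
  lcs_add : forall f g, C f -> C g -> C (tadd f g);
  lcs_scale : forall k f, C f -> C (tscale k f);
  lcs_mul : forall f g, C f -> C g -> C (tmul f g);
  lcs_Ngraded : forall n f, C f -> C (nproj n f);
  lcs_Ggraded : forall w0 f, C f -> C (gproj w0 f);
  lcs_coideal : forall f, C f -> coprod_in C f }.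

Definition gen_deg1 (C : tens -> Prop) : Prop :=
  forall f, C f <-> gen (fun g => C g /\ homog 1 g) f.

Definition extension (C : tens -> Prop) (n : nat) (x : tens) : Prop :=
  Bnich x /\ homog n x /\ ~ C x /\ LCS (gen (fun g => C g \/ g = x)).

End Nichols.

(* Main.v *)
Require Import Defs.
From HB Require Import structures.
From Stdlib Require Import ZArith FunctionalExtensionality PropExtensionality.
From Stdlib Require Import ClassicalEpsilon.
From mathcomp Require Import all_boot all_order all_algebra.
From mathcomp Require Import ring ssrZ.
Set Implicit Arguments. Unset Strict Implicit. Unset Printing Implicit Defensive.
Import Defs GRing.Theory.
Local Open Scope ring_scope.

(** For a letter [x], deleting the first letter of words is a skew derivation
    [dl x] of the quantum shuffle algebra, and a graded subalgebra of the
    Nichols algebra generated by homogeneous elements is a left coideal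
    subalgebra as soon as the generators stay in it under all [dl x].

    In (1) the element is a multiple of the word [ab].  In (2) its derivatives
    are [0, 0, 2 b a, 2 a b], while the coefficient of the word [cba], which is
    [2] at the element, vanishes on all products of [a] and [b].  In (3) an
    explicit combination of products of [a, b, c] has all derivatives in
    [<a, b>], and an explicit functional separates it from [<a, b>].

    In (4) a left coideal subalgebra with degree one part spanned by a set [P]
    of letters lies in the space [KS P] of elements whose words end in [P], so
    it suffices that [KS P] is generated by [P].  The group action permutes the
    sets [P] of equal size.  For [P = {a, b, c}] every element is
    [f0 + f1 d + f2 d^2] with [fi] generated by [a, b, c], and deleting a final
    [d] kills [f1] and [f2].  For [P = {a, b}] and [P = {a}], relations that
    hold on the whole Nichols algebra reduce evaluation at an arbitrary word to
    evaluation at 72 (resp. 3) words, and a dual basis of these evaluations is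
    found among the products of letters of [P]. *)

(** * Quantum shuffles *)

(** The coproduct is deconcatenation, so the right legs of Delta(f) are spanned by the functions
    sending [w] to [f (u ++ w)], that is, by iterated first-letter deletions. The Leibniz rule of
    [dl x] contains the twists [tw x b], which record what a word does to a letter crossing it; on a
    G-homogeneous factor a twist is a scalar, and this is where the grading of the generators by G
    enters. Read on the last letter instead, the coideal condition says that elements of C end only
    in letters of C, which bounds C from above in (4); the work left there is to fill this bound by
    products of letters. Since elements are functions on words, three finite tests suffice: a
    homogeneous product expression is zero if its iterated derivatives down to degree 0 are; a
    functional vanishes on products of given letters if its iterated transposes under left
    multiplication by them have constant term 0; and a pairing is a number. Polynomials, functionals
    and certificates are given as data and only such tests are computed, with coefficients
    [a + b tau] for integers [a] and [b], so that one verification covers every field of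
    characteristic 0. *)

Fixpoint words (n : nat) : seq (seq rk) :=
  if n is m.+1 then [seq x :: u | x <- enum 'I_4, u <- words m] else [:: [::]].

Lemma mem_words n u : (u \in words n) = (size u == n).
Proof.
elim: n u => [|n IHn] [|x u] //=.
  by apply/negbTE/negP => /allpairsP [[y v] [_ _]].
rewrite eqSS -IHn; apply/allpairsP/idP => [[[y v] /= [_ hv [_ ->]]] //|hu].
by exists (x, u); rewrite mem_enum.
Qed.

Lemma words_uniq n : uniq (words n).
Proof.
elim: n => //= n IHn; apply: allpairs_uniq; rewrite ?enum_uniq //.
by move=> [x u] [y v] _ _ /= [-> ->].
Qed.

Lemma big_tuple_words (R : nmodType) n (F : seq rk -> R) :
  \sum_(u : n.-tuple rk) F u = \sum_(u <- words n) F u.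
Proof.
rewrite -(big_map (val : n.-tuple rk -> _) xpredT F); apply: perm_big.
apply: uniq_perm; rewrite ?words_uniq //.
  by rewrite map_inj_uniq ?index_enum_uniq //; apply: val_inj.
move=> u; rewrite mem_words; apply/mapP/idP => [[v _ ->]|hu].
  by rewrite size_tuple.
by exists (Tuple hu); rewrite ?mem_index_enum.
Qed.

Section Shuffle.
Variables (K : fieldType) (t l : K).

Notation tens := (seq rk -> K).
Notation actw := (actw t l).
Notation shc := (shc t l).
Notation tmul := (tmul t l).
Implicit Types (f g h : tens) (u v w : seq rk) (x y b c : rk).

Definition dl x f : tens := fun w => f (x :: w).
Definition dr x f : tens := fun w => f (rcons w x).
(* [tw x b f] keeps the words [u] of [f] with [u . v_b] proportional to [v_x],
   weighted by the scalar of that action. *)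
Definition tw x b f : tens :=
  fun u => if (actw u b).2 == x then (actw u b).1 * f u else 0.

Lemma shc_cons x u v w : (size u + size v = (size w).+1)%N ->
  shc u v (x :: w) =
    (if u is a :: u' then if x == a then shc u' v w else 0 else 0) +
    (if v is b :: v' then
       if x == (actw u b).2 then (actw u b).1 * shc u v' w else 0 else 0).
Proof.
have shcl z z' : shc [::] z z' = if z == z' then 1 else 0 :> K.
  by case: z' z => [|? ?] [|? ?].
have shcr z z' : shc z [::] z' = if z == z' then 1 else 0 :> K.
  by case: z' z => [|? ?] [|? ?].
case: u v => [|a u] [|b v] //=.
  rewrite add0r shcl eqseq_cons [x == b]eq_sym.
  by case: (b == x); rewrite ?mul1r.
rewrite addr0 shcr eqseq_cons [x == a]eq_sym.
by case: (a == x).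
Qed.

(** The product read off one letter of the word at a time: the first letter comes from [f], or from
    [g] after crossing all letters of the word taken from [f]. Later inductions on words use this
    recursion instead of sums over pairs of words. *)
Fixpoint tm w f g : K :=
  if w is x :: w' then tm w' (dl x f) g + \sum_b tm w' (tw x b f) (dl b g)
  else f [::] * g [::].

(** The product with lists in place of tuples, and with the length [n] separate from [w] so that the
    recursion can peel letters off [w] freely. *)
Let tmn n f g w : K :=
  \sum_(i < n.+1) \sum_(u <- words i) \sum_(v <- words (n - i))
     f u * g v * shc u v w.

Let big_words_cons n (F : seq rk -> K) :
  \sum_(u <- words n.+1) F u = \sum_x \sum_(u <- words n) F (x :: u).
Proof.
by rewrite /= big_allpairs_dep [LHS]big_enum.
Qed.

Let tmn_cons n f g x w : size w = n ->
  tmn n.+1 f g (x :: w) =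
    tmn n (dl x f) g w + \sum_b tmn n (tw x b f) (dl b g) w.
Proof.
move=> sw; rewrite {1}/tmn.
pose s1 u v : K := if u is a :: u' then if x == a then shc u' v w else 0 else 0.
pose s2 u v : K := if v is b :: v' then
       if x == (actw u b).2 then (actw u b).1 * shc u v' w else 0 else 0.
transitivity (\sum_(i < n.+2) \sum_(u <- words i) \sum_(v <- words (n.+1 - i))
     (f u * g v * s1 u v + f u * g v * s2 u v)).
  apply: eq_bigr => i _; rewrite big_seq [RHS]big_seq.
  apply: eq_bigr => u; rewrite mem_words => /eqP hu.
  rewrite big_seq [RHS]big_seq; apply: eq_bigr => v.
  rewrite mem_words => /eqP hv; rewrite shc_cons ?mulrDr // hu hv sw.
  by rewrite subnKC // -ltnS.
transitivity (
 (\sum_(i < n.+2) \sum_(u <- words i) \sum_(v <- words (n.+1 - i))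
     (f u * g v * s1 u v)) +
 (\sum_(i < n.+2) \sum_(u <- words i) \sum_(v <- words (n.+1 - i))
     (f u * g v * s2 u v))).
  rewrite -big_split; apply: eq_bigr => i _.
  by rewrite -big_split; apply: eq_bigr => u _; rewrite -big_split.
congr (_ + _).
  (* First letter taken from [u]: the term with [u] empty vanishes and the index shifts by one. *)
  rewrite big_ord_recl big1_seq ?add0r => [|u].
    rewrite /tmn; apply: eq_bigr => i _; rewrite lift0 subSS big_words_cons.
    rewrite (bigD1 x) //= [X in _ + X]big1 ?addr0 => [|y ne].
      by apply: eq_bigr => u _; apply: eq_bigr => v _; rewrite eqxx.
    rewrite big1_seq // => u _; rewrite big1_seq // => v _.
    by rewrite eq_sym (negbTE ne) mulr0.
  rewrite andTb mem_words => /nilP ->.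
  by rewrite big1 // => v _; rewrite mulr0.
(* First letter taken from [v]: the term with [v] empty is the last one, and it vanishes. *)
rewrite big_ord_recr /= subnn /= [X in _ + X]big1 ?addr0; last first.
  by move=> u _; rewrite big_seq1 mulr0.
rewrite /tmn [RHS]exchange_big /=; apply: eq_bigr => i _.
rewrite [RHS]exchange_big /=; apply: eq_bigr => u _.
rewrite (subSn (leq_ord i)) big_words_cons; apply: eq_bigr => b _.
apply: eq_bigr => v _; rewrite /s2 /dl /tw [in RHS]eq_sym.
by case: eqP => _; rewrite ?mulr0 ?mul0r //; ring.
Qed.

Lemma tmulE f g w : tmul f g w = tm w f g.
Proof.
have -> : tmul f g w = tmn (size w) f g w.
  rewrite /Defs.tmul /tmn; apply: eq_bigr => i _.
  rewrite (@big_tuple_words _ i (fun u => \sum_(v : (size w - i).-tuple rk) f u * g v * shc u v w)).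
  apply: eq_bigr => u _.
  exact: (@big_tuple_words _ (size w - i) (fun v => f u * g v * shc u v w)).
elim: w f g => [|x w IHw] f g.
  by rewrite /tmn big_ord1 big_seq1 big_seq1 /= mulr1.
rewrite [size _]/= tmn_cons // IHw /=; congr (_ + _).
by apply: eq_bigr => b _; rewrite IHw.
Qed.
End Shuffle.

(** * The tetrahedron rack *)

Lemma rk_ind (P : rk -> Prop) : P ra -> P rb -> P rc -> P rd -> forall x, P x.
Proof.
move=> pa pb pc pd x; case: x => [[|[|[|[|m]]]] //= hm].
- by rewrite (_ : Ordinal hm = ra) //; apply: val_inj.
- by rewrite (_ : Ordinal hm = rb) //; apply: val_inj.
- by rewrite (_ : Ordinal hm = rc) //; apply: val_inj.
- by rewrite (_ : Ordinal hm = rd) //; apply: val_inj.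
Qed.

Lemma rtriE :
  ((rtri ra ra = ra) * (rtri ra rb = rc) * (rtri ra rc = rd) * (rtri ra rd = rb) *
  (rtri rb ra = rd) * (rtri rb rb = rb) * (rtri rb rc = ra) * (rtri rb rd = rc) *
  (rtri rc ra = rb) * (rtri rc rb = rd) * (rtri rc rc = rc) * (rtri rc rd = ra) *
  (rtri rd ra = rc) * (rtri rd rb = ra) * (rtri rd rc = rb) * (rtri rd rd = rd))%type.
Proof. by do ![split]; apply: val_inj; rewrite /= inordK. Qed.

(** Every letter acts on the rack as a 3-cycle of the other three, so applying it twice inverts it;
    hence the form of [irtri]. *)
Lemma rtri3 x y : rtri x (rtri x (rtri x y)) = y.
Proof. by elim/rk_ind: x; elim/rk_ind: y; rewrite !rtriE. Qed.

Lemma rtri_rtri x y z : rtri x (rtri y z) = rtri (rtri x y) (rtri x z).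
Proof. by elim/rk_ind: x; elim/rk_ind: y; elim/rk_ind: z; rewrite !rtriE. Qed.

Definition irtri x y := rtri x (rtri x y).

Lemma rtriK x : cancel (rtri x) (irtri x).
Proof. exact: rtri3. Qed.

Lemma irtriK x : cancel (irtri x) (rtri x).
Proof. exact: rtri3. Qed.

Lemma rtri_inj x : injective (rtri x).
Proof. exact: can_inj (rtriK x). Qed.

Lemma reindex_rtri (R : nmodType) c (F : rk -> R) :
  \sum_k F k = \sum_k F (rtri c k).
Proof.
by apply: reindex; exists (irtri c) => k _; rewrite (rtriK, irtriK).
Qed.

Lemma sum_rk (R : nmodType) (F : rk -> R) :
  \sum_k F k = F ra + (F rb + (F rc + F rd)).
Proof.
rewrite !big_ord_recl big_ord0 addr0.
by congr (_ + (_ + (_ + _))); congr (F _); apply: val_inj.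
Qed.

(** * Associativity, the group action, and deletion of first and last letters *)

Section Algebra.
Variables (K : fieldType) (t l : K).
Hypotheses (ht : t != 0) (hl : l != 0) (hlt : l ^+ 2 = t ^+ 4).

Notation tens := (seq rk -> K).
Notation qc := (qc t l).
Notation actw := (actw t l).
Notation tw := (tw t l).
Notation tmul := (tmul t l).
Notation "f ** g" := (tmul f g) (at level 40, left associativity).
Notation tone := (tone K).
Notation tvec := (tvec K).
Implicit Types (f g h : tens) (u v w : seq rk) (x y b c : rk).

(** The two sides are the scalars by which g_x g_y and g_{x|>y} g_x act on v_z. The condition on [l]
    enters as [(l / t) * (l / t) = t * t]. *)
Lemma qc_cocycle x y z :
  qc x (rtri y z) * qc y z = qc (rtri x y) (rtri x z) * qc x z.
Proof.
have h1 : l / t * t = l by rewrite divfK.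
have h2 : t * (l / t) = l by rewrite mulrC h1.
have h3 : l / t * (l / t) = t * t.
  by rewrite -!expr2 expr_div_n hlt (exprD t 2 2) mulfK ?expf_neq0.
elim/rk_ind: x; elim/rk_ind: y; elim/rk_ind: z; rewrite !rtriE /Defs.qc /=;
  rewrite ?mul1r ?mulr1 ?h1 ?h2 ?h3 //; exact: mulrC.
Qed.

Lemma qc_neq0 x y : qc x y != 0.
Proof.
by elim/rk_ind: x; elim/rk_ind: y; rewrite /Defs.qc /= ?oner_neq0 ?mulf_neq0 ?invr_neq0.
Qed.

Lemma actw_cat u v b :
  actw (u ++ v) b = ((actw v b).1 * (actw u (actw v b).2).1, (actw u (actw v b).2).2).
Proof.
elim: u => [|x u IH] /=; first by rewrite mulr1 -surjective_pairing.
by rewrite IH /= mulrA.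
Qed.

Lemma actw_rcons u x b :
  actw (rcons u x) b = (qc x b * (actw u (rtri x b)).1, (actw u (rtri x b)).2).
Proof. by rewrite -cats1 actw_cat /= mul1r. Qed.

(** In the group, u g_c = g_{u.c} u; this is that identity applied to v_k, split into letter and
    scalar. *)
Lemma actw_rtri u c k :
  (actw u (rtri c k)).2 = rtri (actw u c).2 (actw u k).2 /\
  qc c k * (actw u (rtri c k)).1 = qc (actw u c).2 (actw u k).2 * (actw u k).1.
Proof.
elim: u => [|y u [IH1 IH2]] /=; first by [].
rewrite IH1 rtri_rtri; split=> //.
by rewrite mulrA IH2 mulrAC [X in X * _]mulrC qc_cocycle mulrAC mulrA.
Qed.

Definition tsum (F : rk -> tens) : tens := fun w => \sum_(i : rk) F i w.
Definition tzero : tens := fun _ => 0.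

Lemma tmulDl f g h : tadd f g ** h = tadd (f ** h) (g ** h).
Proof.
apply: functional_extensionality => w; rewrite /tadd /Defs.tmul -big_split.
apply: eq_bigr => i _ /=; rewrite -big_split; apply: eq_bigr => u _ /=.
by rewrite -big_split; apply: eq_bigr => v _ /=; rewrite !mulrDl.
Qed.

Lemma tmulDr f g h : h ** tadd f g = tadd (h ** f) (h ** g).
Proof.
apply: functional_extensionality => w; rewrite /tadd /Defs.tmul -big_split.
apply: eq_bigr => i _ /=; rewrite -big_split; apply: eq_bigr => u _ /=.
by rewrite -big_split; apply: eq_bigr => v _ /=; rewrite mulrDr mulrDl.
Qed.

Lemma tmulZl k f h : tscale k f ** h = tscale k (f ** h).
Proof.
apply: functional_extensionality => w; rewrite /tscale /Defs.tmul big_distrr.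
apply: eq_bigr => i _ /=; rewrite big_distrr; apply: eq_bigr => u _ /=.
by rewrite big_distrr; apply: eq_bigr => v _ /=; rewrite !mulrA.
Qed.

Lemma tmulZr k f h : h ** tscale k f = tscale k (h ** f).
Proof.
apply: functional_extensionality => w; rewrite /tscale /Defs.tmul big_distrr.
apply: eq_bigr => i _ /=; rewrite big_distrr; apply: eq_bigr => u _ /=.
by rewrite big_distrr; apply: eq_bigr => v _ /=; rewrite !mulrA [h u * k]mulrC.
Qed.

Lemma tzeroE f : tzero = tscale 0 f.
Proof. by apply: functional_extensionality => w; rewrite /tscale mul0r. Qed.

Lemma tmul0l f : tzero ** f = tzero.
Proof. by rewrite (tzeroE tone) tmulZl -!tzeroE. Qed.

Lemma tmul0r f : f ** tzero = tzero.
Proof. by rewrite (tzeroE tone) tmulZr -!tzeroE. Qed.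

Lemma tsumE (F : rk -> tens) :
  tsum F = tadd (F ra) (tadd (F rb) (tadd (F rc) (F rd))).
Proof. by apply: functional_extensionality => w; rewrite /tsum sum_rk. Qed.

Lemma tmul_suml (F : rk -> tens) h : tsum F ** h = tsum (fun i => F i ** h).
Proof. by rewrite !tsumE !tmulDl. Qed.

Lemma tmul_sumr (F : rk -> tens) h : h ** tsum F = tsum (fun i => h ** F i).
Proof. by rewrite !tsumE !tmulDr. Qed.

Lemma tmul_nil f g : (f ** g) [::] = f [::] * g [::].
Proof. by rewrite tmulE. Qed.

Lemma tmul_cons f g x w :
  (f ** g) (x :: w) = (dl x f ** g) w + \sum_b (tw x b f ** dl b g) w.
Proof.
by rewrite !tmulE /=; congr (_ + _); apply: eq_bigr => b _; rewrite tmulE.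
Qed.

Lemma dl_mul x f g :
  dl x (f ** g) = tadd (dl x f ** g) (tsum (fun b => tw x b f ** dl b g)).
Proof. by apply: functional_extensionality => w; rewrite /dl tmul_cons. Qed.

Lemma twD x b f g : tw x b (tadd f g) = tadd (tw x b f) (tw x b g).
Proof.
apply: functional_extensionality => w; rewrite /tw /tadd.
by case: eqP => _; rewrite ?addr0 ?mulrDr.
Qed.

Lemma twZ x b k f : tw x b (tscale k f) = tscale k (tw x b f).
Proof.
apply: functional_extensionality => w; rewrite /tw /tscale.
by case: eqP => _; rewrite ?mulr0 // mulrCA.
Qed.

Lemma tw_sum x b (F : rk -> tens) : tw x b (tsum F) = tsum (fun i => tw x b (F i)).
Proof. by rewrite !tsumE !twD. Qed.

(** A letter [y] at the front of a word acts last on the crossing letter, so the rest of the word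
    must bring [b] to [e] for the whole word to bring it to [rtri y e]. *)
Lemma dl_tw y e b f :
  dl y (tw (rtri y e) b f) = tscale (qc y e) (tw e b (dl y f)).
Proof.
apply: functional_extensionality => u; rewrite /dl /tw /tscale /=.
rewrite (inj_eq (@rtri_inj y)).
by case: eqP => [->|_]; rewrite ?mulr0 // mulrAC mulrC mulrA.
Qed.

(** Two letters crossing [f] may be braided before or after the crossing: if [u] sends [c] to [y],
    then it sends [rtri c k] to [rtri y e] exactly when it sends [k] to [e]. *)
Lemma tw_tw y e c k f :
  tscale (qc c k) (tw y c (tw (rtri y e) (rtri c k) f)) =
  tscale (qc y e) (tw e k (tw y c f)).
Proof.
apply: functional_extensionality => u; rewrite /tw /tscale.
have [-> e2] := actw_rtri u c k.
case: (_ =P y) => [h|_]; last by rewrite !mulr0 if_same mulr0.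
rewrite h in e2 *; rewrite (inj_eq (@rtri_inj y)).
case: eqP => [h2|_]; last by rewrite !mulr0.
rewrite h2 in e2; rewrite mulrCA mulrA -mulrA [qc c k * _]mulrA e2.
by ring.
Qed.

Lemma tw_nil x b f : tw x b f [::] = if b == x then f [::] else 0.
Proof. by rewrite /tw /= mul1r. Qed.

(** A letter [b] crossing a product first crosses [g], becoming some [c], and then [f], becoming
    [x]. The twists thus behave like matrix coefficients, which is what associativity needs. *)
Lemma tw_mul x b f g : tw x b (f ** g) = tsum (fun c => tw x c f ** tw c b g).
Proof.
apply: functional_extensionality => w; elim: w x b f g => [|y w IH] x b f g.
  rewrite tw_nil tmul_nil /tsum (bigD1 x) //= big1 ?addr0 => [|c ne].
    by rewrite tmul_nil !tw_nil eqxx; case: eqP; rewrite ?mulr0.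
  by rewrite tmul_nil !tw_nil (negbTE ne) mul0r.
(* With [y] the first letter of the word, [x] is rewritten as [rtri y e] so that [dl_tw] applies. *)
rewrite -(irtriK y x); set e := irtri y x.
rewrite -[LHS]/(dl y (tw (rtri y e) b (f ** g)) w) dl_tw dl_mul twD tw_sum.
rewrite /tscale /tadd IH /tsum.
under [X in _ + X]eq_bigr => c _ do rewrite IH /tsum.
under [RHS]eq_bigr => c _ do rewrite tmul_cons dl_tw tmulZl /tscale.
rewrite big_split /= mulrDr big_distrr; congr (_ + _).
rewrite [RHS]exchange_big big_distrr; apply: eq_bigr => c _ /=.
(* The intermediate letter is renamed [rtri c k], the shape in which [tw_tw] and [dl_tw] match both
   sides. *)
rewrite [RHS](reindex_rtri c) big_distrr; apply: eq_bigr => k _ /=.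
rewrite dl_tw tmulZr -tmulZl tw_tw.
by rewrite tmulZl.
Qed.

Lemma tmulA f g h : f ** (g ** h) = f ** g ** h.
Proof.
apply: functional_extensionality => w; elim: w f g h => [|x w IH] f g h.
  by rewrite !tmul_nil mulrA.
rewrite !tmul_cons dl_mul tmulDl tmul_suml IH /tadd -addrA; congr (_ + _).
under eq_bigr => c _ do rewrite dl_mul tmulDr tmul_sumr /tadd IH.
rewrite big_split; congr (_ + _).
under [RHS]eq_bigr => b _ do rewrite tw_mul tmul_suml /tsum.
rewrite [RHS]exchange_big; apply: eq_bigr => c _.
by rewrite /tsum; apply: eq_bigr => b _; rewrite IH.
Qed.

Lemma dl_one x : dl x tone = tzero.
Proof. by []. Qed.

Lemma tw_one x b : tw x b tone = if b == x then tone else tzero.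
Proof.
apply: functional_extensionality => -[|y w]; first by rewrite tw_nil; case: ifP.
by rewrite /tw /tone /= mulr0 if_same; case: ifP.
Qed.

Lemma tmul1l f : tone ** f = f.
Proof.
apply: functional_extensionality => w; elim: w f => [|x w IH] f.
  by rewrite tmul_nil mul1r.
rewrite tmul_cons dl_one tmul0l add0r (bigD1 x) //= big1 ?addr0 => [|b ne].
  by rewrite tw_one eqxx IH.
by rewrite tw_one (negbTE ne) tmul0l.
Qed.

Lemma tmul1r f : f ** tone = f.
Proof.
apply: functional_extensionality => w; elim: w f => [|x w IH] f.
  by rewrite tmul_nil mulr1.
rewrite tmul_cons IH big1 ?addr0 // => b _.
by rewrite dl_one tmul0r.
Qed.

(** The diagonal action of g_x on the tensor algebra, on coefficient functions: the coefficient at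
    [w] is the one at the preimage word, times the product of the scalars of its letters. *)
Definition act x f : tens := fun w =>
  (\prod_(b <- map (irtri x) w) qc x b) * f (map (irtri x) w).

Lemma dl_act x b f : dl (rtri x b) (act x f) = tscale (qc x b) (act x (dl b f)).
Proof.
apply: functional_extensionality => w.
by rewrite /dl /act /tscale /= big_cons rtriK mulrA.
Qed.

Lemma actD x f g : act x (tadd f g) = tadd (act x f) (act x g).
Proof. by apply: functional_extensionality => w; rewrite /act /tadd mulrDr. Qed.

Lemma actZ x k f : act x (tscale k f) = tscale k (act x f).
Proof. by apply: functional_extensionality => w; rewrite /act /tscale mulrCA. Qed.

Lemma act_sum x (F : rk -> tens) : act x (tsum F) = tsum (fun i => act x (F i)).
Proof. by rewrite !tsumE !actD. Qed.

Lemma actw_map x v b :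
  (actw (map (rtri x) v) (rtri x b)).2 = rtri x (actw v b).2 /\
  qc x b * (actw (map (rtri x) v) (rtri x b)).1 = qc x (actw v b).2 * (actw v b).1.
Proof.
elim: v => [|y u [IH1 IH2]] /=; first by [].
rewrite IH1 -rtri_rtri; split=> //.
rewrite mulrA IH2 mulrAC [in RHS]mulrA [RHS]mulrAC; congr (_ * _).
by rewrite qc_cocycle mulrC.
Qed.

(** Conjugation by g_x carries the crossing of [b] into the crossing of [rtri x b]. The scalars
    stand on both sides to avoid division. *)
Lemma act_tw x y b f :
  tscale (qc x y) (act x (tw y b f)) =
  tscale (qc x b) (tw (rtri x y) (rtri x b) (act x f)).
Proof.
apply: functional_extensionality => u; rewrite /tscale /act /tw.
set v := map _ u.
have -> : u = map (rtri x) v.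
  by rewrite -map_comp -[LHS]map_id; apply: eq_map => z /=; rewrite irtriK.
have [-> e2] := actw_map x v b.
rewrite (inj_eq (@rtri_inj x)); case: eqP => [h|_]; last by rewrite !mulr0.
by rewrite h in e2; rewrite [RHS]mulrA e2; ring.
Qed.

Lemma act_nil x f : act x f [::] = f [::].
Proof. by rewrite /act big_nil mul1r. Qed.

Lemma act_mul x f g : act x (f ** g) = act x f ** act x g.
Proof.
apply: functional_extensionality => w; elim: w f g => [|z w IH] f g.
  by rewrite act_nil !tmul_nil !act_nil.
rewrite -(irtriK x z); set y := irtri x z.
rewrite -[LHS]/(dl (rtri x y) _ w) dl_act dl_mul actD act_sum.
rewrite tmul_cons dl_act tmulZl /tscale /tadd mulrDr IH; congr (_ + _).
rewrite [RHS](reindex_rtri x) /tsum big_distrr; apply: eq_bigr => b _ /=.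
rewrite dl_act tmulZr -tmulZl -act_tw tmulZl /tscale.
by rewrite IH.
Qed.

Lemma dr_tw x y b f : dr x (tw y b f) = tscale (qc x b) (tw y (rtri x b) (dr x f)).
Proof.
apply: functional_extensionality => u; rewrite /dr /tw /tscale actw_rcons /=.
by case: eqP; rewrite ?mulr0 // mulrA.
Qed.

(* Deleting the last letter: if it comes from [f], all letters of [g] have
   crossed it, whence the twist by [act x]. *)
Lemma dr_mul x f g : dr x (f ** g) = tadd (f ** dr x g) (dr x f ** act x g).
Proof.
apply: functional_extensionality => w; elim: w f g => [|y w IH] f g.
  rewrite {1}/dr /= tmul_cons /tadd !tmul_nil act_nil addrC; congr (_ + _).
  rewrite (bigD1 x) //= big1 ?addr0 => [|b ne].
    by rewrite tmul_nil tw_nil eqxx.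
  by rewrite tmul_nil tw_nil (negbTE ne) mul0r.
have IHr p q : (p ** q) (rcons w x) = (p ** dr x q) w + (dr x p ** act x q) w.
  exact: IH.
rewrite {1}/dr /= tmul_cons IHr.
under eq_bigr => b _ do rewrite IHr.
rewrite big_split /= /tadd !tmul_cons.
rewrite addrACA; congr (_ + _).
congr (_ + _); rewrite [RHS](reindex_rtri x); apply: eq_bigr => b _.
by rewrite dr_tw dl_act tmulZl tmulZr.
Qed.

Lemma dl_vec x y : dl x (tvec y) = if x == y then tone else tzero.
Proof.
apply: functional_extensionality => w; rewrite /dl /Defs.tvec eqseq_cons.
by case: eqP.
Qed.

Lemma tw_vec x b y :
  tw x b (tvec y) = if rtri y b == x then tscale (qc y b) (tvec y) else tzero.
Proof.
apply: functional_extensionality => w; rewrite /tw /Defs.tvec.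
have [->|/negbTE ne] := eqVneq w [:: y]; last first.
  by rewrite mulr0 if_same; case: ifP => _ //; rewrite /tscale ne mulr0.
rewrite /= mul1r mulr1 /tscale /tzero.
by case: ifP => _ //; rewrite eqxx mulr1.
Qed.

(** A single letter [y] turns only [irtri y x] into [x], so the sum in the Leibniz rule has one
    term. The computations with derivatives and with transposes below both rest on this formula. *)
Lemma dl_vec_mul x y f :
  dl x (tvec y ** f) =
  tadd (if x == y then f else tzero)
       (tscale (qc y (irtri y x)) (tvec y ** dl (irtri y x) f)).
Proof.
rewrite dl_mul dl_vec; congr tadd.
  by case: eqP => _; rewrite ?tmul1l ?tmul0l.
apply: functional_extensionality => w.
rewrite /tsum (bigD1 (irtri y x)) //= big1 ?addr0 => [|b ne].
  by rewrite tw_vec irtriK eqxx tmulZl.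
rewrite tw_vec; case: eqP => [h|_]; last by rewrite tmul0l.
by rewrite -h rtriK eqxx in ne.
Qed.
End Algebra.

(** * Generated subalgebras and left coideals *)

Section Generation.
Variables (K : fieldType) (t l : K).
Hypotheses (ht : t != 0) (hl : l != 0) (hlt : l ^+ 2 = t ^+ 4).

Notation tens := (seq rk -> K).
Notation qc := (qc t l).
Notation actw := (actw t l).
Notation shc := (shc t l).
Notation tw := (tw t l).
Notation tmul := (tmul t l).
Notation "f ** g" := (tmul f g) (at level 40, left associativity).
Notation tone := (tone K).
Notation tzero := (@tzero K).
Notation tvec := (tvec K).
Notation act := (act t l).
Notation gen := (gen t l).
Notation Bnich := (Bnich t l).
Implicit Types (f g h : tens) (u v w : seq rk) (x y b c : rk) (S C : tens -> Prop).

Lemma gen_zero S : gen S tzero.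
Proof. by rewrite (tzeroE tone); apply: gen_scale; apply: gen_one. Qed.

Lemma gen_sum S (F : rk -> tens) : (forall b, gen S (F b)) -> gen S (tsum F).
Proof. by move=> h; rewrite tsumE; do 3![apply: gen_add => //]. Qed.

Lemma gen_sub S T f : (forall s, S s -> gen T s) -> gen S f -> gen T f.
Proof.
move=> hS; elim=> {f} [|f /hS //|f g _ hf _ hg|k f _ hf|f g _ hf _ hg].
- exact: gen_one.
- exact: gen_add.
- exact: gen_scale.
- exact: gen_mul.
Qed.

Definition prodl (s : seq tens) : tens := foldr tmul tone s.

(** Elements of [gen S] as linear combinations of monomials in [S]. The projections to homogeneous
    components respect sums but not products, so they are evaluated on monomials, which are
    homogeneous. *)
Inductive span S : tens -> Prop :=
  | span0 : span S tzero
  | span_add k s f : (forall i, (i < size s)%N -> S (nth tone s i)) ->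
      span S f -> span S (tadd (tscale k (prodl s)) f).

Lemma taddA f g h : tadd f (tadd g h) = tadd (tadd f g) h.
Proof. by apply: functional_extensionality => w; rewrite /tadd addrA. Qed.

Lemma tadd0 f : tadd f tzero = f.
Proof. by apply: functional_extensionality => w; rewrite /tadd addr0. Qed.

Lemma t0add f : tadd tzero f = f.
Proof. by apply: functional_extensionality => w; rewrite /tadd add0r. Qed.

Lemma tscaleA (k m : K) f : tscale k (tscale m f) = tscale (k * m) f.
Proof. by apply: functional_extensionality => w; rewrite /tscale mulrA. Qed.

Lemma tscale1 f : tscale 1 f = f.
Proof. by apply: functional_extensionality => w; rewrite /tscale mul1r. Qed.

Lemma tscale_r0 (k : K) : tscale k tzero = tzero.
Proof. by apply: functional_extensionality => w; rewrite /tscale mulr0. Qed.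

Lemma tscaleDr (k : K) f g : tscale k (tadd f g) = tadd (tscale k f) (tscale k g).
Proof. by apply: functional_extensionality => w; rewrite /tscale /tadd mulrDr. Qed.

Lemma tscaleDl (k m : K) f : tscale (k + m) f = tadd (tscale k f) (tscale m f).
Proof. by apply: functional_extensionality => w; rewrite /tscale /tadd mulrDl. Qed.

Lemma prodl_cat s1 s2 : prodl (s1 ++ s2) = prodl s1 ** prodl s2.
Proof.
by elim: s1 => [|f s1 IH] /=; rewrite ?tmul1l // IH tmulA.
Qed.

Lemma span_tadd S f g : span S f -> span S g -> span S (tadd f g).
Proof.
move=> hf hg; elim: hf => [|k s {}f hs _ IH]; first by rewrite t0add.
by rewrite -taddA; apply: span_add.
Qed.

Lemma span_scale S k f : span S f -> span S (tscale k f).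
Proof.
elim=> [|m s {}f hs _ IH]; first by rewrite tscale_r0; exact: span0.
by rewrite tscaleDr tscaleA; apply: span_add.
Qed.

Lemma span_prodl S s : (forall i, (i < size s)%N -> S (nth tone s i)) ->
  span S (prodl s).
Proof.
by move=> hs; rewrite -[prodl s]tscale1 -[tscale _ _]tadd0; apply: span_add; last exact: span0.
Qed.

Lemma span_mul S f g : span S f -> span S g -> span S (f ** g).
Proof.
move=> hf hg; elim: hf => [|k s {}f hs _ IH]; first by rewrite tmul0l; exact: span0.
rewrite tmulDl tmulZl; apply: span_tadd => //; apply: span_scale => {IH f}.
elim: hg => [|m s2 g2 hs2 _ IH]; first by rewrite tmul0r; exact: span0.
rewrite tmulDr tmulZr -prodl_cat; apply: span_add => // i hi.
by rewrite nth_cat; case: ltnP => h; [apply: hs|apply: hs2; rewrite ltn_subLR // -size_cat].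
Qed.

Lemma gen_span S f : gen S f -> span S f.
Proof.
elim=> {f} [|f hf|f g _ hf _ hg|k f _ hf|f g _ hf _ hg].
- exact: (span_prodl (s := [::])).
- by rewrite -[f](tmul1r t l); apply: (span_prodl (s := [:: f])) => -[|i].
- exact: span_tadd.
- exact: span_scale.
- exact: span_mul.
Qed.

Lemma gen_prodl S s : (forall i, (i < size s)%N -> S (nth tone s i)) ->
  gen S (prodl s).
Proof.
elim: s => [|f s IH] hs; first exact: gen_one.
by apply: gen_mul; [apply: gen_in; apply: (hs 0%N)|apply: IH => i; apply: (hs i.+1)].
Qed.

Lemma gen_tw S x b f :
  (forall s y c, S s -> gen S (tw y c s)) -> gen S f -> gen S (tw x b f).
Proof.
move=> hS hf; elim: hf x b => {f} [|f hf|f g _ hf _ hg|k f _ hf|f g _ hf _ hg] x b.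
- by rewrite tw_one; case: ifP => _; [apply: gen_one|apply: gen_zero].
- exact: hS.
- by rewrite twD; apply: gen_add.
- by rewrite twZ; apply: gen_scale.
- by rewrite tw_mul //; apply: gen_sum => c; apply: gen_mul.
Qed.

Lemma gen_dl S x f :
  (forall s y c, S s -> gen S (tw y c s)) ->
  (forall s y, S s -> gen S (dl y s)) -> gen S f -> gen S (dl x f).
Proof.
move=> hS hd hf; elim: hf x => {f} [|f hf|f g hf0 hf _ hg|k f _ hf|f g hf0 hf hg0 hg] x.
- exact: gen_zero.
- exact: hd.
- exact: gen_add (hf x) (hg x).
- exact: gen_scale (hf x).
- rewrite dl_mul //; apply: gen_add; first exact: gen_mul.
  by apply: gen_sum => c; apply: gen_mul => //; apply: gen_tw.
Qed.

Lemma act_one x : act x tone = tone.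
Proof.
apply: functional_extensionality => -[|y w]; first by rewrite act_nil.
by rewrite /act /tone /= mulr0.
Qed.

Lemma act_vec x y : act x (tvec y) = tscale (qc x y) (tvec (rtri x y)).
Proof.
apply: functional_extensionality => w; rewrite /act /tscale /tvec.
have -> : (map (irtri x) w == [:: y]) = (w == [:: rtri x y]).
  rewrite -(inj_eq (inj_map (@rtri_inj x))) -map_comp.
  by rewrite [map _ w](eq_map (irtriK x)) map_id.
case: eqP => [->|_]; last by rewrite !mulr0.
by rewrite /= big_cons big_nil rtriK mulr1.
Qed.

Lemma gen_act S T x f : (forall s, S s -> gen T (act x s)) ->
  gen S f -> gen T (act x f).
Proof.
move=> hS; elim=> {f} [|f /hS //|f g _ hf _ hg|k f _ hf|f g _ hf _ hg].
- by rewrite act_one; exact: gen_one.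
- by rewrite actD; apply: gen_add.
- by rewrite actZ; apply: gen_scale.
- by rewrite act_mul //; apply: gen_mul.
Qed.

Lemma Bnich_vec x : Bnich (tvec x).
Proof. by apply: gen_in; exists x. Qed.

Lemma Bnich_act x f : Bnich f -> Bnich (act x f).
Proof.
by apply: gen_act => s [y ->]; rewrite act_vec; apply: gen_scale; apply: Bnich_vec.
Qed.

Lemma vec_tw S x b y : S (tvec y) -> gen S (tw x b (tvec y)).
Proof.
move=> hS; rewrite tw_vec; case: ifP => _; last exact: gen_zero.
by apply: gen_scale; apply: gen_in.
Qed.

Lemma vec_dl S x y : gen S (dl x (tvec y)).
Proof. by rewrite dl_vec; case: ifP => _; [apply: gen_one|apply: gen_zero]. Qed.

Lemma Bnich_dl x f : Bnich f -> Bnich (dl x f).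
Proof.
apply: gen_dl => [s y c [z ->]|s y [z ->]]; last exact: vec_dl.
by apply: vec_tw; exists z.
Qed.

Lemma dr_vec x y : dr x (tvec y) = if x == y then tone else tzero.
Proof.
rewrite -dl_vec; apply: functional_extensionality => w.
by rewrite /dl /dr /tvec; case: w => //= z [|? w]; rewrite ?andbF // !eqseq_cons !andbF.
Qed.

Lemma dr_one x : dr x tone = tzero.
Proof. by apply: functional_extensionality => -[]. Qed.

Lemma Bnich_dr x f : Bnich f -> Bnich (dr x f).
Proof.
elim=> {f} [|f [y ->]|f g _ hf _ hg|k f _ hf|f g hf0 hf hg0 hg].
- by rewrite dr_one; exact: gen_zero.
- by rewrite dr_vec; case: ifP => _; [apply: gen_one|apply: gen_zero].
- exact: gen_add hf hg.
- exact: gen_scale hf.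
- by rewrite dr_mul; apply: gen_add; apply: gen_mul => //; apply: Bnich_act.
Qed.

Definition dlw u f : tens := fun w => f (u ++ w).
Definition drw v f : tens := fun w => f (w ++ v).

Lemma dlwP C u f : (forall x g, C g -> C (dl x g)) -> C f -> C (dlw u f).
Proof. by move=> hC; elim: u f => [//|x u IH] f hf; apply: (IH (dl x f)); apply: hC. Qed.

Lemma drwP C v f : (forall x g, C g -> C (dr x g)) -> C f -> C (drw v f).
Proof.
move=> hC; elim/last_ind: v f => [|v x IH] f hf.
  by rewrite (_ : drw _ f = f) //; apply: functional_extensionality => w; rewrite /drw cats0.
rewrite (_ : drw _ f = drw v (dr x f)); first by apply: IH; apply: hC.
by apply: functional_extensionality => w; rewrite /drw /dr rcons_cat.
Qed.

(** * The gradings by degree and by the enveloping group *)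

Lemma geq_cat (u1 u2 v1 v2 : gword) : geq u1 v1 -> geq u2 v2 -> geq (u1 ++ u2) (v1 ++ v2).
Proof.
move=> h1 h2; apply: (@geq_trans _ (v1 ++ u2)).
  exact: (@geq_ctx [::] u2).
by have := @geq_ctx v1 [::] _ _ h2; rewrite !cats0.
Qed.

Lemma geq_cons x u v : geq (gdeg u) (gdeg v) -> geq (gdeg (x :: u)) (gdeg (x :: v)).
Proof.
by move=> h; apply: (@geq_cat [:: (x, true)] _ [:: (x, true)]) => //; apply: geq_refl.
Qed.

(** Iterating the defining relation moves g_b to the front through [u]: crossing does not change the
    group degree. *)
Lemma geq_move u b : geq (gdeg (rcons u b)) (gdeg ((actw u b).2 :: u)).
Proof.
elim: u => [|x u IH] /=; first exact: geq_refl.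
apply: (@geq_trans _ (gdeg [:: x, (actw u b).2 & u])).
  exact: geq_cons.
apply: (@geq_ctx [::] (gdeg u) [:: (x, true); ((actw u b).2, true)]
  [:: (rtri x (actw u b).2, true); (x, true)]); exact: geq_rel.
Qed.

(** A shuffle differs from concatenation by crossings, and [geq_move] shows that these preserve the
    group degree. *)
Lemma shc_neq0 u v w : shc u v w != 0 ->
  size w = (size u + size v)%N /\ geq (gdeg w) (gdeg (u ++ v)).
Proof.
elim: w u v => [|x w IH] u v.
  by case: u v => [|? ?] [|? ?]; rewrite /= ?eqxx //= => _; split=> //; exact: geq_refl.
case: u v => [|a u] [|b v].
- by rewrite /= eqxx.
- rewrite (_ : shc [::] _ _ = if b :: v == x :: w then 1 else 0) //.
  case: (_ =P x :: w) => [<- _|_]; last by rewrite eqxx.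
  by split=> //; exact: geq_refl.
- rewrite (_ : shc _ [::] _ = if a :: u == x :: w then 1 else 0) //.
  case: (_ =P x :: w) => [<- _|_]; last by rewrite eqxx.
  by rewrite cats0 addn0; split=> //; exact: geq_refl.
rewrite /=.
have [e1|ne1] := eqVneq (if x == a then shc u (b :: v) w else 0) 0; last first.
  move=> _; move: ne1; case: (x =P a) => [->|_]; last by rewrite eqxx.
  move=> /IH [-> hg].
  by split=> //; apply: geq_cons.
rewrite e1 add0r -[rtri a _]/((actw (a :: u) b).2).
case: (x =P _) => [->|_]; last by rewrite eqxx.
rewrite mulf_eq0 negb_or => /andP [_ /IH [-> hg]]; split; first by rewrite /= addnS.
apply: (@geq_trans _ (gdeg ((actw (a :: u) b).2 :: (a :: u) ++ v))).
  exact: geq_cons.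
rewrite -cat_cons -[b :: v]cat1s catA cats1.
rewrite /gdeg !map_cat; apply: (@geq_cat _ _ (gdeg (rcons (a :: u) b))); last exact: geq_refl.
by apply: geq_sym; apply: geq_move.
Qed.

Lemma tmul_neq0 f g w : (f ** g) w != 0 ->
  exists u v, [/\ f u != 0, g v != 0, size w = (size u + size v)%N
    & geq (gdeg w) (gdeg (u ++ v))].
Proof.
move=> hw; apply: NNPP => hn; move/eqP: hw; apply.
rewrite /Defs.tmul big1 // => i _; rewrite big1 // => u _; rewrite big1 // => v _.
apply/eqP; apply/negPn/negP; rewrite !mulf_eq0 !negb_or => /andP [/andP [fu gv]].
move=> /shc_neq0 [hs hg]; apply: hn; by exists u, v.
Qed.

Definition homG (p : gword) f : Prop := forall w, f w != 0 -> geq (gdeg w) p.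

Lemma homG_mul p q f g : homG p f -> homG q g -> homG (p ++ q) (f ** g).
Proof.
move=> hf hg w /tmul_neq0 [u [v [/hf fu /hg gv _ h]]].
by apply: geq_trans h _; rewrite /gdeg map_cat; apply: geq_cat.
Qed.

Lemma homog_mul m n f g : homog m f -> homog n g -> homog (m + n) (f ** g).
Proof.
move=> hf hg w hw; apply/eqP; apply/negPn/negP => /tmul_neq0 [u [v [fu gv h _]]].
move: hw; rewrite h; have [->|/hf e] := eqVneq (size u) m; last by rewrite e eqxx in fu.
by have [->|/hg e] := eqVneq (size v) n; rewrite ?eqxx //; rewrite e eqxx in gv.
Qed.

Definition gact1 (a : rk * bool) (p : K * rk) : K * rk :=
  if a.2 then (p.1 * qc a.1 p.2, rtri a.1 p.2)
  else (p.1 / qc a.1 (irtri a.1 p.2), irtri a.1 p.2).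

(** The defining relations act trivially on multiples of basis vectors, the rack relation by
    [qc_cocycle]. Hence the action of a word depends on its group degree only; inverses must act as
    well because [geq] passes through words containing them. *)
Lemma geq_gact (u v : gword) p : geq u v -> foldr gact1 p u = foldr gact1 p v.
Proof.
move=> h; elim: h p => {u v} //= [u v w _ IH1 _ IH2 p|p s u v _ IH q|x [k b]|x [k b]|x y [k b]].
- by rewrite IH1.
- by rewrite !foldr_cat IH.
- by rewrite /gact1 /= irtriK divfK ?qc_neq0.
- by rewrite /gact1 /= rtriK mulfK ?qc_neq0.
- by rewrite /gact1 /= -rtri_rtri -!mulrA; congr (_ * _, _); rewrite mulrC qc_cocycle // mulrC.
Qed.

Lemma actw_gdeg u b : actw u b = foldr gact1 (1, b) (gdeg u).
Proof. by rewrite /gdeg foldr_map. Qed.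

(** All words in the support of [f] act on v_b in the same way, so the twist keeps all of them with
    one common scalar or none of them. *)
Lemma homG_tw p f x b : homG p f ->
  exists k, tw x b f = tscale k f.
Proof.
move=> hp; pose r := foldr gact1 (1, b) p.
exists (if r.2 == x then r.1 else 0); apply: functional_extensionality => u.
rewrite /tw /tscale; have [->|/hp h] := eqVneq (f u) 0.
  by rewrite !mulr0 if_same.
by rewrite actw_gdeg (geq_gact _ h) -/r; case: ifP; rewrite ?mul0r.
Qed.

(** Only [x] itself fixes [x] in the rack, so the action on v_x separates the degrees of the
    letters. *)
Lemma geq_letter x y : geq (gdeg [:: x]) (gdeg [:: y]) -> x = y.
Proof.
move/(geq_gact (1, x))=> /= [_].
by elim/rk_ind: x; elim/rk_ind: y; rewrite !rtriE.
Qed.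

Lemma gproj_homG p f w0 : homG p f -> gproj w0 f = f \/ gproj w0 f = tzero.
Proof.
move=> hp; case: (excluded_middle_informative (geq p (gdeg w0))) => [h|h].
  left; apply: functional_extensionality => w; rewrite /gproj.
  case: (excluded_middle_informative _) => // hn; apply/eqP; rewrite eq_sym.
  by apply/negPn/negP => /hp h2; apply: hn; apply: geq_trans h2 h.
right; apply: functional_extensionality => w; rewrite /gproj /tzero.
case: (excluded_middle_informative _) => // hw; apply/eqP.
by apply/negPn/negP => /hp h2; apply: h; apply: geq_trans hw; exact: geq_sym.
Qed.

Lemma gprojD w0 f g : gproj w0 (tadd f g) = tadd (gproj w0 f) (gproj w0 g).
Proof.
apply: functional_extensionality => w; rewrite /gproj /tadd /=.
by case: (excluded_middle_informative _) => h /=; rewrite ?addr0.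
Qed.

Lemma gprojZ w0 k f : gproj w0 (tscale k f) = tscale k (gproj w0 f).
Proof.
apply: functional_extensionality => w; rewrite /gproj /tscale /=.
by case: (excluded_middle_informative _) => h /=; rewrite ?mulr0.
Qed.

Lemma nproj_homog m n f : homog m f -> nproj n f = f \/ nproj n f = tzero.
Proof.
move=> hm; have [->|ne] := eqVneq n m; [left|right];
  apply: functional_extensionality => w; rewrite /nproj; case: eqP => // hw.
  by rewrite hm //; apply/eqP.
by rewrite hm // hw.
Qed.

Lemma nprojD n f g : nproj n (tadd f g) = tadd (nproj n f) (nproj n g).
Proof.
apply: functional_extensionality => w; rewrite /nproj /tadd /=.
by case: eqP => _; rewrite ?addr0.
Qed.

Lemma nprojZ n k f : nproj n (tscale k f) = tscale k (nproj n f).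
Proof.
apply: functional_extensionality => w; rewrite /nproj /tscale /=.
by case: eqP => _; rewrite ?mulr0.
Qed.

Lemma homG_prodl S s : (forall f, S f -> exists p, homG p f) ->
  (forall i, (i < size s)%N -> S (nth tone s i)) -> exists p, homG p (prodl s).
Proof.
move=> hS; elim: s => [|f s IH] hs.
  by exists [::] => -[|x w] //; rewrite ?eqxx // => _; exact: geq_refl.
have [|p hp] := hS f; first exact: (hs 0%N).
have [i|q hq] := IH; first exact: (hs i.+1).
by exists (p ++ q); apply: homG_mul.
Qed.

Lemma homog_prodl S s : (forall f, S f -> exists n, homog n f) ->
  (forall i, (i < size s)%N -> S (nth tone s i)) -> exists n, homog n (prodl s).
Proof.
move=> hS; elim: s => [|f s IH] hs; first by exists 0%N => -[|x w].
have [|p hp] := hS f; first exact: (hs 0%N).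
have [i|q hq] := IH; first exact: (hs i.+1).
by exists (p + q)%N; apply: homog_mul.
Qed.

Lemma gproj0 w0 : gproj w0 tzero = tzero.
Proof. by apply: functional_extensionality => w; rewrite /gproj; case: (excluded_middle_informative _). Qed.

Lemma nproj0 n : nproj n tzero = tzero.
Proof. by apply: functional_extensionality => w; rewrite /nproj if_same. Qed.

Lemma gen_gproj S w0 f : (forall f, S f -> exists p, homG p f) ->
  gen S f -> gen S (gproj w0 f).
Proof.
move=> hS /gen_span; elim=> [|k s {}f hs _ IH].
  by rewrite gproj0; exact: gen_zero.
rewrite gprojD gprojZ; apply: gen_add => //; apply: gen_scale.
have [p hp] := homG_prodl hS hs.
by case: (gproj_homG w0 hp) => ->; [apply: gen_prodl|apply: gen_zero].
Qed.

Lemma gen_nproj S n f : (forall f, S f -> exists n, homog n f) ->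
  gen S f -> gen S (nproj n f).
Proof.
move=> hS /gen_span; elim=> [|k s {}f hs _ IH].
  by rewrite nproj0; exact: gen_zero.
rewrite nprojD nprojZ; apply: gen_add => //; apply: gen_scale.
have [p hp] := homog_prodl hS hs.
by case: (nproj_homog n hp) => ->; [apply: gen_prodl|apply: gen_zero].
Qed.

Lemma homog_vec y : homog 1 (tvec y).
Proof. by move=> w hw; rewrite /tvec; case: eqP => // e; rewrite e in hw. Qed.

Lemma homG_vec y : homG (gdeg [:: y]) (tvec y).
Proof.
move=> w; rewrite /tvec; case: (w =P _) => [-> _|_]; first exact: geq_refl.
by rewrite eqxx.
Qed.

Lemma homog_scale n k f : homog n f -> homog n (tscale k f).
Proof. by move=> hf w hw; rewrite /tscale hf // mulr0. Qed.

Lemma homG_scale p k f : homG p f -> homG p (tscale k f).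
Proof. by move=> hf w; rewrite /tscale mulf_eq0 negb_or => /andP [_ /hf]. Qed.

Lemma homog_add n f g : homog n f -> homog n g -> homog n (tadd f g).
Proof. by move=> hf hg w hw; rewrite /tadd hf // hg // addr0. Qed.

Lemma homG_add p f g : homG p f -> homG p g -> homG p (tadd f g).
Proof.
move=> hf hg w; rewrite /tadd; have [->|/hf //] := eqVneq (f w) 0.
by rewrite add0r => /hg.
Qed.

Lemma homG_geq p q f : geq p q -> homG p f -> homG q f.
Proof. by move=> hpq hf w /hf h; apply: geq_trans h hpq. Qed.

Lemma Bnich_nproj n f : Bnich f -> Bnich (nproj n f).
Proof. by apply: gen_nproj => g [x ->]; exists 1%N; apply: homog_vec. Qed.

Lemma Bnich_fin f : Bnich f -> exists N, forall w, (N < size w)%N -> f w = 0.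
Proof.
elim=> {f} [|f [y ->]|f g _ [N hf] _ [M hg]|k f _ [N hf]|f g _ [N hf] _ [M hg]].
- by exists 0%N => -[|y w].
- by exists 1%N => w hw; apply: homog_vec; case: w hw => [|? []].
- by exists (maxn N M) => w; rewrite gtn_max => /andP [h1 h2]; rewrite /tadd hf // hg // addr0.
- by exists N => w hw; rewrite /tscale hf // mulr0.
exists (N + M)%N => w hw; apply/eqP; apply/negPn/negP => /tmul_neq0 [u [v [fu gv h _]]].
case: (ltnP N (size u)) => [/hf e|hu]; first by rewrite e eqxx in fu.
case: (ltnP M (size v)) => [/hg e|hv]; first by rewrite e eqxx in gv.
by rewrite h ltnNge leq_add in hw.
Qed.

(* The two legs of the coproduct come from a rank factorization of the matrix
   [f (u ++ v)] through a generalized inverse. *)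
Lemma coprod_inP C f : Bnich f ->
  C tzero -> (forall f g, C f -> C g -> C (tadd f g)) ->
  (forall k f, C f -> C (tscale k f)) -> (forall u, C (dlw u f)) ->
  coprod_in t l C f.
Proof.
move=> hB C0 CD CZ Cd; have [N hN] := Bnich_fin hB.
(* [f] vanishes on words longer than [N], so the words in [W] index a finite square matrix carrying
   all nonzero values [f (u ++ v)]. *)
pose W := flatten [seq words i | i <- iota 0 N.+1]; pose m := size W.
have memW u : (u \in W) = (size u <= N)%N.
  apply/flatten_mapP/idP => [[i]|h].
    by rewrite mem_iota mem_words /= add0n ltnS => h /eqP ->.
  by exists (size u); rewrite ?mem_words // mem_iota /= ltnS.
pose wd (i : 'I_m) := nth [::] W i.
pose F : 'M[K]_m := \matrix_(i, j) f (wd i ++ wd j).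
pose X := pinvmx F.
have FXF : F *m X *m F = F by rewrite mulmxKpV.
exists [seq (drw (wd j) f, fun w => \sum_i X j i * f (wd i ++ w)) | j <- enum 'I_m].
split.
  elim: (enum _) => //= j s IH; constructor=> //=; split.
    by apply: drwP hB; apply: Bnich_dr.
  elim: (index_enum _) => [|i r IHr].
    by rewrite (_ : (fun w => _) = tzero) //; apply: functional_extensionality => w; rewrite big_nil.
  rewrite (_ : (fun w => _) = tadd (tscale (X j i) (dlw (wd i) f))
     (fun w => \sum_(i <- r) X j i * f (wd i ++ w))).
    by apply: CD => //; apply: CZ.
  by apply: functional_extensionality => w; rewrite big_cons.
move=> u v; rewrite big_map big_enum /=.
case: (leqP (size u) N) => hu; last first.
  rewrite hN ?size_cat ?ltn_addr // big1 // => j _.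
  by rewrite /drw hN ?mul0r // size_cat ltn_addr.
case: (leqP (size v) N) => hv; last first.
  rewrite hN ?size_cat ?ltn_addl // big1 // => j _; rewrite big1 ?mulr0 // => i _.
  by rewrite hN ?mulr0 // size_cat ltn_addl.
have iu : (index u W < m)%N by rewrite index_mem memW.
have iv : (index v W < m)%N by rewrite index_mem memW.
have e1 : u = wd (Ordinal iu) by rewrite /wd nth_index ?memW.
have e2 : v = wd (Ordinal iv) by rewrite /wd nth_index ?memW.
have := congr1 (fun M : 'M[K]_m => M (Ordinal iu) (Ordinal iv)) FXF.
rewrite -mulmxA mxE [X in _ = X]mxE -e1 -e2 => <-; apply: eq_bigr => j _.
rewrite mxE -e1 [X in _ * X]mxE; congr (_ * _).
by apply: eq_bigr => i _; rewrite [X in _ * X]mxE -e2.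
Qed.

(** Twists of homogeneous generators are multiples of them, so by the Leibniz rule the condition on
    derivatives passes from the generators to all products; iterating it gives every right leg of
    the coproduct. *)
Lemma gen_LCS S :
  (forall s, S s -> Bnich s) -> (forall s, S s -> exists n, homog n s) ->
  (forall s, S s -> exists p, homG p s) -> (forall s x, S s -> gen S (dl x s)) ->
  LCS t l (gen S).
Proof.
move=> hB hN hG hd.
have htw s y c : S s -> gen S (tw y c s).
  move=> hs; have [p hp] := hG s hs; have [k ->] := homG_tw y c hp.
  by apply: gen_scale; apply: gen_in.
have B f : gen S f -> Bnich f by apply: gen_sub.
split=> //.
- exact: gen_one.
- exact: gen_add.
- exact: gen_scale.
- exact: gen_mul.
- by move=> n f; apply: gen_nproj.
- by move=> w0 f; apply: gen_gproj.
move=> f hf; apply: coprod_inP => //.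
- exact: B.
- exact: gen_zero.
- exact: gen_add.
- exact: gen_scale.
- by move=> u; apply: dlwP hf => x g; apply: gen_dl.
Qed.
End Generation.

(** * Computation with noncommutative polynomials *)

(** A copy of the rack made for evaluation, since [rtri] passes through [inord] on ordinals. *)
Inductive letter := La | Lb | Lc | Ld.

Definition ol (x : letter) : rk :=
  match x with La => ra | Lb => rb | Lc => rc | Ld => rd end.

Definition leqb (x y : letter) : bool :=
  match x, y with La, La | Lb, Lb | Lc, Lc | Ld, Ld => true | _, _ => false end.

Definition ltri (x y : letter) : letter :=
  match x, y with
  | La, La => La | La, Lb => Lc | La, Lc => Ld | La, Ld => Lb
  | Lb, La => Ld | Lb, Lb => Lb | Lb, Lc => La | Lb, Ld => Lc
  | Lc, La => Lb | Lc, Lb => Ld | Lc, Lc => Lc | Lc, Ld => La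
  | Ld, La => Lc | Ld, Lb => La | Ld, Lc => Lb | Ld, Ld => Ld
  end.
Definition litri x y := ltri x (ltri x y).

Arguments litri : simpl never.

Definition letters := [:: La; Lb; Lc; Ld].

Lemma all_letters (P : pred letter) : all P letters -> forall x, P x.
Proof. by case/and5P => pa pb pc pd _ []. Qed.

Lemma ol_tri x y : ol (ltri x y) = rtri (ol x) (ol y).
Proof. by case: x; case: y; rewrite /= rtriE. Qed.

Lemma ol_itri x y : ol (litri x y) = irtri (ol x) (ol y).
Proof. by rewrite /litri !ol_tri. Qed.

Lemma ltriK x y : litri x (ltri x y) = y.
Proof. by case: x; case: y. Qed.

Lemma olP x : exists y, x = ol y.
Proof. by elim/rk_ind: x; [exists La|exists Lb|exists Lc|exists Ld]. Qed.

Lemma ol_eq x y : (ol x == ol y) = leqb x y.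
Proof. by case: x; case: y. Qed.

(* Coefficients [a + b tau] with [tau ^ 2 = p tau + q]. *)
Definition co := (Z * Z)%type.
Definition c0 : co := (Z0, Z0).
Definition c1 : co := (Zpos xH, Z0).
Definition cadd (x y : co) : co := (Z.add x.1 y.1, Z.add x.2 y.2).
Definition czero (x : co) : bool := (Z.eqb x.1 Z0 && Z.eqb x.2 Z0)%bool.

(* Tries represent noncommutative polynomials in the four letters, read either
   as shuffle products of letters ([evT]) or as functionals on words ([apT]). *)
Inductive trie := TE | TN of co & trie & trie & trie & trie.

Definition tcst T : co := if T is TN c _ _ _ _ then c else c0.
Definition sel (A : Type) (a b c d : A) (x : letter) : A :=
  match x with La => a | Lb => b | Lc => c | Ld => d end.

(** Zero leaves collapse to [TE], so cancellation in [tplus] becomes visible as an empty trie;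
    [rule_check] recognizes the zero form in this way. *)
Definition mkN (k : co) (a b c d : trie) : trie :=
  if (a, b, c, d) is (TE, TE, TE, TE) then
    if czero k then TE else TN k a b c d
  else TN k a b c d.

Fixpoint tplus (S T : trie) : trie :=
  match S, T with
  | TE, _ => T
  | _, TE => S
  | TN k a b c d, TN k' a' b' c' d' =>
      mkN (cadd k k') (tplus a a') (tplus b b') (tplus c c') (tplus d d')
  end.

Fixpoint homT (n : nat) T : bool :=
  if T is TN k a b c d then
    if n is m.+1 then [&& czero k, homT m a, homT m b, homT m c & homT m d]
    else if (a, b, c, d) is (TE, TE, TE, TE) then true else false
  else true.

Fixpoint letT (P : letter -> bool) T : bool :=
  if T is TN _ a b c d then
    all (fun x => P x || (if sel a b c d x is TE then true else false)) letters
    && [&& letT P a, letT P b, letT P c & letT P d]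
  else true.

Fixpoint wordT (k : co) (u : seq letter) : trie :=
  if u is x :: u' then
    let T := wordT k u' in
    match x with
    | La => mkN c0 T TE TE TE | Lb => mkN c0 TE T TE TE
    | Lc => mkN c0 TE TE T TE | Ld => mkN c0 TE TE TE T
    end
  else mkN k TE TE TE TE.

(** The most significant digit is the first letter. The length is a separate argument because
    leading digits 0 are letters [La]. *)
Fixpoint code_word (n : nat) (m : Z) : seq letter :=
  if n is n'.+1 then
    let (m', r) := Z.div_eucl m (Zpos 4) in
    rcons (code_word n' m') (match r with Z0 => La | Zpos xH => Lb | Zpos (xO xH) => Lc | _ => Ld end)
  else [::].

Definition list_trie (n : nat) (s : seq (Z * co)) : trie :=
  foldr (fun e T => tplus (wordT e.2 (code_word n e.1)) T) TE s.

(** * Derivatives, transposes and pairings of tries *)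

Section Engine.
Variables (p q : Z) (qt q1 ql qlt : co).

Definition cmul (x y : co) : co :=
  (Z.add (Z.mul x.1 y.1) (Z.mul q (Z.mul x.2 y.2)),
   Z.add (Z.add (Z.mul x.1 y.2) (Z.mul x.2 y.1)) (Z.mul p (Z.mul x.2 y.2))).

(** The table of [qc] with the values t, 1, l and l / t as parameters, so that the same computations
    serve (2), (3) and (4). *)
Definition qL (x y : letter) : co :=
  match x, y with
  | La, _ => qt
  | Lb, La => q1 | Lb, Lb => qt | Lb, Lc => ql | Lb, Ld => qlt
  | Lc, La => q1 | Lc, Lb => qlt | Lc, Lc => qt | Lc, Ld => ql
  | Ld, La => q1 | Ld, Lb => ql | Ld, Lc => qlt | Ld, Ld => qt
  end.

Local Arguments qL : simpl never.

Fixpoint tscal (k : co) T : trie :=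
  if T is TN m a b c d then
    mkN (cmul k m) (tscal k a) (tscal k b) (tscal k c) (tscal k d)
  else TE.

(** First-letter deletion performed directly on product expressions by [dl_vec_mul], without
    expanding the shuffles into words. *)
Fixpoint tder T (x : letter) : trie :=
  if T is TN _ a b c d then
    let s y U := tscal (qL y (litri y x)) (tder U (litri y x)) in
    tplus (sel a b c d x) (mkN c0 (s La a) (s Lb b) (s Lc c) (s Ld d))
  else TE.

(** The transpose of left multiplication by the letter [y], acting on functionals: [dl_vec_mul] read
    in the dual direction. *)
Fixpoint tdlt (y : letter) T : trie :=
  if T is TN _ a b c d then
    let r := sel (tdlt y a) (tdlt y b) (tdlt y c) (tdlt y d) in
    let s e := tscal (qL y e) (r (ltri y e)) in
    tplus (sel a b c d y) (mkN c0 (s La) (s Lb) (s Lc) (s Ld))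
  else TE.

(** A function supported in positive degree is zero when all its first-letter deletions are, and in
    degree 0 only the constant is left to test. *)
Fixpoint zeroT (n : nat) T : bool :=
  if T is TE then true else
  if n is m.+1 then all (fun x => zeroT m (tder T x)) letters
  else czero (tcst T).

(** Evaluating the functional on a product of [n] letters from [ys] amounts to applying the
    transposes of its factors one after another; products with a common beginning share the work. *)
Fixpoint vanT (ys : seq letter) (n : nat) T : bool :=
  if T is TE then true else
  if n is m.+1 then all (fun y => vanT ys m (tdlt y T)) ys
  else czero (tcst T).

(* The pairing of the functional [S] with the shuffle polynomial [T]. *)
Fixpoint pairT (S T : trie) : co :=
  match S, T with
  | TE, _ | _, TE => c0
  | _, TN k a b c d =>
      cadd (cmul (tcst S) k)
        (cadd (pairT (tdlt La S) a) (cadd (pairT (tdlt Lb S) b)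
          (cadd (pairT (tdlt Lc S) c) (pairT (tdlt Ld S) d))))
  end.

(** The derivative and [G] may differ as polynomials and agree only modulo the relations of the
    Nichols algebra, hence the test of their difference by [zeroT]. *)
Definition der_check n T G x : bool :=
  let U := tplus (tder T x) (tscal (Zneg xH, Z0) G) in homT n U && zeroT n U.

Section Semantics.
Variables (K : fieldType) (t l tau : K).
Hypotheses (ht : t != 0) (hl : l != 0) (hlt : l ^+ 2 = t ^+ 4).

Definition zK (z : Z) : K := (int_of_Z z)%:~R.
Definition cK (x : co) : K := zK x.1 + zK x.2 * tau.

Hypotheses (htau : tau ^+ 2 = zK p * tau + zK q)
  (hqt : cK qt = t) (hq1 : cK q1 = 1) (hql : cK ql = l) (hqlt : cK qlt = l / t).

Notation tens := (seq rk -> K).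
Notation qc := (qc t l).
Notation tmul := (tmul t l).
Notation "f ** g" := (tmul f g) (at level 40, left associativity).
Notation tone := (tone K).
Notation tzero := (@tzero K).
Notation tvec := (tvec K).
Notation gen := (gen t l).
Notation Bnich := (Bnich t l).
Implicit Types (f g h : tens) (S T : trie).

Lemma zKD x y : zK (Z.add x y) = zK x + zK y.
Proof. by rewrite -rmorphD -(rmorphD int_of_Z). Qed.

Lemma zKM x y : zK (Z.mul x y) = zK x * zK y.
Proof. by rewrite -rmorphM -(rmorphM int_of_Z). Qed.

Lemma cK0 : cK c0 = 0.
Proof. by rewrite /cK /= /zK /= mul0r addr0. Qed.

Lemma cK1 : cK c1 = 1.
Proof. by rewrite /cK /zK /= mul0r addr0. Qed.

Lemma cKD x y : cK (cadd x y) = cK x + cK y.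
Proof. by rewrite /cK /= !zKD; ring. Qed.

Lemma cKM x y : cK (cmul x y) = cK x * cK y.
Proof.
rewrite /cK /= !zKD !zKM.
transitivity (zK x.1 * zK y.1 + (zK x.1 * zK y.2 + zK x.2 * zK y.1) * tau +
  zK x.2 * zK y.2 * (zK p * tau + zK q)); first by ring.
by rewrite -htau; ring.
Qed.

Lemma czeroP x : czero x -> cK x = 0.
Proof.
case: x => a b; rewrite /czero /cK /= => /andP [/Z.eqb_eq -> /Z.eqb_eq ->].
by rewrite /zK /= mul0r addr0.
Qed.

Lemma qLE x y : cK (qL x y) = qc (ol x) (ol y).
Proof. by case: x; case: y. Qed.

Fixpoint evT T : tens :=
  if T is TN k a b c d then
    tadd (tscale (cK k) tone) (tadd (tvec ra ** evT a) (tadd (tvec rb ** evT b)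
      (tadd (tvec rc ** evT c) (tvec rd ** evT d))))
  else tzero.

Fixpoint apT T f : K :=
  if T is TN k a b c d then
    cK k * f [::] + (apT a (dl ra f) + (apT b (dl rb f) +
      (apT c (dl rc f) + apT d (dl rd f))))
  else 0.

Lemma tscale0l f : tscale 0 f = tzero.
Proof. by rewrite -tzeroE. Qed.

Lemma evT_mkN k a b c d : evT (mkN k a b c d) = evT (TN k a b c d).
Proof.
case: a; case: b; case: c; case: d => //=; rewrite /mkN.
case: ifP => // /czeroP h /=.
by rewrite h tscale0l !tmul0r !tadd0.
Qed.

Lemma apT_mkN k a b c d f : apT (mkN k a b c d) f = apT (TN k a b c d) f.
Proof.
case: a; case: b; case: c; case: d => //=; rewrite /mkN.
by case: ifP => // /czeroP h /=; rewrite h mul0r !addr0.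
Qed.

Let tadd5 (a b c d e a' b' c' d' e' : tens) :
  tadd (tadd a a') (tadd (tadd b b') (tadd (tadd c c') (tadd (tadd d d') (tadd e e')))) =
  tadd (tadd a (tadd b (tadd c (tadd d e)))) (tadd a' (tadd b' (tadd c' (tadd d' e')))).
Proof. by apply: functional_extensionality => w; rewrite /tadd; ring. Qed.

Lemma evT_plus S T : evT (tplus S T) = tadd (evT S) (evT T).
Proof.
elim: S T => [|k a IHa b IHb c IHc d IHd] [|k' a' b' c' d'].
- by rewrite tadd0.
- by rewrite t0add.
- by rewrite tadd0.
rewrite [tplus _ _]/= evT_mkN /= cKD IHa IHb IHc IHd !tmulDr tscaleDl.
exact: tadd5.
Qed.

Lemma apT_plus S T f : apT (tplus S T) f = apT S f + apT T f.
Proof.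
elim: S T f => [|k a IHa b IHb c IHc d IHd] [|k' a' b' c' d'] f.
- by rewrite addr0.
- by rewrite add0r.
- by rewrite addr0.
by rewrite [tplus _ _]/= apT_mkN /= cKD IHa IHb IHc IHd; ring.
Qed.

Lemma evT_scal k T : evT (tscal k T) = tscale (cK k) (evT T).
Proof.
elim: T => [|m a IHa b IHb c IHc d IHd]; first by rewrite tscale_r0.
by rewrite [tscal _ _]/= evT_mkN /= cKM IHa IHb IHc IHd !tmulZr -tscaleA -!tscaleDr.
Qed.

Lemma apT_scal k T f : apT (tscal k T) f = cK k * apT T f.
Proof.
elim: T f => [|m a IHa b IHb c IHc d IHd] f; first by rewrite mulr0.
by rewrite [tscal _ _]/= apT_mkN /= cKM IHa IHb IHc IHd; ring.
Qed.

Lemma apTD T f g : apT T (tadd f g) = apT T f + apT T g.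
Proof.
elim: T f g => [|k a IHa b IHb c IHc d IHd] f g /=; first by rewrite addr0.
rewrite -!/(tadd (dl _ f) (dl _ g)) [dl ra _]/(tadd (dl ra f) (dl ra g)).
rewrite [dl rb _]/(tadd (dl rb f) (dl rb g)) [dl rc _]/(tadd (dl rc f) (dl rc g)).
rewrite [dl rd _]/(tadd (dl rd f) (dl rd g)) IHa IHb IHc IHd /tadd; ring.
Qed.

Lemma apTZ T k f : apT T (tscale k f) = k * apT T f.
Proof.
elim: T f => [|m a IHa b IHb c IHc d IHd] f /=; first by rewrite mulr0.
rewrite [dl ra _]/(tscale k (dl ra f)) [dl rb _]/(tscale k (dl rb f)).
rewrite [dl rc _]/(tscale k (dl rc f)) [dl rd _]/(tscale k (dl rd f)).
by rewrite IHa IHb IHc IHd /tscale; ring.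
Qed.

Lemma apT0 T : apT T tzero = 0.
Proof. by rewrite (tzeroE tone) apTZ mul0r. Qed.

Lemma dlD x f g : dl x (tadd f g) = tadd (dl x f) (dl x g). Proof. by []. Qed.
Lemma dlZ x k f : dl x (tscale k f) = tscale k (dl x f). Proof. by []. Qed.

Lemma evT_tder T x : evT (tder T x) = dl (ol x) (evT T).
Proof.
elim: T x => [|k a IHa b IHb c IHc d IHd] x //.
rewrite [tder _ _]/= evT_plus evT_mkN /= !evT_scal IHa IHb IHc IHd !qLE !ol_itri.
rewrite !dlD dlZ dl_one tscale_r0 t0add !dl_vec_mul // cK0 tscale0l t0add !tmulZr /=.
apply: functional_extensionality => w; rewrite /tadd.
by case: x {IHa IHb IHc IHd} => /=; rewrite /tzero; ring.
Qed.

Lemma apT_tdlt T y f : apT (tdlt y T) f = apT T (tvec (ol y) ** f).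
Proof.
have e x g : dl (ol x) (tvec (ol y) ** g) = tadd (if leqb x y then g else tzero)
   (tscale (cK (qL y (litri y x))) (tvec (ol y) ** dl (ol (litri y x)) g)).
  by rewrite dl_vec_mul // ol_eq qLE ol_itri.
elim: T f => [|k a IHa b IHb c IHc d IHd] f //.
rewrite [tdlt _ _]/= apT_plus apT_mkN /= !apT_scal.
rewrite tmul_nil // mul0r mulr0 cK0 mul0r add0r add0r.
have := (e La f, e Lb f, e Lc f, e Ld f) => -[[[/= -> ->] ->] ->].
rewrite !apTD !apTZ -IHa -IHb -IHc -IHd.
by case: y {IHa IHb IHc IHd e} => /=; rewrite !apT0; ring.
Qed.

Lemma apT_one T : apT T tone = cK (tcst T).
Proof. by case: T => [|k a b c d] /=; rewrite ?cK0 // mulr1 !apT0 !addr0. Qed.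

Lemma evT_nil T : evT T [::] = cK (tcst T).
Proof.
case: T => [|k a b c d] /=; rewrite ?cK0 //.
by rewrite /tadd !tmul_nil // /tscale mulr1 !mul0r !addr0.
Qed.

Lemma evT_homog n T : homT n T -> homog n (evT T).
Proof.
elim: n T => [|n IH] [|k a b c d] //.
  move=> h w; have -> : TN k a b c d = TN k TE TE TE TE.
    by move: h; case: a; case: b; case: c; case: d.
  by rewrite /= !tmul0r !tadd0 /tscale /tone; case: w => //= *; rewrite mulr0.
move=> /and5P [/czeroP h0 ha hb hc hd]; rewrite /= h0 tscale0l t0add.
by do ![apply: homog_add]; apply: (@homog_mul _ _ _ 1 n); try exact: homog_vec; apply: IH.
Qed.

Lemma apT_homog m n T f : homT n T -> homog m f -> m != n -> apT T f = 0.
Proof.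
elim: n m T f => [|n IH] m [|k a b c d] f //=.
  move=> h hf ne; rewrite hf ?mulr0 ?add0r; last by rewrite eq_sym.
  by move: h; case: a; case: b; case: c; case: d => //= *; rewrite !addr0.
have hd x g : homog m g -> homog m.-1 (dl x g).
  by move=> hg w hw; apply: hg => /=; apply: contraNneq hw => <-.
case: m hd => [|m] hd' /and5P [/czeroP -> ha hb hc hd] hf ne.
  rewrite mul0r add0r -[dl ra f]/(dl ra f).
  have z x : dl x f = tzero.
    by apply: functional_extensionality => w; rewrite /dl hf.
  by rewrite !z !apT0 !addr0.
by rewrite mul0r !(IH m) ?addr0 //; exact: (hd' _ f).
Qed.

Lemma zeroT_ok n T : homT n T -> zeroT n T -> evT T = tzero.
Proof.
move=> hh hz; apply: functional_extensionality => w.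
have [e|ne] := eqVneq (size w) n; last exact: (evT_homog hh).
elim: n T w e hz {hh} => [|n IH] [|k a b c d] // w.
  by move/size0nil=> -> /= /czeroP h; rewrite -[LHS]/(evT (TN k a b c d) [::]) evT_nil.
case: w => // x w [e]; have [y ->] := olP x.
rewrite [zeroT _ _]/= => h.
rewrite -[LHS]/(dl (ol y) (evT (TN k a b c d)) w) -evT_tder; apply: IH => //.
by case/and5P: h => h1 h2 h3 h4 _; case: (y).
Qed.

Definition among (ys : seq letter) : letter -> bool := fun x => has (leqb x) ys.

Definition vecs (P : letter -> bool) f : Prop := exists2 y, P y & f = tvec (ol y).

Lemma inl_all (P : letter -> bool) ys y : all P ys -> among ys y -> P y.
Proof.
elim: ys => //= z zs IH /andP [hz hzs] /orP [|/(IH hzs) //].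
by case: y {IH hzs}; case: z hz.
Qed.

Lemma vanT_prodl ys n T s : vanT ys n T -> size s = n ->
  (forall i, (i < size s)%N -> vecs (among ys) (nth tone s i)) ->
  apT T (prodl t l s) = 0.
Proof.
elim: n T s => [|n IH] T [|f s] //=.
  by rewrite apT_one; case: T => [|k a b c d] /=; rewrite ?cK0 // => /czeroP.
case: T => [|k a b c d] // h [e] hs; have [//|y hy he] := hs 0%N.
have {}he : f = tvec (ol y) by [].
rewrite he -apT_tdlt; apply: IH => // [|i hi]; last exact: (hs i.+1).
exact: (inl_all h).
Qed.

Lemma vecs_homog P f : vecs P f -> homog 1 f.
Proof. by move=> [y _ ->]; apply: homog_vec. Qed.

Lemma vecs_prodl_homog P s :
  (forall i, (i < size s)%N -> vecs P (nth tone s i)) -> homog (size s) (prodl t l s).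
Proof.
elim: s => [|f s IH] hs; first by case.
apply: (@homog_mul _ _ _ 1 (size s)); first exact: (vecs_homog (hs 0%N isT)).
by apply: IH => i; apply: (hs i.+1).
Qed.

(** By homogeneity only products of exactly [n] letters can contribute, and [vanT] has tested all of
    these. *)
Lemma vanT_gen ys n T f : homT n T -> vanT ys n T -> gen (vecs (among ys)) f ->
  apT T f = 0.
Proof.
move=> hh hv /(gen_span ht hlt); elim=> [|k s g hs _ IH]; first exact: apT0.
rewrite apTD apTZ IH addr0; have [e|ne] := eqVneq (size s) n.
  by rewrite (vanT_prodl hv) ?mulr0.
by rewrite (apT_homog hh (vecs_prodl_homog hs)) ?mulr0.
Qed.

Lemma vanT_Bnich n T f : homT n T -> vanT letters n T -> Bnich f -> apT T f = 0.
Proof.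
move=> hh hv hf; apply: (vanT_gen hh hv); apply: gen_sub hf => s [x ->].
by apply: gen_in; have [y ->] := olP x; exists y => //; case: y.
Qed.

Lemma pairT_ok S T : cK (pairT S T) = apT S (evT T).
Proof.
elim: T S => [|k a IHa b IHb c IHc d IHd] S.
  by rewrite apT0 (_ : pairT S TE = c0) ?cK0 //; case: S.
transitivity (cK (cmul (tcst S) k) + (cK (pairT (tdlt La S) a) + (cK (pairT (tdlt Lb S) b) +
    (cK (pairT (tdlt Lc S) c) + cK (pairT (tdlt Ld S) d))))).
  case: S => [|m a' b' c' d'] /=; last by rewrite !cKD.
  rewrite cKM cK0 mul0r add0r.
  have e U : cK (pairT TE U) = 0 by case: U => *; rewrite /= cK0.
  by rewrite !e !addr0.
rewrite /= cKM IHa IHb IHc IHd !apT_tdlt !apTD apTZ apT_one.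
by rewrite mulrC.
Qed.

Lemma letT_gen P T : letT P T -> gen (vecs P) (evT T).
Proof.
elim: T => [|k a IHa b IHb c IHc d IHd]; first by move=> _; apply: gen_zero.
have e y U : P y || (if U is TE then true else false) -> gen (vecs P) (evT U) ->
    gen (vecs P) (tvec (ol y) ** evT U).
  case/orP => [hy|]; first by move=> h; apply: gen_mul => //; apply: gen_in; exists y.
  by case: U => // _ _; rewrite tmul0r; apply: gen_zero.
rewrite /= => /and5P [/and5P [ha hb hc hd _] /IHa ga /IHb gb /IHc gc /IHd gd].
apply: gen_add; first by apply: gen_scale; apply: gen_one.
apply: gen_add; first exact: (e La).
apply: gen_add; first exact: (e Lb).
by apply: gen_add; [apply: (e Lc)|apply: (e Ld)].
Qed.

Lemma evT_Bnich T : Bnich (evT T).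
Proof.
have h : letT xpredT T by elim: T => //= k a -> b -> c -> d ->.
by apply: gen_sub (letT_gen h) => s [y _ ->]; apply: Bnich_vec.
Qed.

Lemma apT_word k u f : apT (wordT k u) f = cK k * f (map ol u).
Proof.
elim: u f => [|x u IH] f; first by rewrite [wordT _ _]/= apT_mkN /= !addr0.
by rewrite [wordT _ _]/=; case: x; rewrite apT_mkN /= cK0 mul0r IH /dl /= ?add0r ?addr0.
Qed.

Lemma evT_word k u : evT (wordT k u) = tscale (cK k) (prodl t l [seq tvec (ol x) | x <- u]).
Proof.
elim: u => [|x u IH].
  by rewrite [wordT _ _]/= evT_mkN /= !tmul0r !tadd0.
by rewrite [wordT _ _]/=; case: x;
  rewrite evT_mkN /= cK0 tscale0l IH !tmul0r ?t0add ?tadd0 ?tmulZr.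
Qed.
End Semantics.
End Engine.

(** * The extension in degree 11 *)

(* Pairs of a word, read in base 4 with digits [a, b, c, d], and its coefficient. *)
Section ExtensionData.
Local Open Scope Z_scope.
Definition zeta_data : seq (Z * Z) :=
[:: (6, -19530); (26, 29085); (106, 239505); (169, 37578); (258, 8328); (342, 477266);
(405, 306477); (426, 479745); (613, 40641); (665, -7527); (678, -328539); (1034, -37383);
(1065, 3870); (1090, -89718); (1189, -240714); (1289, -106866); (1298, -62790);
(1350, -373714); (1370, -33670); (1622, 1952982); (1685, 505170); (1706, 428673);
(2454, -38814); (2649, -72774); (2662, 1301538); (2714, -417798); (4138, -327087);
(4197, -750552); (4249, -59640); (4262, 1381746); (4362, 316953); (4393, 348876);
(4418, -151362); (4517, -815760); (4758, -2360250); (5145, 599814); (5158, -1753650);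
(5194, -410445); (5225, 455184); (5382, 771830); (5402, 149395); (5482, -2620);
(5545, 205360); (5797, -319200); (6490, 345135); (6742, 3601770); (6805, 381280);
(6826, 91245); (9577, 28104); (9818, -350505); (10585, 43410); (10598, -2043270);
(10650, 781965); (10837, -135400); (10858, -278805); (10921, -32442); (16386, 11202);
(16470, -1559520); (16533, -325992); (16554, -309030); (16677, -765756); (16713, -585792);
(16722, 39300); (16790, -4525068); (16985, 393408); (16998, -2525448); (17050, 720852);
(17450, 250647); (17509, -525624); (17561, 654528); (17574, 644232); (17674, 155592);
(17705, 706896); (17730, -169128); (17829, -649980); (18070, -6126120); (18793, -317340);
(19034, -634320); (20502, 1819140); (20569, -802476); (20582, 4511520); (20634, -228420);
(20778, -439635); (20837, -732264); (20889, -509028); (20902, 4122552); (21097, -725472);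
(21510, -862280); (21530, -656120); (21610, -585315); (21673, -401448); (21762, 126030);
(21846, -4656); (21909, -152100); (21930, -209400); (22117, -434520); (22169, 54000);
(22182, 1656360); (22949, -377640); (23190, -3562920); (25941, 19536); (25962, 61905);
(26025, 253512); (26277, -72720); (26970, 1028700); (27222, 3057600); (27285, 112560);
(27306, -159165); (38245, 56100); (38297, -42972); (38310, -998808); (38505, -2088);
(39253, -48336); (39274, -359715); (39337, -75528); (39589, 27900); (42329, 32112);
(42342, 1472688); (42394, -854388); (42581, 88608); (42602, 168423); (42665, 93456);
(43350, -939780); (43413, -54972); (43434, 59217); (43621, -912); (43673, 3246);
(65546, 6354); (65577, -110556); (65602, 90510); (65701, 291312); (65801, 207504);
(65810, 402792); (65862, 1393776); (65882, 629000); (66134, -2139864); (66197, -465120);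
(66218, -194655); (66597, -691560); (66633, -616752); (66642, 517716); (66710, -5341932);
(66841, 410868); (66854, -4285656); (66890, -1002552); (66921, -29160); (67162, 906228);
(67929, -223380); (67942, 4613904); (67994, -851256); (68181, 414360); (68202, 832518);
(68265, 154152); (69634, -89100); (69718, 14040); (69781, 685008); (69802, 947190);
(69925, 482904); (69961, -82368); (69970, 474648); (70038, -3925488); (70233, -484560);
(70246, 6082296); (70298, -1740864); (70698, -1544922); (70757, -415944); (70809, -124740);
(70822, 4617720); (70922, 1194288); (70953, 302184); (70978, -373122); (71077, -144900);
(71318, -5561640); (72041, -53100); (72282, 114660); (75109, 307224); (75161, 111132);
(75174, -3753504); (75369, 232776); (76117, -199512); (76138, -942390); (76201, -299016);
(76453, 576); (81938, -366570); (81990, -1853904); (82010, -1684980); (82198, -3348036);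
(82265, 311184); (82278, -5102640); (82330, -2077560); (82517, -321192); (82538, -1190790);
(82601, -293040); (82946, 277470); (83030, -2583144); (83093, -409032); (83114, -33810);
(83237, -282564); (83273, -169416); (83282, 192462); (83350, -4236204); (83545, 142776);
(83558, -3556848); (83610, -1026768); (84325, 375624); (84377, 103860); (84390, -4510584);
(84585, 380232); (86022, 851290); (86042, 1617640); (86122, 1883070); (86185, 279480);
(86274, -442920); (86358, -723486); (86421, 115320); (86442, 933390); (86629, 139872);
(86681, -44340); (86694, -1755888); (87050, -527990); (87081, -135090); (87106, 386910);
(87205, -5868); (87305, 27792); (87314, -176652); (87366, 33090); (87638, -750060);
(87701, 35568); (87722, 215440); (88470, -2660040); (88665, -48312); (88730, -202480);
(91557, -45072); (91798, -3479760); (92521, -121932); (92762, -685200); (103766, 45696);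
(103829, -76848); (103850, -128850); (104037, -162816); (104089, 21036); (104102, 1045512);
(104869, -51768); (105110, -1979640); (107861, 49536); (107882, 260310); (107945, 246528);
(108197, 77040); (108890, 1116080); (109142, 1092000); (109226, -152670); (152982, 333528);
(153177, 51876); (153190, 421080); (153242, -469188); (153957, -23436); (154009, 58464);
(154022, 272808); (154217, -63972); (157014, -324984); (157077, 624); (157098, 26130);
(157285, -77568); (157337, 88644); (157350, 270504); (158117, 78768); (158358, -409860);
(169305, -33858); (169318, -358416); (169370, 697056); (169557, -15516); (169578, 25074);
(169641, -111852); (170326, 638808); (170389, -26016); (170410, -213594); (170597, 27624);
(170649, 13440); (170662, 50904); (173402, -443840); (173654, -649692); (173738, 138354);
(174486, 320448); (174681, -7614); (174694, -67056); (262186, 5220); (262245, 227520);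
(262297, -6588); (262310, -159768); (262410, -19350); (262441, -324756); (262466, 61236);
(262565, 409644); (262806, 615348); (263193, -533844); (263206, 335952); (263242, -21384);
(263273, -990684); (263430, -475152); (263450, 225744); (263530, 307440); (263593, -900000);
(263845, 354240); (264538, -1053576); (264790, -1080360); (264853, -127440); (264874, 128664);
(266277, -224820); (266313, -535032); (266322, 255852); (266390, -1438380); (266521, -518400);
(266534, -1066968); (266570, -378792); (266601, -1128276); (266842, -2032488);
(267286, 1017648); (267353, -556956); (267366, 731016); (267418, -904248); (267562, 74664);
(267621, -65880); (267673, -482760); (267881, -1124280); (268629, -44424); (268650, 860184);
(268713, -1063800); (268965, 127980); (271705, 66204); (271718, -547632); (271770, 2224080);
(271957, -79416); (271978, 517824); (272041, -356400); (272726, 992340); (272789, 92844);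
(272810, -74178); (272997, -113796); (273049, 155394); (273062, -18360); (278538, 17460);
(278569, 195804); (278594, -77184); (278693, -190728); (278793, -303264); (278802, 264672);
(278854, -187488); (279126, 1523376); (279189, 153360); (279210, -7497); (279589, 226440);
(279625, 82080); (279634, 291744); (279702, 863568); (279833, -353268); (279846, -359136);
(279882, -315072); (279913, -537084); (280154, -2045376); (280921, 251100);
(280934, -1297872); (280986, 2317032); (281173, -33480); (281194, -271656); (282710, -841392);
(282773, -45576); (282794, -179550); (282917, -146808); (282953, -228744); (282962, 285480);
(283030, -805176); (283225, 432756); (283238, -546048); (283290, 1331856); (283690, -13428);
(283749, -50832); (283801, 403884); (283814, 454320); (283914, 224442); (283945, 179388);
(283970, -128664); (284069, -45792); (284310, -350712); (285033, -572292); (285274, -2775492);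
(288101, 37224); (288153, -300708); (288166, 419400); (288361, -569592); (289109, -63720);
(289130, 1010988); (289193, -599616); (289445, 1152); (300438, 683136); (300633, -107460);
(300646, 392688); (300698, -1799928); (301413, -109656); (301465, 35064); (301478, -443736);
(301673, -505656); (304470, -453024); (304533, 9936); (304554, -176742); (304741, 53856);
(304793, -228564); (304806, 24336); (327705, -1156464); (327754, 1360962); (327785, -2738340);
(327942, 2977584); (327962, 4979928); (328042, 3697200); (328105, -3423600);
(328357, 1225440); (328713, 1156464); (328722, 2931768); (328774, 5619312); (328794, 6774012);
(328982, 5742504); (329049, 1199880); (329062, 5697504); (329114, 5917536); (329301, -443232);
(329322, 3618324); (329385, -2379240); (330070, -1901772); (330133, 676188); (330154, 892026);
(330341, -1782972); (330393, 1560168); (330406, -1272852); (331786, -1320282);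
(331817, 2792664); (331842, 2808144); (331941, -3564648); (332041, -3489696);
(332050, -13968); (332102, 5375232); (332122, 4052088); (332374, -5802048); (332437, 2322000);
(332458, 143325); (332837, 3494340); (332873, 3474144); (332882, 2805120); (332950, -8047152);
(333081, -1194156); (333094, -5337720); (333130, -1335330); (333161, -87426);
(333402, 3059784); (334169, 1217700); (334182, 5270400); (334234, 3698568);
(334421, -1017360); (334442, 1221768); (334505, -869184); (337302, 3246264);
(337497, 1111104); (337510, 671472); (337562, 494532); (338277, 1107540); (338329, -934200);
(338342, 2338020); (338537, 925452); (344070, -1409840); (344090, -3156910);
(344170, -3795840); (344233, 1377360); (344322, 1394568); (344406, 229308); (344469, 1558980);
(344490, -2411730); (344677, 1716660); (344729, -1523880); (344742, 3233220);
(345098, 1999728); (345129, -1600776); (345154, -1516320); (345253, 59832); (345353, -15120);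
(345362, 1519488); (345414, 1198176); (345434, 897042); (345686, -1060968); (345749, 2177280);
(345770, -764343); (346518, 3998040); (346713, -108432); (346726, -3530136); (346778, 536904);
(348202, 1155780); (348261, -3399300); (348313, -122310); (348326, -3887100);
(348426, -1977282); (348457, 1662444); (348482, 1364832); (348581, -3450168);
(348822, 3744936); (349209, 2351646); (349222, 2557404); (349258, 689076); (349289, 1771524);
(349446, -1222032); (349466, -609102); (349546, -131136); (349609, 650352);
(349861, -1282656); (350554, 634716); (350806, -1591704); (350869, 1247760); (350890, -55284);
(353641, -267660); (353882, 417024); (354649, 819270); (354662, 2262636); (354714, 590760);
(354901, -581760); (354922, 144360); (354985, -120864); (365989, 364320); (366230, -1306872);
(366953, 380700); (367194, -761184); (370021, -321660); (370073, -129330); (370086, -810324);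
(370281, -568080); (371029, 83856); (371050, 79920); (371365, -4644); (415066, 46632);
(415318, -142824); (415381, 15840); (415402, -95499); (416150, -233976); (416345, 45468);
(416358, -186384); (416410, 601224); (419237, -24840); (419478, -82800); (420201, -191700);
(420442, -1221336); (431446, 60732); (431509, -23940); (431530, 222390); (431717, -80460);
(431769, 126630); (431782, -378504); (432549, -31320); (432790, 149112); (435541, 15648);
(435562, -174480); (435625, 172080); (436570, 735120); (436885, 2496); (436906, -55755);
(611689, 702); (611930, 265212); (612697, -17928); (612710, 153000); (612762, 351072);
(612949, -1224); (612970, 97776); (613033, -38736); (615830, -216); (616025, -6912);
(616038, 99648); (616090, 289692); (616805, 31968); (616857, -56700); (616870, 376308);
(617065, 61884); (628058, -233160); (628310, -66720); (628373, 7344); (628394, 167301);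
(629142, -199776); (629337, -23544); (629350, 262464); (629402, 128904); (632229, -4104);
(632470, 148464); (633193, -49356); (633434, -279468); (677209, 10044); (677222, -62424);
(677274, -309852); (677461, 3168); (677482, -54468); (677545, 63720); (678230, -37836);
(678293, 7668); (678314, 73998); (678501, 28728); (678553, -33642); (678566, 121464);
(681306, 466320); (681558, -23016); (681621, 8640); (681642, -158121); (682390, 117744);
(682585, 15228); (682598, -76080); (682650, 66120); (693589, -2064); (693610, 4860);
(693673, -48720); (693925, 900); (694618, -466320); (694954, 55755); (697705, 15300);
(697946, 233160); (698778, -46632); (698965, -624); (1048662, 364536); (1048725, -117828);
(1048746, -117288); (1048869, -530424); (1048905, -674568); (1048914, -373416);
(1048982, 1054296); (1049177, 449712); (1049242, 388404); (1049642, 449316);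
(1049701, -656280); (1049753, 788616); (1049766, -1036584); (1049866, -723060);
(1049897, 915624); (1049922, 547860); (1050021, -913140); (1050262, 1524420);
(1050985, -590976); (1051226, -333360); (1052694, -1101960); (1052761, -1189728);
(1052774, -2146176); (1052826, -774216); (1052970, -152352); (1053029, -1144080);
(1053081, -1316736); (1053094, -1974456); (1053289, -1168992); (1053702, 1085040);
(1053722, 1157460); (1053802, 615636); (1053865, -424656); (1053954, -350160);
(1054038, 36432); (1054101, -369000); (1054122, 142680); (1054309, -965160);
(1054361, -518400); (1054374, -842760); (1055141, -947520); (1055382, 952560);
(1058133, 60372); (1058154, -346284); (1058217, 223344); (1058469, -300960);
(1059162, -204840); (1059414, -294480); (1059477, 125820); (1059498, 80964);
(1064997, 175320); (1065033, 300024); (1065042, 414684); (1065110, -573588);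
(1065241, -439344); (1065254, -1189944); (1065290, -338688); (1065321, -265680);
(1065562, -146628); (1066006, -59400); (1066073, -1053000); (1066086, -904824);
(1066138, -65304); (1066282, -146340); (1066341, -695880); (1066393, -1518264);
(1066406, -909144); (1066601, -609768); (1067349, 290952); (1067370, -203580);
(1067433, -163512); (1067685, 10080); (1069065, 17820); (1069074, -238536);
(1069126, -778680); (1069146, -37980); (1069334, -876960); (1069401, -840672);
(1069414, -1111320); (1069466, -74160); (1069653, 586440); (1069674, 318492);
(1069737, -104976); (1070082, 77820); (1070166, -344160); (1070229, 643680);
(1070250, 272448); (1070373, 416340); (1070409, 154872); (1070418, 26352); (1070486, -343656);
(1070681, -766260); (1070694, -667224); (1070746, -95580); (1071461, -616140);
(1071513, -1271700); (1071526, -474336); (1071721, -270540); (1074518, 135144);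
(1074581, -401760); (1074602, -5652); (1074789, -451440); (1074841, -824580);
(1074854, -120744); (1075621, -366120); (1075862, 205740); (1086809, 87480); (1086822, 36504);
(1086874, -244224); (1087061, -150660); (1087082, 309636); (1087145, 146124);
(1087830, -5256); (1087893, -12960); (1087914, 325800); (1088101, -209520);
(1088153, -134460); (1088166, -18576); (1090906, 489960); (1091158, 116244);
(1091221, -191160); (1091242, -147348); (1091990, -55116); (1092185, 127170);
(1092198, 64224); (1114154, 91260); (1114213, -394992); (1114265, 104220); (1114278, -211356);
(1114378, -245088); (1114409, 542700); (1114434, 234108); (1114533, -746496);
(1114774, 321408); (1115161, 802980); (1115174, 360936); (1115210, 106200);
(1115241, 1133460); (1115398, -586980); (1115418, -666792); (1115498, -268560);
(1115561, 838080); (1115813, -721440); (1116506, 1147248); (1116758, -252720);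
(1116821, 151920); (1116842, -172962); (1118245, 402408); (1118281, 885600);
(1118290, 429840); (1118358, -551880); (1118489, 582120); (1118502, -706752);
(1118538, -293472); (1118569, 849420); (1118810, 1128384); (1119254, 431460);
(1119321, 508356); (1119334, 184248); (1119386, 388296); (1119530, -116496);
(1119589, 122616); (1119641, 66528); (1119654, -41256); (1119849, 562464); (1120597, 42480);
(1120618, -490536); (1120681, 448416); (1120933, -321120); (1123673, 108756);
(1123686, -74520); (1123738, -1017864); (1123925, -69840); (1123946, -162648);
(1124009, 443664); (1124694, 25380); (1124757, -70920); (1124778, 223344); (1124965, 207000);
(1125017, -134280); (1125030, 25560); (1130506, 42984); (1130537, -223020); (1130562, -93816);
(1130661, 387720); (1130761, 410400); (1130770, 158544); (1130822, -80136);
(1130842, -504180); (1131094, -5616); (1131157, -254880); (1131178, 207360);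
(1131557, -429912); (1131593, -170640); (1131602, 122256); (1131670, -31968);
(1131801, 216000); (1131814, -203040); (1131850, -34920); (1131881, 100980);
(1132122, -383256); (1132889, 83376); (1132902, 176472); (1132954, -551016); (1133141, 23760);
(1133162, -196020); (1133225, 141912); (1134594, 2616); (1134678, -33660); (1134741, 166320);
(1134762, -163440); (1134885, 334728); (1134921, 300240); (1134930, 152856);
(1134998, -56016); (1135193, -27540); (1135206, 281592); (1135258, -27720); (1135658, 16668);
(1135717, -41616); (1135769, -117792); (1135782, 237312); (1135882, 97236);
(1135913, -106812); (1135938, -72648); (1136037, 32076); (1136278, -61992); (1137001, 30996);
(1137242, -75672); (1140069, 3600); (1140121, -324720); (1140134, -33336); (1140329, 33264);
(1141077, 59400); (1141098, -381672); (1141161, -74520); (1141413, -33120); (1152406, -91656);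
(1152601, -188460); (1152614, -68328); (1152666, 260136); (1153381, -15840);
(1153433, -464040); (1153446, 41832); (1153641, 109296); (1156438, 160380);
(1156501, -150120); (1156522, 135648); (1156709, -8280); (1156761, -329040);
(1156774, 124344); (1157782, -648); (1201513, 39852); (1201754, 442872); (1202521, -160704);
(1202534, 62856); (1202586, 260280); (1202773, 106920); (1202794, -196884);
(1202857, -139968); (1205654, 175104); (1205849, 90720); (1205862, -2016); (1205914, -145728);
(1206629, -15120); (1206681, -398520); (1206694, 158760); (1206889, 89424);
(1217882, -270252); (1218134, -40824); (1218197, 105300); (1218218, 73008);
(1218966, -179784); (1219161, -254340); (1219174, -3744); (1219226, -21528); (1222053, 34020);
(1223258, 324); (1310742, 283176); (1310809, 625644); (1310822, 850392); (1310874, 82944);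
(1311018, -163728); (1311077, 775440); (1311129, 1029780); (1311142, 1386180);
(1311337, 319680); (1311750, -561600); (1311770, -736224); (1311850, -956232);
(1311913, 109620); (1312002, 282240); (1312086, -103296); (1312149, 525960);
(1312170, -766080); (1312357, 970920); (1312409, 745200); (1312422, 1426680);
(1313189, 498960); (1313430, -703440); (1314841, -581580); (1314854, -684504);
(1314890, -529956); (1314921, -346680); (1315078, -2160); (1315098, -1087416);
(1315178, -1595808); (1315241, 127980); (1315493, -8640); (1315849, 38880);
(1315858, -614304); (1315910, -1131840); (1315930, -1270440); (1316118, -541800);
(1316185, -104598); (1316198, -542484); (1316250, -1058256); (1316437, 224208);
(1316458, -1611684); (1316521, 131220); (1317206, -189864); (1317269, 408888);
(1317290, -1163916); (1317477, 570888); (1317529, 301968); (1317542, 864648); (1320282, 7020);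
(1320534, -606204); (1320597, 408240); (1320618, -247752); (1321366, 751356);
(1321561, -367740); (1321574, -731484); (1321626, 209376); (1327146, 270648);
(1327205, -919872); (1327257, -286200); (1327270, -1286496); (1327370, -798696);
(1327401, 685800); (1327426, 840888); (1327525, -1478736); (1327766, 1860408);
(1328153, 1447200); (1328166, 1792368); (1328202, -46296); (1328233, 1653480);
(1328390, -1641600); (1328410, -1697400); (1328490, -1301832); (1328553, 899100);
(1328805, -989280); (1329498, 971424); (1329750, -1089720); (1329813, 324000);
(1329834, 48510); (1331237, 477000); (1331273, 886680); (1331282, 864108);
(1331350, -1669140); (1331481, 332100); (1331494, -1772496); (1331530, -843084);
(1331561, 667980); (1331802, 1790172); (1332246, 768600); (1332313, 408672);
(1332326, 451656); (1332378, 1265256); (1332522, 316044); (1332581, 69408); (1332633, 158112);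
(1332646, -69984); (1332841, 356076); (1333589, 54648); (1333610, -1271016);
(1333673, 289764); (1333925, -214560); (1336665, -4860); (1336678, -297000);
(1336730, -952560); (1336917, 115128); (1336938, -1006632); (1337001, 109836);
(1337686, -55080); (1337749, 101088); (1337770, -758772); (1337957, 200448); (1338009, 96228);
(1338022, 251856); (1348969, 156330); (1349210, -30780); (1349977, -364176);
(1349990, -640440); (1350042, 238536); (1350229, 183600); (1350250, -725544);
(1350313, -68364); (1353110, -154440); (1353305, 368388); (1353318, 543240);
(1353370, -487980); (1354085, -57780); (1354137, -188892); (1354150, -246780);
(1376262, -220764); (1376282, -676444); (1376362, -1028640); (1376425, 547680);
(1376514, 218220); (1376598, 446000); (1376661, -673740); (1376682, -826740);
(1376869, 243780); (1376921, -1454700); (1376934, 561420); (1377290, 662256);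
(1377321, -1518840); (1377346, -656820); (1377445, 1328040); (1377545, 1418400);
(1377554, 625284); (1377606, -239100); (1377626, 107760); (1377878, 1053720);
(1377941, -1404360); (1377962, -288000); (1378710, 669240); (1378905, 1825020);
(1378918, -298800); (1378970, 435000); (1380394, 631908); (1380453, 1699968);
(1380505, 2177400); (1380518, -735216); (1380618, -691164); (1380649, 117720);
(1380674, -13392); (1380773, 2669904); (1381014, -167832); (1381401, -2835180);
(1381414, -87048); (1381450, 654948); (1381481, -2876760); (1381638, 915360);
(1381658, 604236); (1381738, 147692); (1381801, -1323980); (1382053, 1830720);
(1382746, -48468); (1382998, 1223160); (1383061, -1269440); (1383082, 11622);
(1385833, 1179960); (1386074, 536988); (1386841, -1215708); (1386854, -326160);
(1386906, -199788); (1387093, 340580); (1387114, -18408); (1387177, -28728); (1392642, 636);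
(1392726, -1316720); (1392789, 908520); (1392810, 348300); (1392933, 2719440);
(1392969, 2791440); (1392978, 897036); (1393046, -2877300); (1393241, -3017430);
(1393254, -202500); (1393306, -1097460); (1393706, -1065252); (1393765, 1867008);
(1393817, -3880140); (1393830, 1750584); (1393930, 1344600); (1393961, -2839770);
(1393986, -906432); (1394085, 2764584); (1394326, -2790792); (1395049, 2989890);
(1395290, 1111644); (1396758, 1858416); (1396825, 2834694); (1396838, 2776428);
(1396890, 1212372); (1397034, 188772); (1397093, 1836624); (1397145, 1891308);
(1397158, 1812360); (1397353, 2870172); (1397766, -1220192); (1397786, -1322340);
(1397866, -662292); (1397929, 943062); (1398018, 304016); (1398165, 275256);
(1398186, -146536); (1398373, 1096704); (1398438, 587392); (1399205, 1636416);
(1399446, -899136); (1402197, -7152); (1402218, 64590); (1402281, -977946);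
(1402533, 1083744); (1403226, -287292); (1403478, 657040); (1403541, -463080);
(1403562, 33546); (1414501, -83832); (1414553, -467988); (1414566, -19800);
(1414761, -652572); (1415509, 94752); (1415530, -231780); (1415593, -450492);
(1415845, 270936); (1418585, 334386); (1418598, 223284); (1418650, -108396);
(1418837, -192060); (1418858, -108516); (1418921, -78792); (1419606, -255880);
(1419669, 291360); (1419690, -188004); (1419877, -191880); (1419929, 118656);
(1463717, 25200); (1463958, -30960); (1464681, -55620); (1464922, 102780); (1467749, -29520);
(1467801, -220860); (1467814, -139320); (1468009, -79380); (1468757, 37584);
(1468778, -558900); (1468841, -48276); (1469093, 4320); (1480086, -52200); (1480281, -115830);
(1480294, -143100); (1480346, 375948); (1481061, 23220); (1481113, -21600); (1481126, 44280);
(1481321, 37800); (1484118, 83136); (1484181, -38880); (1484202, 282240); (1484389, 8640);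
(1484441, -86400); (1485462, 6156); (1660266, 16218); (1660329, -24012); (1660581, 34560);
(1661274, -105216); (1661526, 18000); (1661589, -18000); (1661610, -35334); (1664361, 34560);
(1664602, -126600); (1665369, 17712); (1665382, 1080); (1665434, -132072); (1665621, -11520);
(1665642, 138492); (1665705, 29592); (1676709, -51120); (1676950, 79920); (1677673, -101520);
(1677914, -79632); (1680741, 18720); (1680793, -121500); (1680806, 36720); (1681001, 71820);
(1681749, 16416); (1681770, -266760); (1681833, -34884); (1682085, 2160); (1725786, 47376);
(1726038, 35460); (1726101, -5940); (1726122, 99360); (1726870, 68580); (1727065, 41310);
(1727078, 39960); (1727130, -170352); (1729957, 27540); (1730198, 17280); (1730921, 51840);
(1731162, 85572); (1742166, -29712); (1742229, 15120); (1742250, -146280); (1742437, -10800);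
(1742489, 36720); (1742502, -32040); (1743269, 2160); (1746261, -5040); (1746282, 168390);
(1747542, -2184); (1747605, -720); (1747626, -7686); (2446693, -1188); (2446745, -8316);
(2446953, -23760); (2447701, 1188); (2447722, 79326); (2447785, -35640); (2448037, 18180);
(2450777, 18036); (2450790, 10152); (2450842, 101880); (2451029, -9072); (2451050, 129528);
(2451113, -29700); (2451798, -17424); (2451861, 26568); (2451882, 85896); (2452069, -31392);
(2452121, 34308); (2452134, 1944); (2463081, 31374); (2463322, 31860); (2464089, -14580);
(2464102, 20304); (2464154, 70128); (2464362, 116280); (2464425, -13068); (2467222, 31968);
(2467417, 79704); (2467482, 171792); (2468197, 19440); (2468249, -34236); (2468262, -10908);
(2468457, 27216); (2512234, -63108); (2512297, 35388); (2512549, -34560); (2513242, 6816);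
(2513494, -40176); (2513557, 25560); (2513578, 52506); (2516329, -55296); (2516570, -99888);
(2517337, 40716); (2517350, 10152); (2517402, 141384); (2517589, -9360); (2517610, 11304);
(2517673, -2376); (2528677, 21960); (2528918, -11664); (2529641, 67824); (2529882, 85896);
(2532709, -3600); (2532761, 7020); (2532774, 15984); (2532969, -21276); (2533717, 1404);
(2533738, -62694); (2533801, 5508); (2708825, -3672); (2708838, -918); (2708890, -33966);
(2709077, 1566); (2709098, -100800); (2709161, 11880); (2709846, -1584); (2709909, -8424);
(2709930, -84870); (2710117, 7236); (2710169, -26784); (2710182, -13824); (2712922, -12492);
(2713174, -17604); (2713258, -666); (2714006, -7884); (2714201, 21870); (2714214, 3456);
(2714266, 41724); (2725226, 114606); (2725289, -29952); (2725541, 13500); (2726234, -29112);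
(2726549, -6840); (2726570, -31500); (2729321, 29160); (2729562, 50988); (2730329, -9828);
(2730394, -34584); (2730581, 1170); (2730602, 18630); (2774358, 3696); (2774421, 720);
(2774442, 32460); (2774629, 3600); (2774681, 11520); (2774694, 16440); (2775702, -2880);
(2778474, -108864); (2778537, 14688); (2778789, -2160); (2779797, 720); (2779818, 7686);
(2790757, -1440); (2790809, -2340); (2790822, -7020); (2791786, 52506); (2791849, -3132);
(2795114, -10188); (2795862, 546)].

Definition zeta_da_data : seq (Z * Z) :=
[:: (1, 59910); (64, -64860); (85, -530623); (272, 146250); (324, -219870); (337, 53854);
(1104, -187830); (1345, -132110); (4096, 4950); (4117, 937712); (4180, -39300);
(4432, -57000); (5125, -484740); (5377, 34120); (5440, 62410); (5461, 130740); (16400, 22554);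
(16452, 49464); (16465, -151536); (16660, 160668); (17408, -7812); (17429, -669888);
(17492, -22392); (17744, 33930); (20484, 27378); (20497, 385536); (20549, 1036404);
(20736, -35190); (20757, 1388088); (20820, -79398); (21505, -248770); (21568, 119880);
(21589, 205974); (21776, -144630); (21828, 79740); (21841, -16938); (65616, -32724);
(65857, 305304); (66580, -198828); (66821, -737496); (69648, 58176); (69700, -226656);
(69713, 168480); (69908, -234720); (70677, 722160); (70740, -228456); (70992, 100152);
(81985, -2841216); (82180, -2817720); (82193, -5324256); (82245, -5438808); (82960, -2713104);
(83012, 51984); (83025, -5099184); (83220, -2691072); (86017, 1345376); (86080, -1337544);
(86101, -1781736); (86288, 1440288); (86340, -1424448); (86353, -1137840); (87120, -1307808);
(87361, 1182360); (262165, -420228); (262228, 468816); (262480, -738660); (263173, 1603080);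
(263425, -1603440); (263488, 540960); (263509, 322596); (266260, -700884); (266501, -50760);
(267268, 524736); (267281, 1475280); (267333, 1521720); (267520, -173220); (267541, -158040);
(267604, -26352); (278608, -91008); (278849, 319680); (279572, -429840); (279813, -326160);
(282640, 36576); (282692, -330264); (282705, -101304); (282900, -293976); (283648, 16464);
(283669, -20880); (283732, -210096); (283984, 101268); (327685, -45576); (327937, -97200);
(328000, 138960); (328021, -437064); (328769, -548640); (328964, -649296); (328977, -844560);
(329029, -464760); (331856, 422712); (332097, -885600); (332820, 399492); (333061, 788760);
(344065, 431364); (344128, -428820); (344149, -229460); (344336, 1288620); (344388, -1257084);
(344401, 395700); (345168, 13392); (345409, -1703760); (348160, -636); (348181, 1599800);
(348244, -1318236); (348496, 1327632); (349189, -3165936); (349441, 1904192);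
(349504, -444416); (349525, -268104)].

Definition zeta_db_data : seq (Z * Z) :=
[:: (16, -29088); (68, -145440); (81, -265248); (276, -290880); (1024, 29088); (1045, 917304);
(1108, -290880); (1360, 218160); (4100, 203616); (4113, 675936); (4165, 1877148);
(4352, -145440); (4373, 1563288); (4436, -145440); (5121, -439776); (5184, 290880);
(5205, 1232088); (5392, -290880); (5444, 145440); (5457, -29088); (16404, 174528);
(16645, 1156104); (17412, -145440); (17425, 145440); (17477, 286344); (17685, 1249128);
(17748, -29088); (20545, 443232); (20740, 290880); (20753, 595584); (20805, 1065924);
(21520, 145440); (21585, 297792); (21780, 72720); (65557, -211824); (65620, -21960);
(65872, 43920); (66565, 135108); (66817, 117936); (66880, -43920); (66901, 110304);
(69652, 65880); (69893, -240840); (70660, -65880); (70673, -169992); (70725, 33264);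
(70912, 21960); (70933, 41400); (82000, -32940); (82241, 78084); (83205, -3530088);
(86032, 13176); (86084, 39528); (86097, 65232); (86292, 39528); (87040, -4392);
(87061, 3389904); (87124, 13176); (87376, -6588); (262148, -50544); (262161, -296784);
(262213, -194616); (262400, 50544); (262421, -286200); (262484, 84240); (263169, 347328);
(263232, -202176); (263253, 457920); (263440, 303264); (263492, -202176); (263505, 39744);
(266245, 341064); (266497, -378432); (266581, 141264); (267329, 567648); (267524, 336960);
(267537, 295488); (267589, -237492); (278549, 933552); (278612, -336960); (278864, 505440);
(279557, -1572264); (279809, 1010880); (279872, -336960); (279893, -205560); (282644, 505440);
(282885, 661176); (283652, -336960); (283665, -717120); (283717, -902664); (283904, 84240);
(283925, -94320); (327681, 100620); (327744, -140868); (327765, -359880); (327952, 140868);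
(328004, -704340); (328017, -661140); (328784, -845208); (329025, 1343880); (331776, 40248);
(331797, -825888); (332112, -563472); (332805, 2217960); (333057, -1835040); (333120, 469560);
(333141, -123336); (344080, 281736); (344132, 1126944); (344145, 2752560); (344340, 1690416);
(345088, -241488); (345109, -1733088); (345172, 1126944); (345424, -845208);
(348164, -845208); (348177, -3337632); (348229, -7711488); (348416, 603720);
(348437, -5187360); (348500, 281736); (349185, 1397880); (349248, -804960);
(349269, -2668152); (349456, 603720); (349508, -241488); (349521, 40248)].

Definition zeta_dc_data : seq (Z * Z) :=
[:: (21, -97720); (84, 49760); (336, -99520); (1029, 293160); (1281, -294960); (1344, 99520);
(1365, 1200); (4116, -149280); (4357, -5400); (5124, 149280); (5137, 437040); (5189, 431640);
(5376, -49760); (5397, 140280); (16464, 74640); (16705, -213120); (17669, 202320);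
(20496, -29856); (20548, -89568); (20561, -168336); (20756, -89568); (21504, 9952);
(21525, -60240); (21588, -29856); (21840, 14928); (65541, 403200); (65793, -1206000);
(65856, 802800); (65877, 261600); (66625, -1198800); (66820, -2408400); (66833, -3618000);
(66885, -2005200); (69712, 2408400); (69953, -4816800); (70676, 2408400); (70917, 3204000);
(81921, 401400); (81984, -401400); (82005, -1326000); (82192, 1204200); (82244, -1204200);
(82257, 397800); (83265, -1602000); (86037, 2664000); (86100, -802800); (86352, 802800);
(87045, -2670000); (87297, 1336800); (87360, -267600); (262164, 1620); (262405, 46440);
(263172, -3240); (263185, 39960); (263237, 132840); (263424, 1620); (263445, 160920);
(266305, 43200); (266513, 36720); (266565, 176040); (267280, -3240); (267332, -6480);
(267345, 58320); (267540, -3240); (278533, -43200); (278785, 36720); (278848, 6480);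
(279617, -49680); (279812, -12960); (279825, 73440); (279877, 86400); (282704, 9720);
(282945, 55080); (283668, 6480); (283909, -64800); (327684, 28512); (327697, 151200);
(327749, 328320); (327936, -28512); (327957, 371520); (328020, -47520); (328705, -179712);
(328768, 114048); (328789, 228960); (328976, -171072); (329028, 114048); (329041, -28512);
(331781, -244080); (332033, 198288); (332117, 71712); (332865, -322272); (333060, -190080);
(333073, -132192); (333125, -84672); (344085, -258120); (344148, 190080); (344400, -285120);
(345093, 604800); (345345, -545400); (345408, 190080); (345429, 8640); (348180, -285120);
(348421, -151200); (349188, 190080); (349201, 355320); (349253, 274320); (349440, -47520);
(349461, 61560)].

Definition zeta_dd_data : seq (Z * Z) :=
[:: (80, 5832); (321, -113346); (1044, 11664); (1285, 573732); (4112, -3888); (4164, 7776);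
(4177, -555984); (4372, 11664); (5141, -749988); (5204, 11664); (5456, -5832);
(16449, 219600); (16644, 23328); (16657, -547632); (16709, 458928); (17424, 19440);
(17476, 7776); (17489, -5904); (17684, 23328); (20481, -11664); (20544, 11664);
(20565, -33660); (20752, -15552); (20804, 19440); (20817, -127944); (21584, 11664);
(21825, 5112); (65556, -5076); (65797, -460512); (66564, 10152); (66577, -437184);
(66629, -324432); (66816, -5076); (66837, -385776); (69697, -226800); (69905, 145152);
(69957, -146016); (70672, 10152); (70724, 20304); (70737, -110592); (70932, 10152);
(81925, -1210464); (82177, 1230768); (82240, -20304); (82261, 748224); (83009, -3534624);
(83204, 40608); (83217, 3611520); (83269, -1118448); (86096, -30456); (86337, 79488);
(87060, -20304); (87301, 2298024); (262160, -40176); (262212, -200880); (262225, -1052352);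
(262420, -401760); (263168, 40176); (263189, -931176); (263252, -401760); (263504, 301320);
(266244, 281232); (266257, 1256472); (266309, 1169640); (266496, -200880); (266517, 485352);
(266580, -200880); (267265, -601020); (267328, 401760); (267349, 508464); (267536, -401760);
(267588, 200880); (267601, 114696); (278548, 241056); (278789, 1491480); (279556, -200880);
(279569, 1086480); (279621, 1724544); (279829, 1785888); (279892, -40176); (282689, 1045440);
(282884, 401760); (282897, 697680); (282949, 1407672); (283664, 200880); (283729, 734400);
(283924, 100440); (327701, 633408); (327764, -42600); (328016, 85200); (328709, -694944);
(328961, 229680); (329024, -85200); (329045, 125928); (331796, 127800); (332037, 1430352);
(332804, -127800); (332817, 632880); (332869, 228960); (333056, 42600); (333077, 418896);
(344144, -63900); (344385, 1512900); (345349, -2819844); (348176, 25560); (348228, 76680);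
(348241, 2880000); (348436, 76680); (349184, -8520); (349205, 2795076); (349268, 25560);
(349520, -12780)].

Definition phi_data : seq (Z * Z) :=
[:: (1, 12264248716260); (64, -12551444433471); (85, -808928144480); (272, 24559303478583);
(324, -16850055008880); (337, -2885301403680); (1104, -20380460656647); (1345, 8140502177880);
(4096, 286468105884); (4117, 4053097602786); (4180, -15756679600746); (4432, 12215203294749);
(5125, -6070357681710); (5377, 3113471361010); (5461, 96546218780); (16400, 6948268442592);
(16452, -3995262209184); (16465, 15121096004880); (16660, 29095299485304);
(17408, -1443894197976); (17429, -413503667256); (17492, 9923932996632);
(17744, -10560599264589); (20484, -4152504275400); (20497, -7052183230200);
(20549, -6772860938280); (20736, 2529131070672); (20757, -903134184720);
(20820, 1893053513184); (21505, 1283157264240); (21568, -1936563698568);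
(21589, -291211467600); (21776, 621031207392); (21828, -88831149264); (22864, -14479363440);
(65616, -11282365640556); (65857, 19409763321720); (66580, -13352617770840);
(69648, -13332182072112); (69700, 31739300710560); (69713, -19972709239680);
(69908, -11807710733160); (70656, -82302777432); (70677, -11657765328384);
(70740, 15570446476344); (70992, -4002136845987); (81985, 17856889427400);
(82180, 22091406656880); (82193, 3953808168480); (82245, 9387841890360);
(82960, 9525627378768); (83012, 117609468960); (83025, -4287358019160);
(86017, 3397676881200); (86080, -1974678650160); (86101, 4282332706800);
(86288, -2772433129512); (86340, 12882597279960); (86353, -11017762741920);
(87120, -7804238803032); (87361, 16797483362760); (262144, 727611327);
(262165, -2794776740996); (262228, 7875076027056); (262480, -6550608529812);
(263173, 6277144036560); (263425, -4446447654000); (263509, -642186530720);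
(264513, 7239681720); (266260, 8176260522960); (266501, 881600605200);
(267268, -7363702262400); (267281, -4933542709200); (267333, -9510187448040);
(267520, 2096796933600); (267541, 239738616600); (267604, 1686820975560);
(278608, -6438351248856); (278849, 8243474094360); (279572, -2014176843360);
(282640, 3865687125000); (282692, 4831121320920); (282705, -424552678080);
(282900, 13580863398120); (283648, -732689201088); (283669, -4438831252056);
(283732, 6721307072136); (283984, -4198934119221); (327685, 857340563220);
(327937, -931070669880); (328000, 1241548388160); (328021, 1793070022200);
(328769, -308395629720); (328964, -6445235134920); (328977, 5493417066120);
(329029, -4418676108120); (331856, -1697325884136); (332097, 4763770941600);
(332820, -2797173187920); (344065, -446894971040); (344128, -143461162560);
(344149, -2705636739400); (344336, -252369234240); (344388, -4658857441320);
(344401, 4478529662760); (345168, 102352554264); (345409, -1278268488720);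
(348160, 99335072930); (348181, 2332162110500); (348244, -1625992399800);
(348496, -81678522636); (349189, -1088038750680); (349441, 214083669320);
(1048592, 1875603188358); (1048644, -3332234179662); (1048657, 3045434769120);
(1048852, 3889272239670); (1049600, -90086633136); (1049621, 247949458044);
(1049684, 108914723682); (1049936, -772124932080); (1052676, 181908766704);
(1052689, -574707588960); (1052741, -1381687457880); (1052928, -147097029480);
(1052949, -475419735384); (1053012, -1013412710862); (1053697, -1519485890400);
(1053760, 1906791053112); (1053781, -210859046640); (1053968, -3612718446888);
(1054020, 1970306470032); (1055056, 28958726880); (1064980, 1036777018272);
(1065221, 374535698040); (1065988, -214358206416); (1066001, 429006108720);
(1066053, 2450400941400); (1066240, 10477857192); (1066261, -490964028456);
(1066324, -1081619503890); (1069121, 1190561804856); (1069316, 815567951760);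
(1069329, 3020445173856); (1069381, -1416740136384); (1070096, 1102345877976);
(1070148, 241442040048); (1070161, -1442685077184); (1114112, -180969015);
(1114133, 516049593480); (1114196, -210532707656); (1114448, -105680159312);
(1115141, -974181733200); (1115393, 465371821440); (1116481, 7239681720);
(1118228, -1534842957168); (1118469, 231669815040); (1119236, 541103382600);
(1119249, 1650744731160); (1119301, 1822972948920); (1119488, -256236691312);
(1119509, 670858800936); (1119572, -1207322667054); (1130576, 5253298706400);
(1130817, -7793071878960); (1131540, 5003451263952); (1134608, -159372357960);
(1134660, -3098483075400); (1134673, 16554500880); (1134868, -7588062255768);
(1135616, 168064830068); (1135637, 2585383167396); (1135700, -6148154193504);
(1135952, 4186115743617); (1310724, -3263085259455); (1310737, -12770136960609);
(1310789, -18201416065191); (1310976, 3290063773332); (1310997, -10291411218969);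
(1311060, 14495672619150); (1311745, 15404960201304); (1311808, -12406470467112);
(1311829, -346239355221); (1312016, 17332578057600); (1312068, -7869508185840);
(1313104, -14479363440); (1314821, -2806338204060); (1315073, 1429131261504);
(1315136, 759397300392); (1315157, 1722852556821); (1315905, -8625480271416);
(1316100, -6126076342920); (1316113, 3703480222224); (1316165, -3016270523496);
(1327104, -24746255652); (1327125, -1741706405952); (1327188, -10311441360);
(1327440, 1822977749232); (1328133, 20659249176); (1328385, 1271375302704);
(1328469, 546633681915); (1329473, 7239681720); (1331220, -5995104618000);
(1331461, -8334038628000); (1332228, 3394385086920); (1332241, -1448671012440);
(1332293, 2032233451080); (1332480, -529183526298); (1332501, -1303571119776);
(1332564, 603062011302); (1376257, 642503231640); (1376320, -759467441400);
(1376341, -1912881933120); (1376528, 2111817380040); (1376580, -6338146299840);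
(1376593, 3922445296320); (1377360, -1693714213080); (1377601, -3331481726880);
(1380352, 119102152308); (1380373, 4573960721352); (1380436, -5664248143992);
(1380688, 1945792615464); (1381381, -4458100446096); (1381633, 1675998634056);
(1381717, 74588624805); (1382721, 7239681720); (1392656, 141727426788);
(1392708, 2787305839992); (1392721, -1605859803000); (1392916, 1471116656208);
(1393664, -276003662070); (1393685, -2604366358020); (1393748, 2596134221256);
(1394000, -822111128022); (1396740, -793074142935); (1396753, 45541890780);
(1396805, -422447675610); (1396992, 373505919453); (1397013, 623545680756);
(1397076, -220693786569); (1397761, 146509923495); (1397824, -300896242080);
(1397845, -74588624805); (1398032, 133702038942); (1398084, -25210593213);
(2425088, 2413227240)].
End ExtensionData.

Definition int_trie (n : nat) (s : seq (Z * Z)) : trie :=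
  list_trie n [seq (e.1, (e.2, Z0)) | e <- s].

Definition cm1 : co := (Zneg xH, Z0).

(** The derivatives are listed on their own because [zeta] involves the letter [c], whereas
    membership in the subalgebra generated by [a] and [b] needs an expression in these two letters
    alone. *)
Definition zeta := int_trie 11 zeta_data.
Definition zeta_d (x : letter) := int_trie 10
  (sel zeta_da_data zeta_db_data zeta_dc_data zeta_dd_data x).
Definition ext_phi := int_trie 11 phi_data.

Lemma zeta_checkT :
  [&& all (fun x => der_check Z0 Z0 c1 c1 cm1 cm1 10 zeta (zeta_d x) x &&
                    letT (among [:: La; Lb]) (zeta_d x)) letters,
      homT 11 zeta & letT (among [:: La; Lb; Lc]) zeta].
Proof. by vm_compute. Qed.

Lemma phi_checkT : [&& homT 11 ext_phi,
  vanT Z0 Z0 c1 c1 cm1 cm1 [:: La; Lb] 11 ext_phi &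
  ~~ Z.eqb (pairT Z0 Z0 c1 c1 cm1 cm1 ext_phi zeta).1 Z0].
Proof. by vm_compute. Qed.

Opaque zeta zeta_d ext_phi.

(** * Reduction rules for final letters *)

(* A linear form on functions is a list of weighted words; a rule [(w, r)]
   asserts that evaluation at [w] equals [r] on the space under study. *)
Definition lform := seq (seq letter * co).
Definition rule := (seq letter * lform)%type.

Fixpoint weqb (u v : seq letter) : bool :=
  match u, v with
  | [::], [::] => true
  | x :: u', y :: v' => leqb x y && weqb u' v'
  | _, _ => false
  end.

Lemma weqbP u v : reflect (u = v) (weqb u v).
Proof.
elim: u v => [|x u IH] [|y v] /=; try by constructor.
have -> : leqb x y = (ol x == ol y) by rewrite ol_eq.
apply: (iffP andP) => [[e /IH ->]|[-> /IH ->]]; last by rewrite eqxx.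
by case: x y e => -[].
Qed.

(** A word without a rule stands for itself. *)
Definition lookup (R : seq rule) (w : seq letter) : lform :=
  if [seq r.2 | r <- R & weqb r.1 w] is r :: _ then r else [:: (w, c1)].

Definition lform_trie (f : lform) : trie :=
  foldr (fun e T => tplus (wordT e.2 e.1) T) TE f.

Section Rules.
Variables (p q : Z) (qt q1 ql qlt : co).
Notation cmul := (cmul p q).

Definition lscal (k : co) (f : lform) : lform := [seq (e.1, cmul k e.2) | e <- f].
Definition lcons (x : letter) (f : lform) : lform := [seq (x :: e.1, e.2) | e <- f].

Local Arguments lscal : simpl never.
Local Arguments lcons : simpl never.
Local Arguments lookup : simpl never.

(** The reduction starts from the last letter: the space under study is stable under [dl], so a rule
    may be applied behind any initial letters. Hence rules are needed only for a letter followed by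
    an already reduced word. *)
Fixpoint nform (R : seq rule) (u : seq letter) : lform :=
  if u is x :: u' then
    flatten [seq lscal e.2 (lookup R (x :: e.1)) | e <- nform R u']
  else [:: ([::], c1)].

(** The relation followed by [v], with each word reduced behind its first letter only. The words
    that remain, a letter followed by a normal form, are the unknowns among which the certificates
    derive the new rules. *)
Definition expand (R : seq rule) (rel : lform) (v : seq letter) : lform :=
  flatten [seq if e.1 is y :: u then lscal e.2 (lcons y (nform R (u ++ v)))
               else [:: (v, e.2)] | e <- rel].

Definition rule_check (rels : seq lform) (R : seq rule) (r : rule) (N : co)
    (cert : seq (co * nat * seq letter)) : bool :=
  let f := ((r.1, N) :: lscal (cmul (Zneg xH, Z0) N) r.2) ++
    flatten [seq lscal (cmul (Zneg xH, Z0) e.1.1)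
       (expand R (nth [::] rels e.1.2) e.2) | e <- cert] in
  if lform_trie f is TE then true else false.

Fixpoint add_rules rels N (R : seq rule) (s : seq (rule * seq (co * nat * seq letter))) :
    option (seq rule) :=
  if s is (r, cert) :: s' then
    if rule_check rels R r N cert then add_rules rels N (r :: R) s' else None
  else Some R.

(* [B0] and [B1] are sets of words of consecutive lengths: modulo the rules,
   evaluation at [x :: w] for [w] in [B0] is a combination of evaluations on [B1]. *)
Definition step_check (R : seq rule) (B0 B1 : seq (seq letter)) : bool :=
  all (fun x => all (fun w => all (fun e => has (weqb e.1) B1) (lookup R (x :: w))) B0)
    letters.

Definition dual_check (P : letter -> bool) n (B : seq (seq letter)) (D : seq trie) : bool :=
  [&& size B == size D, all (homT n) D, all (letT P) D &
   all (fun i => all (fun j =>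
     czero (cadd (pairT p q qt q1 ql qlt (wordT c1 (nth [::] B i)) (nth TE D j))
       (if i == j then (Zneg xH, Z0) else c0))) (iota 0 (size B))) (iota 0 (size B))].

(** The list of levels must end with an empty set of words: the space is then zero in that degree,
    and so in all higher degrees. *)
Fixpoint levels_check P rels N n (R : seq rule) (B0 : seq (seq letter))
    (s : seq (seq (seq letter) * seq (rule * seq (co * nat * seq letter)) * seq trie)) : bool :=
  if s is (B1, rs, D) :: s' then
    if add_rules rels N R rs is Some R1 then
      [&& step_check R1 B0 B1, dual_check P n B1 D & levels_check P rels N n.+1 R1 B1 s']
    else false
  else if B0 is [::] then true else false.

(** * Soundness of the reduction rules and of the dual bases *)

Section Semantics.
Variables (K : fieldType) (t l tau : K).
Hypotheses (ht : t != 0) (hl : l != 0) (hlt : l ^+ 2 = t ^+ 4).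
Notation cK := (cK tau).
Hypotheses (htau : tau ^+ 2 = zK K p * tau + zK K q)
  (hqt : cK qt = t) (hq1 : cK q1 = 1) (hql : cK ql = l) (hqlt : cK qlt = l / t).

Notation tens := (seq rk -> K).
Notation tzero := (@tzero K).
Notation tone := (tone K).
Notation gen := (gen t l).
Notation Bnich := (Bnich t l).
Notation evT := (evT t l tau).
Notation apT := (apT tau).
Implicit Types (f g h : tens) (R : seq rule).

Variable P : letter -> bool.

(* Elements of the Nichols algebra whose words end with letters in [P]: the
   largest left coideal subalgebra with degree one part spanned by [P]. *)
Definition KS f : Prop := Bnich f /\ forall u x, ~~ P x -> f (rcons u (ol x)) = 0.

Definition apL (L : lform) f : K := \sum_(e <- L) cK e.2 * f (map ol e.1).

Lemma apL_cat L M f : apL (L ++ M) f = apL L f + apL M f.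
Proof. by rewrite /apL big_cat. Qed.

Lemma apL_hd e L f : apL (e :: L) f = cK e.2 * f (map ol e.1) + apL L f.
Proof. by rewrite /apL big_cons. Qed.

Lemma apL_scal k L f : apL (lscal k L) f = cK k * apL L f.
Proof.
rewrite /apL big_map big_distrr; apply: eq_bigr => e _ /=.
by rewrite (cKM htau) mulrA.
Qed.

Lemma apL_cons x L f : apL (lcons x L) f = apL L (dl (ol x) f).
Proof. by rewrite /apL big_map. Qed.

Lemma apL_flatten (A : Type) (s : seq A) (F : A -> lform) f :
  apL (flatten [seq F e | e <- s]) f = \sum_(e <- s) apL (F e) f.
Proof.
elim: s => [|e s IH]; first by rewrite /apL !big_nil.
by rewrite /= apL_cat IH big_cons.
Qed.

Lemma apL1 u f : apL [:: (u, c1)] f = f (map ol u).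
Proof. by rewrite /apL big_seq1 cK1 mul1r. Qed.

Lemma apT_lform L f : apT (lform_trie L) f = apL L f.
Proof.
elim: L => [|e L IH]; first by rewrite /apL big_nil.
by rewrite /= apT_plus apT_word IH /apL big_cons.
Qed.

Lemma KS_dl x f : KS f -> KS (dl x f).
Proof.
move=> [hB hP]; split; first exact: Bnich_dl.
by move=> u y /hP h; rewrite /dl -rcons_cons h.
Qed.

Definition rsound R := forall f, KS f -> forall w, f (map ol w) = apL (lookup R w) f.

Lemma nform_ok R u f : rsound R -> KS f -> f (map ol u) = apL (nform R u) f.
Proof.
move=> hR; elim: u f => [|x u IH] f hf; first by rewrite apL1.
rewrite -[LHS]/(dl (ol x) f (map ol u)) IH; last exact: KS_dl.
rewrite [nform _ _]/= apL_flatten; apply: eq_bigr => e _.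
by rewrite /= apL_scal -(hR f hf).
Qed.

Definition rel_ok (L : lform) := forall f, Bnich f -> apL L f = 0.

Lemma Bnich_drw v f : Bnich f -> Bnich (drw v f).
Proof. by apply: drwP => x g; apply: Bnich_dr. Qed.

Lemma expand_ok R L v f : rsound R -> rel_ok L -> KS f -> apL (expand R L v) f = 0.
Proof.
move=> hR hL hf; rewrite -(hL (drw (map ol v) f)); last exact: Bnich_drw (proj1 hf).
rewrite apL_flatten; apply: eq_bigr => -[[|y u] k] _ /=.
  by rewrite /apL big_seq1.
rewrite apL_scal apL_cons -nform_ok //; last exact: KS_dl.
by rewrite map_cat.
Qed.

Lemma rule_check_ok rels R r N cert : cK N != 0 ->
  (forall i, rel_ok (nth [::] rels i)) -> rsound R ->
  rule_check rels R r N cert -> rsound (r :: R).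
Proof.
move=> hN hrel hR hc f hf w; rewrite /lookup /=.
case: weqbP => [<-|_]; last exact: hR.
move: hc; rewrite /rule_check; set L := (_ ++ _) => hc.
have : apL L f = 0 by rewrite -apT_lform; case: (lform_trie L) hc.
have cm1 : cK (Zneg xH, Z0) = -1 by rewrite /cK /zK /= mul0r addr0.
rewrite apL_cat apL_flatten [X in _ + X]big1 => [|e _]; last first.
  by rewrite apL_scal expand_ok ?mulr0.
rewrite addr0 apL_hd apL_scal (cKM htau) cm1 /=.
rewrite mulN1r mulNr -mulrBr => /eqP; rewrite mulf_eq0 (negbTE hN) /= subr_eq0.
by move/eqP.
Qed.

Lemma add_rules_ok rels N R s R1 : cK N != 0 ->
  (forall i, rel_ok (nth [::] rels i)) -> rsound R ->
  add_rules rels N R s = Some R1 -> rsound R1.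
Proof.
move=> hN hrel; elim: s R => [|[r cert] s IH] R hR /=; first by case=> <-.
by case: ifP => // /(rule_check_ok hN hrel hR) h /(IH _ h).
Qed.

Definition vanB (n : nat) (B : seq (seq letter)) := forall f, KS f ->
  (forall w, has (weqb w) B -> f (map ol w) = 0) -> forall u, size u = n -> f u = 0.

Lemma step_ok R n B0 B1 : rsound R -> step_check R B0 B1 -> vanB n B0 -> vanB n.+1 B1.
Proof.
move=> hR hs h0 f hf h1 [|x u] // [hu]; have [y ->] := olP x.
rewrite -[LHS]/(dl (ol y) f u); apply: h0 => //; first exact: KS_dl.
move=> w hw; rewrite -[LHS]/(f (map ol (y :: w))) (hR f hf).
have hall : all (fun w => all (fun e => has (weqb e.1) B1) (lookup R (y :: w))) B0.
  by move: hs => /and5P [? ? ? ? _]; case: (y).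
have {hall} : all (fun e => has (weqb e.1) B1) (lookup R (y :: w)).
  by elim: B0 hw hall {hs} => //= v B0 IH /orP [/weqbP -> /andP []|hw /andP [_ /IH]] //; apply.
rewrite /apL; elim: (lookup _ _) => [|e s IH] /=; first by rewrite big_nil.
by case/andP => he hs2; rewrite big_cons IH // h1 // mulr0 addr0.
Qed.

(** Deleting a final [x] kills every letter in [P], and by [dr_mul] it kills the product of two
    elements that it kills. *)
Lemma gen_vecs_end f u x : gen (vecs P) f -> ~~ P x -> f (rcons u (ol x)) = 0.
Proof.
move=> hf hx; suff -> : f (rcons u (ol x)) = tzero u by [].
rewrite -[LHS]/(dr (ol x) f u); congr (_ u).
elim: hf => {u f} [|f [y hy ->]|f g _ hf _ hg|k f _ hf|f g _ hf _ hg].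
- exact: dr_one.
- by rewrite dr_vec ol_eq; case: ifP => // e; move: hx hy; case: x e; case: y => // _ /negbTE ->.
- by rewrite -[LHS]/(tadd (dr (ol x) f) (dr (ol x) g)) hf hg tadd0.
- by rewrite -[LHS]/(tscale k (dr (ol x) f)) hf tscale_r0.
- by rewrite dr_mul // hf hg tmul0r tmul0l tadd0.
Qed.

Lemma gen_KS f : gen (vecs P) f -> KS f.
Proof.
move=> hf; split; last by move=> u x; apply: gen_vecs_end.
by apply: gen_sub hf => s [y _ ->]; apply: Bnich_vec.
Qed.

Lemma KS_add f g : KS f -> KS g -> KS (tadd f g).
Proof.
move=> [hf1 hf2] [hg1 hg2]; split; first exact: gen_add.
by move=> u x h; rewrite /tadd hf2 // hg2 // addr0.
Qed.

Lemma KS_nproj n f : KS f -> KS (nproj n f).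
Proof.
move=> [h1 h2]; split; first exact: Bnich_nproj.
by move=> u x h; rewrite /nproj h2 // if_same.
Qed.

(** The pairing matrix of the words [B] with the polynomials [D] is the identity, so subtracting the
    combination of [D] with coefficients the values of [f] on [B] gives an element of the space
    vanishing on [B], hence in the whole degree. *)
Lemma dual_gen n B D f : dual_check P n B D -> vanB n B -> KS f -> homog n f ->
  gen (vecs P) f.
Proof.
move=> /and4P [/eqP sBD hD lD hd] hv hf hn.
pose c j := f (map ol (nth [::] B j)).
pose g := foldr (fun j h => tadd (tscale (c j) (evT (nth TE D j))) h) tzero.
have Dhom j : (j < size B)%N -> homT n (nth TE D j).
  by move=> hj; apply: (all_nthP TE hD); rewrite -sBD.
have Dlet j : (j < size B)%N -> letT P (nth TE D j).
  by move=> hj; apply: (all_nthP TE lD); rewrite -sBD.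
have gg s : all (fun j => (j < size B)%N) s -> gen (vecs P) (g s) /\ homog n (g s).
  elim: s => [|j s IH] /=; first by move=> _; split; [apply: gen_zero|].
  case/andP => hj /IH [h1 h2]; split.
    apply: gen_add => //; apply: gen_scale; apply: letT_gen => //; exact: Dlet.
  by apply: homog_add => //; apply: homog_scale; apply: evT_homog => //; apply: Dhom.
have gE i s : (i < size B)%N -> all (fun j => (j < size B)%N) s ->
    g s (map ol (nth [::] B i)) = \sum_(j <- s) (if i == j then c j else 0).
  move=> hi; elim: s => [|j s IH] /=; first by rewrite big_nil.
  case/andP => hj /IH h; rewrite big_cons /tadd h; congr (_ + _).
  have mi : i \in iota 0 (size B) by rewrite mem_iota.
  have mj : j \in iota 0 (size B) by rewrite mem_iota.
  have := czeroP tau (allP (allP hd i mi) j mj).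
  rewrite cKD (@pairT_ok p q qt q1 ql qlt K t l tau) // apT_word cK1 mul1r /tscale => /eqP.
  rewrite addr_eq0 => /eqP ->; case: eqP => _.
    by rewrite /cK /zK /= mul0r addr0 opprK mulr1.
  by rewrite cK0 oppr0 mulr0.
have hall : all (fun j => (j < size B)%N) (iota 0 (size B)).
  by apply/allP => j; rewrite mem_iota.
have [g1 g2] := gg _ hall.
suff -> : f = g (iota 0 (size B)) by [].
have hdiff : forall u, size u = n -> tadd f (tscale (-1) (g (iota 0 (size B)))) u = 0.
  apply: hv.
    by apply: KS_add => //; apply: gen_KS; apply: gen_scale.
  move=> w hw; have [i hi ->] : exists2 i, (i < size B)%N & w = nth [::] B i.
    move: hw; elim: (B) => //= v B' IH /orP [/weqbP ->|/IH [i hi ->]].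
      by exists 0%N.
    by exists i.+1.
  rewrite /tadd /tscale gE // (bigD1_seq i) /= ?mem_iota ?iota_uniq //.
  rewrite eqxx big1 ?addr0 => [|j /negbTE ne]; last by rewrite eq_sym ne.
  by rewrite mulN1r subrr.
apply: functional_extensionality => u; have [e|ne] := eqVneq (size u) n.
  have := hdiff u e; rewrite /tadd /tscale mulN1r => /eqP.
  by rewrite subr_eq0 => /eqP.
by rewrite hn // g2.
Qed.

Lemma levels_ok rels N n R B0 s : cK N != 0 ->
  (forall i, rel_ok (nth [::] rels i)) -> rsound R -> vanB n B0 ->
  levels_check P rels N n.+1 R B0 s ->
  forall m f, (n < m)%N -> KS f -> homog m f -> gen (vecs P) f.
Proof.
move=> hN hrel; elim: s n R B0 => [|[[B1 rs] D] s IH] n R B0 hR hv /=.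
  case: B0 hv => // hv _ m f hm hf hh.
  suff -> : f = tzero by exact: gen_zero.
  apply: functional_extensionality => u; have [e|ne] := eqVneq (size u) m; last exact: hh.
  (* Deleting the first [m - n] letters leaves an element of the space evaluated in degree [n],
     where it is zero. *)
  rewrite -(cat_take_drop (m - n) u) -[LHS]/(dlw (take (m - n) u) f (drop (m - n) u)).
  apply: (hv _ _ (fun w (h : false) => _)) => //.
    by apply: dlwP hf => x g; apply: KS_dl.
  by rewrite size_drop e subKn // ltnW.
case e : (add_rules _ _ _ _) => [R1|] // /and3P [h1 h2 h3] m f.
have hR1 := add_rules_ok hN hrel hR e; have hv1 := step_ok hR1 h1 hv.
rewrite leq_eqVlt => /orP [/eqP <-|]; first exact: (dual_gen h2).
exact: (IH _ _ _ hR1 hv1 h3).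
Qed.

Local Arguments weqb : simpl never.

(** Elements of the space vanish on words ending outside [P]. Rules for one-letter words express
    this, because [nform] reduces the last letter first. *)
Definition rules0 : seq rule := [seq ([:: x], [::]) | x <- letters & ~~ P x].

Lemma rules0_sound : rsound rules0.
Proof.
move=> f hf w; rewrite /lookup.
suff : [seq r.2 | r <- rules0 & weqb r.1 w] = [::] \/
   (exists s, [seq r.2 | r <- rules0 & weqb r.1 w] = [::] :: s) /\ f (map ol w) = 0.
  by case=> [->|[[s ->] ->]]; rewrite ?apL1 // /apL big_nil.
have : all (fun x => ~~ P x) [seq x <- letters | ~~ P x] by exact: filter_all.
rewrite /rules0; elim: [seq x <- letters | _] => [|x s IH] /=; first by left.
case/andP => hx hs; have {}IH := IH hs; case: (weqbP [:: x] w) => [<-|_]; last exact: IH.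
right; split; first by eexists.
exact: ((proj2 hf) [::] x hx).
Qed.

Lemma KS_gen rels N s : cK N != 0 -> (forall i, rel_ok (nth [::] rels i)) ->
  levels_check P rels N 1 rules0 [:: [::]] s ->
  forall f, KS f -> gen (vecs P) f.
Proof.
move=> hN hrel hs f hf.
have hv0 : vanB 0 [:: [::]] by move=> g _ h u /size0nil ->; apply: (h [::]).
have hh m g : KS g -> homog m g -> gen (vecs P) g.
  (* The tables begin in degree 1; a homogeneous element of degree 0 is a multiple of the unit. *)
  case: m => [|m] hg hm; last exact: (levels_ok hN hrel rules0_sound hv0 hs (ltn0Sn m) hg hm).
  suff -> : g = tscale (g [::]) tone by apply: gen_scale; apply: gen_one.
  apply: functional_extensionality => -[|x u]; rewrite /tscale /tone /= ?mulr1 // mulr0.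
  exact: hm.
have [M hM] := Bnich_fin (proj1 hf).
have : forall m, gen (vecs P) (fun w => if (size w < m)%N then f w else 0).
  elim=> [|m IH]; first exact: gen_zero.
  have -> : (fun w => if (size w < m.+1)%N then f w else 0) =
      tadd (nproj m f) (fun w => if (size w < m)%N then f w else 0).
    apply: functional_extensionality => w; rewrite /tadd /nproj ltnS.
    by case: ltngtP => _; rewrite ?add0r ?addr0.
  apply: gen_add => //; apply: (hh m); first exact: KS_nproj.
  by move=> w hw; rewrite /nproj (negbTE hw).
move=> /(_ M.+1); congr (gen _ _); apply: functional_extensionality => w.
by rewrite ltnS; case: leqP => // /hM ->.
Qed.
End Semantics.
End Rules.
(* For each degree [n]: the basis words of degree [n] (in base 4); rules
   [(word, form, certificate)], where the entry [(k, i, v)] of a certificate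
   stands for [k] times relation [i] followed by the word [v], and the
   certificate proves 6 times the rule (6 clears denominators); and the dual
   basis of polynomials. *)
Section KernelData.
Local Open Scope Z_scope.
Definition two_data : seq (seq Z * seq (Z * seq (Z * co) * seq (co * nat * Z)) * seq (seq (Z * co))) :=
[:: ([:: 0; 1],
 [::],
 [:: [:: (0, (1, 0))];
  [:: (1, (1, 0))]]);
([:: 0; 1; 4; 5],
 [:: (8, [:: (1, (0, 1))], [:: ((0, -6), 0%N, 0)]);
  (9, [::], [:: ((0, 6), 3%N, 0)]);
  (12, [::], [:: ((0, -6), 1%N, 0)]);
  (13, [:: (4, (1, 0))], [:: ((0, 6), 2%N, 0)])],
 [:: [:: (0, (0, -1))];
  [:: (1, (1, 0))];
  [:: (4, (1, 0))];
  [:: (5, (0, -1))]]);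
([:: 1; 4; 5; 16; 17; 20],
 [:: (0, [::], [:: ((6, 0), 4%N, 0)]);
  (21, [::], [:: ((6, 0), 5%N, 0)]);
  (32, [:: (4, (0, 1)); (17, (0, 1))], [:: ((0, -6), 0%N, 0)]);
  (33, [:: (5, (0, 1))], [:: ((0, -6), 0%N, 1)]);
  (36, [::], [:: ((0, 3), 3%N, 0); ((0, 3), 1%N, 1)]);
  (37, [:: (20, (0, -1))], [:: ((0, 6), 3%N, 1)]);
  (48, [:: (1, (-1, -1))], [:: ((0, -6), 1%N, 0)]);
  (49, [::], [:: ((0, -3), 1%N, 1); ((0, 3), 3%N, 0)]);
  (52, [:: (16, (1, 0))], [:: ((0, 6), 2%N, 0)]);
  (53, [:: (4, (0, -1)); (17, (1, 0))], [:: ((0, 6), 2%N, 1)])],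
 [:: [:: (1, (0, -1))];
  [:: (4, (0, -1)); (17, (-1, -1))];
  [:: (5, (0, -1))];
  [:: (16, (0, -1))];
  [:: (4, (0, -1)); (17, (0, -1))];
  [:: (20, (0, -1))]]);
([:: 4; 5; 16; 17; 20; 65; 68; 80],
 [:: (1, [::], [:: ((6, 0), 4%N, 1)]);
  (69, [:: (4, (1, 1)); (17, (0, 1))], [:: ((0, 6), 1%N, 0); ((6, 0), 0%N, 1)]);
  (81, [:: (16, (-1, 0)); (68, (-1, 0))], [:: ((6, 0), 0%N, 0)]);
  (84, [::], [:: ((6, 0), 5%N, 0)]);
  (129, [:: (17, (-1, 0)); (4, (-1, 0))], [:: ((-6, -6), 1%N, 0)]);
  (132, [:: (20, (0, 1))], [:: ((0, -6), 0%N, 4)]);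
  (133, [::], [:: ((0, 6), 6%N, 0)]);
  (144, [:: (65, (-1, 0))], [:: ((0, 3), 3%N, 0); ((0, -3), 2%N, 1); ((0, 3), 1%N, 4)]);
  (145, [:: (20, (-1, -1))], [:: ((0, 3), 1%N, 5); ((0, 3), 3%N, 1); ((3, 3), 0%N, 4)]);
  (148, [:: (80, (0, -1))], [:: ((0, 6), 3%N, 4)]);
  (193, [:: (5, (-1, -1))], [:: ((0, -6), 1%N, 1)]);
  (196, [:: (65, (-1, 0))], [:: ((0, -3), 1%N, 4); ((0, 3), 3%N, 0); ((0, -3), 2%N, 1)]);
  (197, [:: (20, (1, 1))], [:: ((0, 3), 3%N, 1); ((0, -3), 1%N, 5); ((-3, -3), 0%N, 4)]);
  (208, [::], [:: ((6, 0), 7%N, 1)]);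
  (209, [:: (65, (1, 0))], [:: ((0, 6), 2%N, 1)]);
  (212, [:: (16, (0, -1)); (68, (1, 0))], [:: ((0, 6), 2%N, 4)])],
 [:: [:: (4, (-1, -2)); (17, (-1, -1))];
  [:: (5, (-1, -1))];
  [:: (16, (-1, -2)); (68, (-1, -1))];
  [:: (4, (0, -1)); (17, (0, -1))];
  [:: (20, (0, -1))];
  [:: (65, (0, -1))];
  [:: (16, (0, -1)); (68, (0, -1))];
  [:: (80, (-1, -1))]]);
([:: 16; 17; 20; 65; 68; 80; 260; 261; 272; 321],
 [:: (4, [::], [:: ((6, 0), 4%N, 4)]);
  (5, [::], [:: ((6, 0), 4%N, 5)]);
  (273, [:: (65, (0, 1)); (260, (-1, 0))], [:: ((0, -6), 0%N, 1)]);
  (276, [:: (16, (1, 1)); (68, (0, 1))], [:: ((0, -6), 2%N, 20)]);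
  (324, [:: (272, (-1, 0))], [:: ((-6, 0), 5%N, 1)]);
  (336, [::], [:: ((6, 0), 5%N, 0)]);
  (516, [:: (68, (-1, 0)); (16, (-1, 0))], [:: ((0, -6), 0%N, 4); ((6, 6), 2%N, 20)]);
  (517, [:: (17, (-1, -1))], [:: ((0, -6), 0%N, 5); ((-6, 0), 4%N, 4)]);
  (528, [:: (80, (0, 1)); (321, (-1, 0))], [:: ((0, -6), 0%N, 16)]);
  (529, [:: (68, (1, -1)); (16, (0, -2))], [:: ((6, 0), 3%N, 5); ((6, 6), 0%N, 4); ((-12, 0), 2%N, 20)]);
  (532, [::], [:: ((6, 6), 6%N, 0)]);
  (577, [:: (20, (-1, 0)); (261, (-1, 0))], [:: ((0, -6), 2%N, 5); ((6, 6), 1%N, 17); ((6, 0), 1%N, 4)]);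
  (580, [:: (80, (-1, -1))], [:: ((0, 3), 1%N, 20); ((0, 3), 3%N, 4); ((3, 3), 0%N, 16)]);
  (592, [::], [:: ((0, 6), 6%N, 5)]);
  (772, [:: (20, (0, -1)); (261, (1, 0))], [:: ((-6, -6), 1%N, 4); ((0, 6), 2%N, 5); ((-6, -6), 1%N, 17)]);
  (773, [::], [:: ((-6, -6), 7%N, 0)]);
  (784, [:: (65, (0, -1))], [:: ((0, -6), 1%N, 16)]);
  (785, [:: (261, (-1, 0))], [:: ((6, 0), 1%N, 17); ((0, -6), 2%N, 5); ((6, 0), 1%N, 4)]);
  (788, [:: (321, (0, 1)); (80, (1, 1))], [:: ((0, 3), 3%N, 4); ((0, -3), 1%N, 20); ((-3, -3), 0%N, 16)]);
  (833, [::], [:: ((0, -6), 7%N, 5)]);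
  (836, [:: (65, (0, 1)); (260, (1, 0))], [:: ((0, 6), 2%N, 4)]);
  (848, [:: (272, (1, 0))], [:: ((0, 6), 2%N, 16)])],
 [:: [:: (16, (-2, -2)); (68, (-1, -1))];
  [:: (17, (-1, -1))];
  [:: (20, (-1, -1)); (261, (-1, -1))];
  [:: (65, (-1, -1)); (260, (1, 1))];
  [:: (16, (0, -1)); (68, (0, -1))];
  [:: (80, (-1, -1))];
  [:: (65, (1, 0)); (260, (-1, -1))];
  [:: (261, (-1, -1))];
  [:: (272, (-1, -1))];
  [:: (80, (0, -1)); (321, (-1, -1))]]);
([:: 65; 68; 80; 260; 261; 272; 321; 1040; 1044; 1089],
 [:: (16, [::], [:: ((6, 0), 4%N, 16)]);
  (17, [::], [:: ((0, 6), 1%N, 5)]);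
  (20, [::], [:: ((6, 0), 4%N, 20)]);
  (1041, [:: (261, (1, 1))], [:: ((-6, -6), 0%N, 5)]);
  (1092, [:: (260, (0, 1)); (1040, (-1, 0))], [:: ((0, -6), 0%N, 4)]);
  (1104, [:: (272, (0, 1))], [:: ((0, -6), 2%N, 80)]);
  (1284, [:: (1089, (1, 1))], [:: ((6, 0), 5%N, 5)]);
  (1285, [:: (1044, (-1, -1)); (80, (0, -1)); (321, (1, 1))], [:: ((0, -3), 3%N, 4); ((3, -3), 0%N, 65); ((6, 3), 2%N, 20); ((6, 6), 1%N, 16); ((0, 3), 1%N, 68)]);
  (1296, [::], [:: ((6, 0), 3%N, 80)]);
  (1345, [::], [:: ((6, 0), 5%N, 1)]);
  (2064, [:: (272, (-1, 0))], [:: ((-2, 2), 0%N, 68); ((-2, -4), 6%N, 1); ((4, 2), 2%N, 80)]);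
  (2065, [:: (65, (-1, -1)); (260, (1, 1)); (1040, (-1, -1))], [:: ((0, -6), 0%N, 17); ((-6, -12), 0%N, 4)]);
  (2068, [:: (68, (-1, -1))], [:: ((0, -6), 0%N, 20); ((-6, 0), 4%N, 16)]);
  (2113, [:: (321, (-1, 0)); (1044, (0, 1)); (80, (0, 1))], [:: ((-3, -3), 0%N, 65); ((0, 3), 3%N, 4); ((-6, -3), 2%N, 20); ((-6, -6), 1%N, 16); ((0, -3), 1%N, 68)]);
  (2116, [:: (272, (1, -1))], [:: ((0, -6), 0%N, 68); ((-6, 0), 2%N, 80)]);
  (2128, [::], [:: ((0, -6), 0%N, 80)]);
  (2308, [:: (80, (-1, 0)); (1044, (-1, 0))], [:: ((0, -3), 2%N, 20); ((0, 3), 1%N, 68); ((-3, -3), 0%N, 65); ((0, 3), 3%N, 4)]);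
  (2309, [:: (68, (1, 1))], [:: ((6, 0), 6%N, 16); ((0, 6), 0%N, 20); ((6, 0), 4%N, 16)]);
  (2320, [:: (1089, (-1, -1))], [:: ((-6, -6), 7%N, 5); ((6, 0), 2%N, 65); ((0, 6), 1%N, 80)]);
  (2369, [::], [:: ((6, 0), 8%N, 0)]);
  (3088, [:: (1044, (1, 1))], [:: ((-6, -6), 1%N, 16); ((-3, 0), 0%N, 65); ((3, 3), 3%N, 4); ((-3, 3), 2%N, 20); ((-3, -3), 1%N, 68)]);
  (3089, [:: (68, (0, 1))], [:: ((6, 0), 3%N, 5); ((6, 6), 6%N, 16); ((-6, 0), 0%N, 20); ((6, 6), 4%N, 16)]);
  (3092, [::], [:: ((0, -6), 1%N, 20); ((0, 6), 8%N, 0); ((6, 0), 0%N, 80)]);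
  (3137, [:: (261, (0, -1))], [:: ((0, -6), 1%N, 65); ((0, -6), 4%N, 20)]);
  (3140, [:: (80, (-1, -1)); (1044, (-2, -1)); (321, (0, -1))], [:: ((0, -3), 0%N, 65); ((3, -6), 2%N, 20); ((6, 0), 1%N, 16); ((-3, 0), 3%N, 4); ((3, 0), 1%N, 68)]);
  (3152, [:: (1089, (-1, -1))], [:: ((-6, -6), 7%N, 5); ((6, 0), 2%N, 65)]);
  (3332, [:: (261, (0, -1))], [:: ((6, 0), 7%N, 20); ((0, -6), 1%N, 65); ((0, -6), 4%N, 20)]);
  (3333, [::], [:: ((0, 6), 2%N, 5)]);
  (3344, [:: (65, (-1, -1)); (1040, (1, 0))], [:: ((0, 6), 2%N, 16)]);
  (3393, [:: (1089, (1, 0))], [:: ((0, 6), 2%N, 65)])],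
 [:: [:: (65, (-1, 0)); (1040, (1, 1))];
  [:: (68, (-1, -1))];
  [:: (80, (-1, 0)); (1044, (-1, -1))];
  [:: (65, (1, 0)); (260, (-1, -1))];
  [:: (261, (-1, -1))];
  [:: (272, (-1, -1))];
  [:: (80, (0, -1)); (321, (-1, -1)); (1044, (1, 0))];
  [:: (65, (-1, 0)); (260, (1, 0)); (1040, (-1, 0))];
  [:: (1044, (-1, -1))];
  [:: (1089, (-1, -1))]]);
([:: 260; 261; 272; 321; 1040; 1044; 1089; 4161; 4176; 4357],
 [:: (65, [::], [:: ((6, 0), 4%N, 65)]);
  (68, [::], [:: ((0, 6), 1%N, 20)]);
  (80, [::], [:: ((6, 0), 4%N, 80)]);
  (4164, [:: (1044, (1, 1))], [:: ((-6, -6), 0%N, 20)]);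
  (4356, [:: (261, (1, 0)); (4161, (1, 1))], [:: ((0, -6), 2%N, 260); ((-6, 0), 2%N, 65)]);
  (4368, [:: (1040, (0, 1))], [:: ((0, -6), 0%N, 16)]);
  (4417, [:: (1089, (0, 1))], [:: ((0, -6), 2%N, 321)]);
  (5136, [:: (261, (1, 1)); (4161, (0, 1))], [:: ((6, 0), 5%N, 20); ((6, 0), 2%N, 260); ((-6, -6), 2%N, 65)]);
  (5140, [:: (4176, (-1, -1)); (1089, (0, 1))], [:: ((0, 6), 5%N, 5); ((0, -6), 2%N, 321)]);
  (5185, [::], [:: ((6, 0), 3%N, 321)]);
  (8257, [:: (1089, (-1, -1)); (4176, (1, 1))], [:: ((0, -6), 0%N, 260); ((-6, -6), 6%N, 5); ((0, -6), 3%N, 16); ((6, 6), 2%N, 80); ((0, -12), 5%N, 5); ((0, 12), 2%N, 321)]);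
  (8260, [:: (260, (-1, -1)); (1040, (1, 1))], [:: ((0, -6), 0%N, 68); ((-6, -12), 0%N, 16)]);
  (8272, [:: (272, (-1, -1))], [:: ((0, -6), 0%N, 80)]);
  (8452, [:: (4176, (0, 1)); (1089, (-1, -1))], [:: ((0, -6), 5%N, 5); ((0, 6), 2%N, 321); ((0, -6), 0%N, 260)]);
  (8453, [:: (1044, (1, 1)); (321, (-1, 0))], [:: ((0, -6), 0%N, 261); ((0, -6), 0%N, 20); ((6, 6), 4%N, 80)]);
  (8464, [::], [:: ((-6, -6), 6%N, 4)]);
  (8513, [::], [:: ((0, -6), 0%N, 321)]);
  (9232, [:: (4176, (-1, 0))], [:: ((0, 6), 3%N, 16); ((-6, -6), 2%N, 80); ((0, 6), 5%N, 5); ((0, -6), 2%N, 321)]);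
  (9236, [:: (272, (1, 1))], [:: ((6, 6), 1%N, 16)]);
  (9281, [:: (4357, (-1, -1))], [:: ((0, -6), 8%N, 0)]);
  (12353, [:: (1044, (0, -1))], [:: ((0, 6), 7%N, 80); ((6, 6), 2%N, 16)]);
  (12356, [:: (272, (0, 1))], [:: ((6, 0), 3%N, 20); ((0, 6), 1%N, 16)]);
  (12368, [:: (4357, (0, 1))], [:: ((0, -6), 1%N, 80); ((-6, 0), 8%N, 0)]);
  (12548, [:: (1044, (1, -1)); (321, (0, 1))], [:: ((0, -6), 1%N, 260); ((6, -6), 4%N, 80); ((-6, -6), 0%N, 261); ((-6, -6), 0%N, 20)]);
  (12549, [::], [:: ((0, 6), 7%N, 16)]);
  (12560, [:: (1089, (1, 1)); (4176, (-1, -1))], [:: ((6, 0), 2%N, 80)]);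
  (12609, [:: (4357, (-1, -1))], [:: ((0, -6), 1%N, 321); ((0, -6), 8%N, 0)]);
  (13328, [:: (1044, (1, 0))], [:: ((0, 6), 2%N, 16)]);
  (13332, [::], [:: ((0, 6), 2%N, 20)]);
  (13377, [:: (261, (-1, -1)); (4161, (1, 0))], [:: ((0, 6), 2%N, 65)])],
 [:: [:: (260, (-1, 0))];
  [:: (261, (-1, 1)); (4161, (1, 1))];
  [:: (272, (-1, 0))];
  [:: (321, (-1, 0)); (1044, (1, 0))];
  [:: (260, (1, 0)); (1040, (-1, 0))];
  [:: (1044, (-1, -1))];
  [:: (1089, (-1, -1)); (4176, (1, 1))];
  [:: (261, (-1, -1)); (4161, (-1, 0))];
  [:: (4176, (-1, 0))];
  [:: (4357, (-1, 0))]]);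
([:: 1040; 1044; 1089; 4161; 4176; 4357; 16645; 16705],
 [:: (260, [::], [:: ((6, 0), 4%N, 260)]);
  (261, [::], [:: ((6, 0), 4%N, 261)]);
  (272, [::], [:: ((6, 0), 4%N, 272)]);
  (321, [::], [:: ((6, 0), 4%N, 321)]);
  (16644, [:: (1044, (0, 1))], [:: ((-6, -6), 0%N, 68); ((0, 6), 5%N, 80)]);
  (16656, [:: (4176, (1, 1))], [:: ((-6, -6), 0%N, 80)]);
  (17424, [::], [:: ((0, 6), 5%N, 80)]);
  (17428, [:: (4357, (-1, -1)); (16705, (1, 0))], [:: ((0, -6), 2%N, 1044); ((6, 0), 2%N, 80); ((0, 6), 2%N, 321)]);
  (17473, [:: (4161, (0, 1))], [:: ((0, -6), 0%N, 65); ((-6, 0), 5%N, 20)]);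
  (20545, [:: (16645, (0, 1))], [:: ((-6, -6), 5%N, 16)]);
  (20560, [:: (4161, (-1, 0))], [:: ((-6, 0), 5%N, 20); ((6, 0), 0%N, 65)]);
  (20741, [::], [:: ((0, -6), 5%N, 17)]);
  (33028, [:: (4161, (0, -1))], [:: ((6, 0), 3%N, 272); ((-6, -6), 6%N, 20); ((0, 6), 0%N, 65)]);
  (33029, [:: (16705, (0, 1))], [:: ((0, -6), 0%N, 261); ((6, 0), 2%N, 1044); ((6, 6), 2%N, 80); ((-6, 0), 2%N, 321)]);
  (33040, [:: (1040, (-1, -1))], [:: ((0, -6), 0%N, 272)]);
  (33089, [:: (1089, (-1, -1))], [:: ((0, -6), 0%N, 321)]);
  (33808, [:: (4161, (0, -1))], [:: ((6, 0), 3%N, 272); ((0, 6), 0%N, 65)]);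
  (33812, [:: (1089, (-1, -1)); (4176, (1, 1))], [:: ((-6, 0), 1%N, 65)]);
  (33857, [::], [:: ((0, -6), 0%N, 1089); ((-6, 0), 5%N, 17)]);
  (36929, [:: (4357, (0, 1)); (16705, (-2, -1))], [:: ((0, 6), 1%N, 1089); ((0, -6), 2%N, 321); ((6, 0), 0%N, 261); ((6, 6), 2%N, 1044); ((0, 6), 2%N, 80)]);
  (36944, [::], [:: ((-6, -6), 1%N, 272); ((-6, -6), 7%N, 17); ((0, -6), 0%N, 1089); ((-6, 0), 5%N, 17)]);
  (37125, [::], [:: ((-6, -6), 6%N, 272)]);
  (49412, [:: (1089, (0, -1)); (4176, (1, 0))], [:: ((-6, 0), 8%N, 5); ((6, 0), 0%N, 321); ((-6, 0), 0%N, 80)]);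
  (49413, [:: (1044, (-1, 0))], [:: ((-6, -6), 7%N, 80); ((6, 6), 2%N, 65)]);
  (49424, [::], [:: ((0, 6), 7%N, 17)]);
  (49473, [::], [:: ((0, -6), 1%N, 321); ((0, 6), 6%N, 272)]);
  (50192, [:: (4176, (1, 0)); (1089, (-1, -1))], [:: ((0, -6), 1%N, 1040); ((-6, 0), 1%N, 65)]);
  (50196, [::], [:: ((0, -6), 1%N, 1044); ((-6, 0), 4%N, 272)]);
  (50241, [:: (4357, (1, 1)); (16705, (-1, -1))], [:: ((6, 0), 2%N, 321)]);
  (53313, [:: (1044, (-1, -1))], [:: ((0, 6), 2%N, 65)]);
  (53328, [:: (4357, (1, 1))], [:: ((0, 6), 2%N, 80)]);
  (53509, [:: (16645, (1, 0))], [:: ((0, 6), 2%N, 261)])],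
 [:: [:: (1040, (0, 1))];
  [:: (1044, (-1, 0))];
  [:: (1089, (-1, 0)); (4176, (1, 1))];
  [:: (4161, (-1, 0))];
  [:: (4176, (-1, 0))];
  [:: (4357, (-1, 0)); (16705, (1, 1))];
  [:: (16645, (0, 1))];
  [:: (16705, (-1, 0))]]);
([:: 4161; 4176; 4357; 16645; 16705; 66580],
 [:: (1040, [::], [:: ((0, 6), 1%N, 272)]);
  (1044, [::], [:: ((6, 0), 4%N, 1044)]);
  (1089, [::], [:: ((0, 6), 1%N, 321)]);
  (66576, [:: (4176, (0, 1))], [:: ((-6, -6), 0%N, 272)]);
  (66625, [:: (16705, (1, 1))], [:: ((-6, -6), 0%N, 321)]);
  (69697, [::], [:: ((-6, 0), 5%N, 80)]);
  (69712, [:: (4357, (0, 1)); (16705, (-1, 0))], [:: ((6, 6), 3%N, 1040); ((-6, -6), 2%N, 4176); ((6, 0), 0%N, 321)]);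
  (69893, [:: (16645, (0, 1))], [:: ((0, -6), 2%N, 4357)]);
  (82181, [::], [:: ((6, 0), 3%N, 4357)]);
  (82241, [:: (16645, (-1, 0))], [:: ((6, 0), 0%N, 261)]);
  (132112, [::], [:: ((-6, -6), 6%N, 80)]);
  (132116, [:: (16705, (-1, -1))], [:: ((0, -6), 1%N, 261)]);
  (132161, [:: (4161, (-1, -1))], [:: ((0, -6), 0%N, 1089)]);
  (135233, [:: (16645, (0, -1))], [:: ((0, -6), 3%N, 4176); ((0, 6), 2%N, 4357)]);
  (135248, [:: (4161, (0, -1))], [:: ((0, -6), 0%N, 4176)]);
  (135429, [::], [:: ((0, -6), 0%N, 4357)]);
  (147717, [:: (66580, (0, 1))], [:: ((-6, -6), 2%N, 1044); ((6, 6), 2%N, 321); ((0, 6), 1%N, 4357)]);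
  (147777, [::], [:: ((-3, -3), 1%N, 1089); ((0, 3), 3%N, 321); ((0, -3), 0%N, 4357)]);
  (197648, [:: (4161, (1, 1))], [:: ((6, 0), 3%N, 272); ((6, 6), 0%N, 4176)]);
  (197652, [:: (4176, (-1, 0))], [:: ((6, 0), 8%N, 5); ((0, -6), 0%N, 272)]);
  (197697, [::], [:: ((3, 0), 3%N, 321); ((0, -3), 1%N, 1089); ((3, 0), 0%N, 4357)]);
  (200769, [:: (4357, (-1, -1)); (16705, (1, 0))], [:: ((6, 0), 2%N, 4176); ((-6, -6), 3%N, 1040); ((-6, 0), 0%N, 321)]);
  (200784, [::], [:: ((6, 6), 2%N, 272)]);
  (200965, [:: (66580, (0, 1))], [:: ((-6, -6), 2%N, 1044); ((6, 6), 2%N, 321)]);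
  (213253, [::], [:: ((-6, -6), 7%N, 80)]);
  (213313, [::], [:: ((0, 6), 2%N, 321)])],
 [:: [:: (4161, (0, 1))];
  [:: (4176, (0, 1))];
  [:: (4357, (0, 1)); (16705, (1, 1))];
  [:: (16645, (0, 1))];
  [:: (16705, (-1, 0))];
  [:: (66580, (0, 1))]]);
([:: 16645; 16705; 66580; 266320],
 [:: (4161, [::], [:: ((0, 6), 1%N, 1089)]);
  (4176, [::], [:: ((-6, -6), 0%N, 1040)]);
  (4357, [::], [:: ((6, 0), 4%N, 4357)]);
  (266305, [:: (16705, (0, 1))], [:: ((-6, -6), 0%N, 1089)]);
  (266501, [:: (66580, (0, -1))], [:: ((-6, 0), 5%N, 272); ((0, 6), 0%N, 1044)]);
  (278789, [::], [:: ((0, -6), 2%N, 16645)]);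
  (278849, [:: (66580, (1, 1))], [:: ((-6, -6), 0%N, 1044)]);
  (328724, [::], [:: ((-6, -6), 5%N, 260)]);
  (528449, [::], [:: ((6, 6), 1%N, 1040)]);
  (528464, [:: (16705, (1, 0))], [:: ((0, -6), 1%N, 1044)]);
  (528645, [:: (16645, (-1, -1))], [:: ((0, -6), 0%N, 4357)]);
  (540933, [::], [:: ((0, -6), 3%N, 16705)]);
  (540993, [:: (16645, (0, -1))], [:: ((0, -6), 0%N, 16705)]);
  (590868, [:: (266320, (0, 1))], [:: ((-6, -6), 2%N, 4176); ((6, 6), 1%N, 16705); ((6, 0), 1%N, 4357)]);
  (790593, [:: (16645, (1, 1))], [:: ((6, 0), 3%N, 1089); ((6, 6), 0%N, 16705)]);
  (790608, [::], [:: ((6, 0), 7%N, 261)]);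
  (790789, [:: (266320, (-1, -1))], [:: ((6, 0), 2%N, 4176); ((-6, 0), 1%N, 16705)]);
  (803077, [:: (66580, (-1, -1))], [:: ((0, -6), 1%N, 16645)]);
  (803137, [::], [:: ((0, -6), 1%N, 16705)]);
  (853012, [::], [:: ((0, 6), 3%N, 16645)])],
 [:: [:: (16645, (1, 1))];
  [:: (16705, (0, 1))];
  [:: (66580, (0, 1))];
  [:: (266320, (1, 1))]]);
([:: 66580; 266320],
 [:: (16645, [::], [:: ((6, 0), 4%N, 16645)]);
  (16705, [::], [:: ((-6, -6), 0%N, 4161)]);
  (1065221, [:: (66580, (1, 0))], [:: ((-6, -6), 0%N, 4357)]);
  (1065281, [:: (266320, (0, -1))], [:: ((0, 6), 0%N, 4176)]);
  (1115156, [::], [:: ((0, -6), 2%N, 66580)]);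
  (1314896, [::], [:: ((-6, -6), 5%N, 1040)]);
  (2113797, [::], [:: ((0, -6), 0%N, 16645)]);
  (2113857, [:: (66580, (-1, -1))], [:: ((6, 0), 3%N, 4161); ((0, 6), 0%N, 4357)]);
  (2163732, [::], [:: ((0, -6), 0%N, 66580); ((6, 0), 5%N, 1040)]);
  (2363472, [::], [:: ((0, 6), 6%N, 16645)]);
  (3162373, [::], [:: ((-6, -6), 7%N, 1040)]);
  (3162433, [::], [:: ((0, -6), 1%N, 16705); ((6, 6), 4%N, 16645)]);
  (3212308, [:: (266320, (-1, -1))], [:: ((0, -6), 1%N, 66580)]);
  (3412048, [::], [:: ((0, 6), 2%N, 4176)])],
 [:: [:: (66580, (1, 1))];
  [:: (266320, (1, 1))]]);
([:: 266320],
 [:: (66580, [::], [:: ((6, 0), 0%N, 16645)]);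
  (4260884, [:: (266320, (1, 0))], [:: ((-6, -6), 0%N, 16705)]);
  (4460624, [::], [:: ((0, -6), 2%N, 266320)]);
  (8455188, [::], [:: ((0, -6), 0%N, 66580)]);
  (8654928, [::], [:: ((0, -6), 0%N, 266320)]);
  (12649492, [::], [:: ((0, 6), 2%N, 16645)]);
  (12849232, [::], [:: ((0, -6), 1%N, 266320)])],
 [:: [:: (266320, (1, 0))]]);
([::],
 [:: (266320, [::], [:: ((6, 0), 0%N, 66580)]);
  (17043536, [::], [:: ((0, -6), 2%N, 266320)]);
  (33820752, [::], [:: ((0, -6), 0%N, 266320)]);
  (50597968, [::], [:: ((0, -6), 1%N, 266320)])],
 [::])].
Definition one_data : seq (seq Z * seq (Z * seq (Z * co) * seq (co * nat * Z)) * seq (seq (Z * co))) :=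
[:: ([:: 0],
 [::],
 [:: [:: (0, (1, 0))]]);
([:: 0],
 [:: (4, [::], [:: ((0, -6), 2%N, 0)]);
  (8, [::], [:: ((0, -6), 0%N, 0)]);
  (12, [::], [:: ((0, -6), 1%N, 0)])],
 [:: [:: (0, (0, -1))]]);
([::],
 [:: (0, [::], [:: ((6, 0), 4%N, 0)]);
  (16, [::], [:: ((0, -6), 2%N, 0)]);
  (32, [::], [:: ((0, -6), 0%N, 0)]);
  (48, [::], [:: ((0, -6), 1%N, 0)])],
 [::])].
(* Functionals vanishing on the Nichols algebra: the four quadratic relations,
   the cubes of the letters and one relation in degree 6. *)
Definition rel_data : seq (nat * seq (Z * co)) :=
[:: (2%N, [:: (1, (1, 0)); (8, (1, 1)); (6, (-1, -1))]);
(2%N, [:: (2, (1, 0)); (12, (1, 1)); (11, (-1, -1))]);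
(2%N, [:: (3, (1, 0)); (4, (1, 1)); (13, (-1, -1))]);
(2%N, [:: (7, (1, 0)); (9, (-1, -1)); (14, (0, 1))]);
(3%N, [:: (0, (1, 0))]);
(3%N, [:: (21, (1, 0))]);
(3%N, [:: (42, (1, 0))]);
(3%N, [:: (63, (1, 0))]);
(6%N, [:: (3091, (0, -1)); (1047, (-1, 0)); (3934, (1, 0)); (1882, (1, 0)); (2607, (1, 0)); (2369, (1, 0)); (2434, (-1, -1))])].
End KernelData.

Definition kernel_rels : seq lform :=
  [seq [seq (code_word r.1 e.1, e.2) | e <- r.2] | r <- rel_data].

(** In a certificate entry the word follows a relation inside words of length [n], so its length is
    [n] minus the degree of that relation. *)
Definition kernel_level (n : nat)
    (d : seq Z * seq (Z * seq (Z * co) * seq (co * nat * Z)) * seq (seq (Z * co))) :=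
  ([seq code_word n c | c <- d.1.1],
   [seq ((code_word n e.1.1, [seq (code_word n a.1, a.2) | a <- e.1.2]),
         [seq (a.1, code_word (n - (nth (0%N, [::]) rel_data a.1.2).1) a.2) | a <- e.2])
    | e <- d.1.2],
   [seq list_trie n b | b <- d.2]).

Definition kernel_levels d :=
  [seq kernel_level e.1.+1 e.2 | e <- zip (iota 0 (size d)) d].

(* At a primitive cube root of unity [t = tau] one has [-1 / t = 1 + tau]. *)
Definition w_t : co := (Z0, Zpos xH).
Definition w_l : co := (Zpos xH, Zpos xH).
Definition w_lt : co := (Z0, Zneg xH).

Definition pset (a b c d : bool) : letter -> bool := sel a b c d.

Definition kernel_check a b c d s :=
  levels_check (Zneg xH) (Zneg xH) w_t c1 w_l w_lt (pset a b c d) kernel_rels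
    (Zpos 6, Z0) 1 (rules0 (pset a b c d)) [:: [::]] (kernel_levels s).

Lemma one_check : kernel_check true false false false one_data.
Proof. by vm_compute. Qed.

Lemma two_check : kernel_check true true false false two_data.
Proof. by vm_compute. Qed.

Lemma rel_check : all (fun r => let T := list_trie r.1 r.2 in
  homT r.1 T && vanT (Zneg xH) (Zneg xH) w_t c1 w_l w_lt letters r.1 T) rel_data.
Proof. by vm_compute. Qed.

(** * Left coideal subalgebras and final letters *)

Section Coideals.
Variables (K : fieldType) (t l : K).
Hypotheses (ht : t != 0) (hl : l != 0) (hlt : l ^+ 2 = t ^+ 4).

Notation tens := (seq rk -> K).
Notation qc := (qc t l).
Notation tmul := (tmul t l).
Notation "f ** g" := (tmul f g) (at level 40, left associativity).
Notation tzero := (@tzero K).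
Notation tvec := (tvec K).
Notation gen := (gen t l).
Notation vecs := (@vecs K).
Notation KS := (KS t l).
Implicit Types (f g h : tens) (S C : tens -> Prop) (P : letter -> bool).

Definition tword (u : seq rk) : tens := fun w => if w == u then 1 else 0.

Lemma vec_vec x y :
  tvec x ** tvec y = tadd (tword [:: x; y]) (tscale (qc x y) (tword [:: rtri x y; x])).
Proof.
apply: functional_extensionality => -[|z w].
  by rewrite tmul_nil /tadd /tscale /tword /tvec /= mul0r mulr0 addr0.
rewrite -[LHS]/(dl z (tvec x ** tvec y) w) dl_vec_mul // dl_vec.
rewrite /tadd /tscale /tword !eqseq_cons -/(_ == _).
congr (_ + _); first by case: (z == x).
rewrite -(can2_eq (irtriK x) (rtriK x)).
case: eqP => [<-|_]; first by rewrite tmul1r.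
by rewrite tmul0r /tzero !mulr0.
Qed.

Lemma mul_letter f g x : (f ** g) [:: x] = f [:: x] * g [::] + f [::] * g [:: x].
Proof.
rewrite tmul_cons tmul_nil; congr (_ + _).
rewrite (bigD1 x) //= big1 ?addr0 => [|b /negbTE ne]; rewrite tmul_nil tw_nil.
  by rewrite eqxx.
by rewrite ne mul0r.
Qed.

(** By [mul_letter], evaluation at a letter obeys a Leibniz rule with the constant terms as weights,
    so products create no new letter in degree one. *)
Lemma gen_letter0 S x f : (forall s, S s -> s [:: x] = 0) -> gen S f -> f [:: x] = 0.
Proof.
move=> hS; elim=> {f} [//|f /hS //|f g _ hf _ hg|k f _ hf|f g _ hf _ hg].
- by rewrite /tadd hf hg addr0.
- by rewrite /tscale hf mulr0.
- by rewrite mul_letter hf hg mulr0 mul0r addr0.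
Qed.

Lemma gen_vecs1 C P f : (forall g x, C g -> ~~ P x -> g [:: ol x] = 0) ->
  gen (fun g => C g /\ homog 1 g) f -> gen (vecs P) f.
Proof.
move=> hC; apply: gen_sub => g [hg h1].
have -> : g = tsum (fun x => tscale (g [:: x]) (tvec x)).
  apply: functional_extensionality => w; rewrite /tsum /tscale /tvec.
  case: w => [|x [|y w]].
  - by rewrite h1 // big1 // => x _; rewrite mulr0.
  - rewrite (bigD1 x) //= eqxx mulr1 big1 ?addr0 // => y /negbTE ne.
    by rewrite eqseq_cons eq_sym ne mulr0.
  - by rewrite h1 // big1 // => z _; rewrite eqseq_cons andbF mulr0.
apply: gen_sum => x; have [y ->] := olP x.
have [hy|hy] := boolP (P y); last by rewrite (hC g) // tscale0l; apply: gen_zero.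
by apply: gen_scale; apply: gen_in; exists y.
Qed.

Lemma genP S T : (forall f, S f -> gen T f) -> (forall f, T f -> gen S f) ->
  gen S = gen T.
Proof.
move=> h1 h2; apply: functional_extensionality => f; apply: propositional_extensionality.
by split; apply: gen_sub.
Qed.

(* A homogeneous component outside [C] exists because the support of [f] meets
   finitely many classes of words. *)
Lemma gproj_notin C f : (exists N, forall w, (N < size w)%N -> f w = 0) ->
  C tzero -> (forall f g, C f -> C g -> C (tadd f g)) -> ~ C f ->
  exists w0, ~ C (gproj w0 f).
Proof.
move=> [N hN] C0 CD hf; apply: NNPP => hn; apply: hf.
have hp w0 : C (gproj w0 f) by apply: NNPP => h; apply: hn; exists w0.
pose near (W : seq (seq rk)) u := exists2 v, v \in W & geq (gdeg u) (gdeg v).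
have nearE w W u : near (w :: W) u <-> geq (gdeg u) (gdeg w) \/ near W u.
  split=> [[v]|[h|[v hv h]]].
  - by rewrite inE => /orP [/eqP ->|hv] h; [left|right; exists v].
  - by exists w; rewrite ?inE ?eqxx.
  - by exists v; rewrite ?inE ?hv ?orbT.
have ifT (A : Prop) (x y : K) : A -> (if excluded_middle_informative A then x else y) = x.
  by case: (excluded_middle_informative A).
have ifF (A : Prop) (x y : K) : ~ A -> (if excluded_middle_informative A then x else y) = y.
  by case: (excluded_middle_informative A).
pose cut W : tens := fun u => if excluded_middle_informative (near W u) then f u else 0.
have hcut W : C (cut W).
  elim: W => [|w W IH].
    rewrite (_ : cut _ = tzero) //; apply: functional_extensionality => u.
    by rewrite /cut ifF // => -[].
  case: (classic (near W w)) => hw.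
    rewrite (_ : cut _ = cut W) //; apply: functional_extensionality => u; rewrite /cut.
    case: (classic (near W u)) => h; first by rewrite !ifT // nearE; right.
    rewrite !ifF // nearE => -[h1|//]; apply: h; have [v vW hwv] := hw.
    by exists v => //; apply: geq_trans hwv.
  rewrite (_ : cut _ = tadd (gproj w f) (cut W)); first exact: CD.
  apply: functional_extensionality => u; rewrite /cut /tadd /gproj.
  case: (classic (geq (gdeg u) (gdeg w))) => h1.
    rewrite (ifT (near (w :: W) u)) ?(ifT (geq _ _)) ?ifF ?addr0 //; last by rewrite nearE; left.
    by move=> [v vW h]; apply: hw; exists v => //; apply: geq_trans h; apply: geq_sym.
  rewrite (ifF (geq _ _)) // add0r; case: (classic (near W u)) => h2.
    by rewrite !ifT // nearE; right.
  by rewrite !ifF // nearE => -[].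
rewrite (_ : f = cut (flatten [seq words i | i <- iota 0 N.+1])) //.
apply: functional_extensionality => u; rewrite /cut.
case: (excluded_middle_informative _) => // h; apply: hN; rewrite ltnNge.
apply/negP => hu; apply: h; exists u; last exact: geq_refl.
apply/flatten_mapP; exists (size u); last by rewrite mem_words.
by rewrite mem_iota /= add0n ltnS.
Qed.

Lemma geq_cancel x u v : geq (gdeg (x :: u)) (gdeg (x :: v)) -> geq (gdeg u) (gdeg v).
Proof.
have e w : geq ([:: (x, false)] ++ gdeg (x :: w)) (gdeg w).
  exact: (@geq_ctx [::] (gdeg w) _ _ (geq_invl x)).
move=> h; apply: geq_trans (e v); apply: geq_trans (geq_sym (e u)) _.
by apply: geq_cat => //; apply: geq_refl.
Qed.

(** If the degree of [w0] can be written g_x times that of a word [w1], deleting [x] turns the first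
    degree into the second by cancellation; otherwise no word of this component begins with [x]. *)
Lemma dl_gproj x w0 f : dl x (gproj w0 f) = tzero \/
  exists w1, dl x (gproj w0 f) = gproj w1 (dl x f).
Proof.
case: (classic (exists w1, geq (gdeg (x :: w1)) (gdeg w0))) => [[w1 h1]|hn]; [right|left].
  exists w1; apply: functional_extensionality => u; rewrite /dl /gproj.
  case: (excluded_middle_informative (geq (gdeg (x :: u)) _)) => h2;
    case: (excluded_middle_informative (geq (gdeg u) _)) => h3 //=.
    case: h3; apply: (@geq_cancel x); exact: geq_trans h2 (geq_sym h1).
  by case: h2; apply: geq_trans h1; apply: geq_cons.
apply: functional_extensionality => u; rewrite /dl /gproj.
by case: (excluded_middle_informative _) => // h; case: hn; exists u.
Qed.

Lemma homG_gproj w0 f : homG (gdeg w0) (gproj w0 f).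
Proof.
move=> w; rewrite /gproj; case: (excluded_middle_informative _) => //= _.
by rewrite eqxx.
Qed.

Lemma LCS_deg1_gen C f : LCS t l C -> gen (fun g => C g /\ homog 1 g) f -> C f.
Proof.
move=> hC; elim=> {f} [|f [] //|f g _ hf _ hg|k f _ hf|f g _ hf _ hg].
- exact: (lcs_one hC).
- exact: (lcs_add hC).
- exact: (lcs_scale hC).
- exact: (lcs_mul hC).
Qed.

Definition deg1_letters C : letter -> bool := fun x =>
  if excluded_middle_informative (C (tvec (ol x))) then true else false.

(** Both gradings project [f] inside [C] to its part in degree 1 and group degree g_x, which is a
    multiple of v_x because distinct letters have distinct degrees. *)
Lemma LCS_letter C f x : LCS t l C -> C f -> ~~ deg1_letters C x -> f [:: ol x] = 0.
Proof.
move=> hC hf; rewrite /deg1_letters.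
case: (excluded_middle_informative _) => // hx _; apply/eqP/negPn/negP => ne; apply: hx.
have h1 := lcs_Ggraded hC [:: ol x] (lcs_Ngraded hC 1 hf).
suff -> : tvec (ol x) = tscale (f [:: ol x])^-1 (gproj [:: ol x] (nproj 1 f)).
  exact: (lcs_scale hC).
apply: functional_extensionality => w; rewrite /tscale /gproj /nproj /tvec.
case: w => [|y [|z w]]; rewrite ?eqseq_cons ?andbF ?andbT /= ?if_same ?mulr0 //.
have [->|ny] := eqVneq y (ol x).
  case: (excluded_middle_informative _) => [_|hn] /=; first by rewrite mulVf.
  by case: hn; apply: geq_refl.
case: (excluded_middle_informative _) => [h|_] /=; last by rewrite mulr0.
by rewrite (geq_letter ht hl hlt h) eqxx in ny.
Qed.

(** On a word ending in [x], the coproduct writes the coefficient as a sum of products whose second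
    factors are values at the single letter [x] of elements of [C]; these vanish. *)
Lemma LCS_KS C f : LCS t l C -> C f -> KS (deg1_letters C) f.
Proof.
move=> hC hf; split; first exact: (lcs_sub hC).
move=> u x hx; have [s [hs e]] := lcs_coideal hC hf.
rewrite -cats1 e; elim: s hs {e} => [|p s IH] hs; first by rewrite big_nil.
rewrite big_cons IH ?addr0; last by inversion hs.
by rewrite (@LCS_letter C) ?mulr0 //; inversion hs as [|? ? []].
Qed.

Definition KSgen P := forall f, KS P f -> gen (vecs P) f.

Lemma LCS_deg1 C : LCS t l C -> KSgen (deg1_letters C) -> gen_deg1 t l C.
Proof.
move=> hC hK f; split=> [hf|]; last exact: LCS_deg1_gen.
apply: gen_sub (hK _ (LCS_KS hC hf)) => g [x hx ->]; apply: gen_in.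
split; last exact: homog_vec.
by move: hx; rewrite /deg1_letters; case: (excluded_middle_informative _).
Qed.
End Coideals.

(** * Primitive cube roots of unity *)

Section CubeRoot.
Variables (K : fieldType) (t l : K).
Hypotheses (hK : [pchar K] =i pred0) (ht0 : t ^+ 2 + t + 1 = 0) (htl : l = - t^-1).

Notation tens := (seq rk -> K).
Notation qc := (qc t l).
Notation tmul := (tmul t l).
Notation "f ** g" := (tmul f g) (at level 40, left associativity).
Notation tone := (tone K).
Notation tzero := (@tzero K).
Notation tvec := (tvec K).
Notation act := (act t l).
Notation gen := (gen t l).
Notation Bnich := (Bnich t l).
Notation vecs := (@vecs K).
Notation KS := (KS t l).
Notation KSgen := (KSgen t l).
Notation cK := (cK t).
Implicit Types (f g h : tens) (S C : tens -> Prop) (P : letter -> bool).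

Let ht : t != 0.
Proof. by apply/eqP => e; move: ht0; rewrite e expr0n /= !add0r => /eqP; rewrite oner_eq0. Qed.

Let t2 : t ^+ 2 = - t - 1.
Proof. by apply/eqP; rewrite -subr_eq0 -ht0; apply/eqP; ring. Qed.

Let t3 : t ^+ 3 = 1.
Proof. by rewrite exprS t2; transitivity (1 - (t ^+ 2 + t + 1)); [ring|rewrite ht0 subr0]. Qed.

Let lE : l = 1 + t.
Proof.
rewrite htl; have -> : t^-1 = t ^+ 2 by apply: (mulfI ht); rewrite divff // -exprS t3.
by rewrite t2; ring.
Qed.

Let hl : l != 0.
Proof. by rewrite htl oppr_eq0 invr_eq0. Qed.

Let hlt : l ^+ 2 = t ^+ 4.
Proof. by rewrite lE [in RHS]exprS t3 mulr1 -[RHS]addr0 -ht0; ring. Qed.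

Let hlt' : l / t = - t.
Proof. by apply: (mulIf ht); rewrite divfK // lE mulNr -expr2 t2; ring. Qed.

Let zKm1 : zK K (Zneg xH) = -1.
Proof. by []. Qed.

Let htau : t ^+ 2 = zK K (Zneg xH) * t + zK K (Zneg xH).
Proof. by rewrite zKm1 mulN1r t2. Qed.

Let hqt : cK w_t = t.
Proof. by rewrite /cK /zK /= add0r mul1r. Qed.
Let hq1 : cK c1 = 1.
Proof. exact: cK1. Qed.
Let hql : cK w_l = l.
Proof. by rewrite /cK /zK /= mul1r lE. Qed.
Let hqlt : cK w_lt = l / t.
Proof. by rewrite /cK /zK /= add0r mulN1r hlt'. Qed.

(** The cube of g_x acts trivially on V: the scalars along its orbits multiply to t^3 = 1 or to l (l
    / t) = 1. *)
Lemma qc_cycle x b : qc x b * qc x (rtri x b) * qc x (rtri x (rtri x b)) = 1.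
Proof.
have e : l * (l / t) = 1 by rewrite mulrA -expr2 hlt exprS t3 mulr1 divff.
have e3 : t * t * t = 1 by rewrite -t3; ring.
elim/rk_ind: x; elim/rk_ind: b; rewrite !rtriE /Defs.qc //=;
  rewrite ?mul1r ?mulr1 // mulrC //.
Qed.

Lemma act3 x f : act x (act x (act x f)) = f.
Proof.
apply: functional_extensionality => w; elim: w f => [|z w IH] f.
  by rewrite !act_nil.
rewrite -{1}(rtri3 x z) -[LHS]/(dl _ _ w) dl_act dl_act actZ dl_act !actZ !tscaleA.
by rewrite /tscale IH /dl -[RHS]mul1r -(qc_cycle x z); ring.
Qed.

Lemma KS_act x P f : KS P f -> KS (fun y => P (litri x y)) (act (ol x) f).
Proof.
move=> [hB hP]; split; first exact: Bnich_act.
move=> u y hy; rewrite /act map_rcons -ol_itri hP ?mulr0 //.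
Qed.

(** Since g_x has order 3, an element of the transported space is moved back to the space of [P] by
    acting twice, written there in the letters of [P], and carried forward by acting once more. *)
Lemma KSgen_act x P : KSgen P -> KSgen (fun y => P (litri x y)).
Proof.
move=> hP f hf; rewrite -(act3 (ol x) f).
apply: (@gen_act _ _ _ ht hlt (vecs P)) => [s [y hy ->]|].
  rewrite act_vec -ol_tri; apply: gen_scale; apply: gen_in.
  by exists (ltri x y); rewrite ?ltriK.
apply: hP; have := KS_act x (KS_act x hf); congr (KS _ _).
apply: functional_extensionality => y; congr P.
by case: x {hf}; case: y.
Qed.

Let rels_ok i : rel_ok t l t (nth [::] kernel_rels i).
Proof.
move=> f hf; case: (ltnP i (size rel_data)) => hi; last first.
  by rewrite nth_default ?size_map // /apL big_nil.
rewrite (nth_map (0%N, [::])) // -apT_lform.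
have := all_nthP (0%N, [::]) rel_check i hi; set r := nth _ _ _ => /andP [h1 h2].
have -> : lform_trie [seq (code_word r.1 e.1, e.2) | e <- r.2] = list_trie r.1 r.2.
  by rewrite /list_trie; elim: (r.2) => //= e s ->.
exact: (vanT_Bnich ht hlt htau hqt hq1 hql hqlt h1 h2).
Qed.

Lemma zK_neq0 (m : Z) : Z.eqb m Z0 = false -> zK K m != 0.
Proof.
move=> hm; have h n : (n.+1%:R != 0 :> K) by rewrite ((pcharf0P K).1 hK).
rewrite /zK; case: m hm => //= n _.
  by rewrite -(prednK (n := Pos.to_nat n)) ?h //; apply/ltP; apply: Pos2Nat.is_pos.
by rewrite NegzE mulrNz oppr_eq0; apply: h.
Qed.

Lemma KSgen_check a b c d s : kernel_check a b c d s -> KSgen (pset a b c d).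
Proof.
move=> hs f hf; apply: (KS_gen ht hlt htau hqt hq1 hql hqlt _ rels_ok hs hf).
by rewrite /cK /= [zK K Z0 * t]mul0r addr0 zK_neq0.
Qed.

Lemma KSgen0 : KSgen (pset false false false false).
Proof.
move=> f [hB h]; suff -> : f = tscale (f [::]) tone by apply: gen_scale; apply: gen_one.
apply: functional_extensionality => w; rewrite /tscale /tone.
case/lastP: w => [|w x]; first by rewrite mulr1.
have [y ->] := olP x; rewrite h; last by case: y.
by case: w => *; rewrite mulr0.
Qed.

Lemma KSgen4 : KSgen (pset true true true true).
Proof.
move=> f [hB _]; apply: gen_sub hB => s [x ->]; have [y ->] := olP x.
by apply: gen_in; exists y => //; case: y.
Qed.

Let N := gen (vecs (pset true true true false)).

Let N_vec y : y <> Ld -> N (tvec (ol y)).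
Proof. by move=> h; apply: gen_in; exists y => //; case: y h. Qed.

(** These are the quadratic relations, each solved for the product that starts with [d]. *)
Let d_move y : y <> Ld -> exists g k y',
  [/\ N g, y' <> Ld & tvec rd ** tvec (ol y) = tadd g (tscale k (tvec (ol y') ** tvec rd))].
Proof.
have tl : t * l = -1 by rewrite htl mulrN divff.
have e4 : l / t * (l / t) * (l / t) = -1.
  by rewrite hlt'; transitivity (- t ^+ 3); [ring|rewrite t3].
case: y => // _.
- exists (tscale t^-1 (tvec ra ** tvec rc)), 1, Lc; split=> //.
    by apply: gen_scale; apply: gen_mul; [apply: (@N_vec La)|apply: (@N_vec Lc)].
  rewrite !vec_vec // !rtriE /Defs.qc /= htl tscale1 !tscaleDr !tscaleA mulVf //.
  by apply: functional_extensionality => w; rewrite /tadd /tscale; ring.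
- exists (tvec rb ** tvec ra), l, La; split=> //.
    by apply: gen_mul; [apply: (@N_vec Lb)|apply: (@N_vec La)].
  rewrite !vec_vec // !rtriE /Defs.qc /= !tscaleDr !tscaleA [l * t]mulrC tl.
  by apply: functional_extensionality => w; rewrite /tadd /tscale; ring.
- exists (tscale (- (l / t * (l / t))) (tvec rc ** tvec rb)), (l / t), Lb; split=> //.
    by apply: gen_scale; apply: gen_mul; [apply: (@N_vec Lc)|apply: (@N_vec Lb)].
  rewrite !vec_vec // !rtriE /Defs.qc /= !tscaleDr !tscaleA mulNr e4.
  by apply: functional_extensionality => w; rewrite /tadd /tscale; ring.
Qed.

Let d_N f : N f -> exists g h, [/\ N g, N h & tvec rd ** f = tadd g (h ** tvec rd)].
Proof.
move/(gen_span ht hlt); elim=> [|k s {}f hs _ [g1 [h1 [Ng1 Nh1 e1]]]].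
  exists tzero, tzero; split; try exact: gen_zero.
  by rewrite tmul0r tmul0l tadd0.
suff [g [h [Ng Nh e]]] : exists g h, [/\ N g, N h & tvec rd ** prodl t l s = tadd g (h ** tvec rd)].
  exists (tadd (tscale k g) g1), (tadd (tscale k h) h1); split.
  - by apply: gen_add => //; apply: gen_scale.
  - by apply: gen_add => //; apply: gen_scale.
  rewrite tmulDr tmulZr e e1 tmulDl tmulZl tscaleDr.
  by apply: functional_extensionality => w; rewrite /tadd; ring.
elim: s hs => [|f2 s IH] hs.
  exists tzero, tone; split; [exact: gen_zero|exact: gen_one|].
  by rewrite /= tmul1r // tmul1l // t0add.
have [g [h [Ng Nh e]]] := IH (fun i => hs i.+1).
have [y hy e2] := hs 0%N isT; have {}e2 : f2 = tvec (ol y) by [].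
have [|g2 [k2 [y2 [Ng2 hy2 e3]]]] := @d_move y; first by case: y hy {e2}.
have Ns : N (prodl t l s) by apply: gen_prodl => i; apply: (hs i.+1).
exists (tadd (g2 ** prodl t l s) (tscale k2 (tvec (ol y2) ** g))),
  (tscale k2 (tvec (ol y2) ** h)); split.
- by apply: gen_add; [apply: gen_mul|apply: gen_scale; apply: gen_mul => //; apply: N_vec].
- by apply: gen_scale; apply: gen_mul => //; apply: N_vec.
rewrite [prodl _ _ _]/= e2 tmulA // e3 tmulDl tmulZl -tmulA // e tmulDr tmulA //.
by rewrite tscaleDr tmulZl -taddA.
Qed.

(** The braiding multiplies d (x) d by [t], so the cube of [d] carries the quantum factorial (1 +
    t)(1 + t + t^2), which is 0. *)
Let ddd : tvec rd ** (tvec rd ** tvec rd) = tzero.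
Proof.
have e : zeroT (Zneg xH) (Zneg xH) w_t c1 w_l w_lt 3 (wordT c1 [:: Ld; Ld; Ld]) by vm_compute.
have h : homT 3 (wordT c1 [:: Ld; Ld; Ld]) by [].
have := zeroT_ok htau hqt hq1 hql hqlt h e.
by rewrite evT_word cK1 tscale1 /= tmul1r.
Qed.

(* Every element is [f0 + f1 d + f2 d^2] with the [fi] generated by [a, b, c]. *)
Let Bnich_decomp f : Bnich f -> exists f0 f1 f2, [/\ N f0, N f1, N f2 &
  f = tadd f0 (tadd (f1 ** tvec rd) (f2 ** (tvec rd ** tvec rd)))].
Proof.
move/(gen_span ht hlt); elim=> [|k s {}f hs _ [g0 [g1 [g2 [Ng0 Ng1 Ng2 eg]]]]].
  exists tzero, tzero, tzero; split; try exact: gen_zero.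
  by rewrite !tmul0l !tadd0.
suff [f0 [f1 [f2 [Nf0 Nf1 Nf2 e]]]] : exists f0 f1 f2, [/\ N f0, N f1, N f2 &
  prodl t l s = tadd f0 (tadd (f1 ** tvec rd) (f2 ** (tvec rd ** tvec rd)))].
  exists (tadd (tscale k f0) g0), (tadd (tscale k f1) g1), (tadd (tscale k f2) g2).
  split; try by apply: gen_add => //; apply: gen_scale.
  rewrite e eg !tmulDl !tmulZl !tscaleDr.
  by apply: functional_extensionality => w; rewrite /tadd; ring.
elim: s hs => [|f2 s IH] hs.
  exists tone, tzero, tzero; split; [exact: gen_one|exact: gen_zero|exact: gen_zero|].
  by rewrite !tmul0l !tadd0.
have [f0 [f1 [f3 [Nf0 Nf1 Nf3 e]]]] := IH (fun i => hs i.+1).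
have [x e2] := hs 0%N isT; have {}e2 : f2 = tvec x by [].
rewrite [prodl _ _ _]/= e2 e; have [y ey] := olP x.
case: (classic (y = Ld)) => [ed|ny]; last first.
  exists (tvec x ** f0), (tvec x ** f1), (tvec x ** f3).
  by split; try (by apply: gen_mul => //; rewrite ey; apply: N_vec); rewrite !tmulDr !tmulA.
have -> : x = rd by rewrite ey ed.
have [p0 [q0 [Np0 Nq0 e0]]] := d_N Nf0.
have [p1 [q1 [Np1 Nq1 e1]]] := d_N Nf1.
have [p3 [q3 [Np3 Nq3 e4]]] := d_N Nf3.
exists p0, (tadd q0 p1), (tadd q1 p3); split=> //; try exact: gen_add.
rewrite !tmulDr e0 !tmulA // e1 -[tvec rd ** f3 ** _ ** _]tmulA // e4.
rewrite !tmulDl -!tmulA // ddd tmul0r tadd0.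
by apply: functional_extensionality => w; rewrite /tadd; ring.
Qed.

Let dr_N f : N f -> dr rd f = tzero.
Proof.
move=> hf; apply: functional_extensionality => u.
rewrite -[LHS]/(f (rcons u (ol Ld))) -[RHS]/(0 : K).
exact: (@gen_vecs_end _ _ _ _ _ u Ld hf isT).
Qed.

(** Deleting a final [d] is zero on elements generated by [a], [b], [c], sends [d] to 1 and [d^2] to
    [(1 + t) d], where 1 + t = l is invertible. Deleting twice therefore gives [f2 = 0], and
    deleting once then gives [f1 = 0]. *)
Lemma KSgen3 : KSgen (pset true true true false).
Proof.
move=> f [/Bnich_decomp [f0 [f1 [f2 [N0 N1 N2 e]]]] hd].
have t1 : 1 + t != 0 by rewrite -lE.
have dd : dr rd (tvec rd) = tone by rewrite dr_vec eqxx.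
have ddd2 : dr rd (tvec rd ** tvec rd) = tscale (1 + t) (tvec rd).
  rewrite dr_mul // dd tmul1r // tmul1l // act_vec rtriE tscaleDl tscale1.
  by [].
have h1 : tadd f1 (tscale (1 + t) (f2 ** tvec rd)) = tzero.
  have : dr rd f = tzero by apply: functional_extensionality => u; apply: (hd u Ld).
  rewrite e => h; rewrite -[RHS]h.
  rewrite -[RHS]/(tadd (dr rd f0) (tadd (dr rd (f1 ** tvec rd)) (dr rd (f2 ** (tvec rd ** tvec rd))))).
  have -> : dr rd (f1 ** tvec rd) = f1.
    by rewrite dr_mul // dd (dr_N N1) tmul0l tadd0 tmul1r.
  have -> : dr rd (f2 ** (tvec rd ** tvec rd)) = tscale (1 + t) (f2 ** tvec rd).
    by rewrite dr_mul // ddd2 (dr_N N2) tmul0l tadd0 tmulZr.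
  by rewrite dr_N // t0add.
have f20 : f2 = tzero.
  have h : dr rd (tadd f1 (tscale (1 + t) (f2 ** tvec rd))) = tzero by rewrite h1.
  have : tscale (1 + t) f2 = tzero.
    rewrite -[RHS]h -[RHS]/(tadd (dr rd f1) (tscale (1 + t) (dr rd (f2 ** tvec rd)))).
    by rewrite dr_N // t0add dr_mul // dd (dr_N N2) tmul0l tadd0 tmul1r.
  move=> h2; rewrite -[f2]tscale1 -(mulVf t1) -tscaleA h2.
  exact: tscale_r0.
have f10 : f1 = tzero by move: h1; rewrite f20 tmul0l tscale_r0 tadd0.
by rewrite e f10 f20 !tmul0l !tadd0.
Qed.

Lemma KSgen_pset x a b c d : KSgen (pset a b c d) ->
  KSgen (pset (pset a b c d (litri x La)) (pset a b c d (litri x Lb))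
    (pset a b c d (litri x Lc)) (pset a b c d (litri x Ld))).
Proof.
move/(@KSgen_act x _); rewrite (_ : (fun y => _) = pset (pset a b c d (litri x La))
  (pset a b c d (litri x Lb)) (pset a b c d (litri x Lc)) (pset a b c d (litri x Ld))) //.
by apply: functional_extensionality; case.
Qed.

Arguments KSgen_pset x [a b c d] _.

Lemma KSgen_all P : KSgen P.
Proof.
have -> : P = pset (P La) (P Lb) (P Lc) (P Ld).
  by apply: functional_extensionality; case.
have a1 := KSgen_check one_check.
have ab := KSgen_check two_check.
(* The letter [a] carries {a, b} to {a, c} and that to {a, d}; the other sets of letters are reached
   in the same way, by one letter from a set already treated. *)
have ac := KSgen_pset La ab.
have ad := KSgen_pset La ac.
case: (P La); case: (P Lb); case: (P Lc); case: (P Ld).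
- exact: KSgen4.
- exact: KSgen3.
- exact: (KSgen_pset Lb KSgen3).
- exact: ab.
- exact: (KSgen_pset La KSgen3).
- exact: ac.
- exact: ad.
- exact: a1.
- exact: (KSgen_pset Lc KSgen3).
- exact: (KSgen_pset Ld ac).
- exact: (KSgen_pset Lc ab).
- exact: (KSgen_pset Lc a1).
- exact: (KSgen_pset Ld ad).
- exact: (KSgen_pset Ld a1).
- exact: (KSgen_pset Lb a1).
- exact: KSgen0.
Qed.
End CubeRoot.

(** * Subalgebras not generated in degree one *)

Section Cases.
Variables (K : fieldType) (t l s : K).
Hypotheses (ht : t != 0) (hl : l != 0) (hlt : l ^+ 2 = t ^+ 4) (hs : s != 0).

Notation tens := (seq rk -> K).
Notation tmul := (tmul t l).
Notation "f ** g" := (tmul f g) (at level 40, left associativity).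
Notation tzero := (@tzero K).
Notation tvec := (tvec K).
Notation gen := (gen t l).
Notation Bnich := (Bnich t l).
Notation vecs := (@vecs K).
Notation sv x := (tscale s (tvec x)).
Notation ab := (among [:: La; Lb]).
Implicit Types (f g h : tens) (S C : tens -> Prop) (P : letter -> bool).

Lemma Bnich_sv x : Bnich (sv x).
Proof. by apply: gen_scale; apply: Bnich_vec. Qed.

Lemma homog_sv x : homog 1 (sv x).
Proof. by apply: homog_scale; apply: homog_vec. Qed.

Lemma homG_sv x : homG (gdeg [:: x]) (sv x).
Proof. by apply: homG_scale; apply: homG_vec. Qed.

Lemma dl_sv S x y : gen S (dl x (sv y)).
Proof. by rewrite dlZ; apply: gen_scale; apply: vec_dl. Qed.

Lemma unscale k f : k != 0 -> f = tscale k^-1 (tscale k f).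
Proof. by move=> hk; rewrite tscaleA mulVf // tscale1. Qed.

Lemma gen_sv S x : S (sv x) -> gen S (tvec x).
Proof. by move=> h; rewrite [tvec x](unscale _ hs); apply: gen_scale; apply: gen_in. Qed.

(** Crossing [b] permutes the letters other than [b], so the derivative along such a letter passes
    through every factor of a power of [b] and finds nothing to delete. *)
Lemma gen_b_dl f x : gen (vecs (among [:: Lb])) f -> x != rb -> dl x f = tzero.
Proof.
move=> /(gen_span ht hlt) hf hx; elim: hf => {f} [//|k r f hr _ IH].
rewrite dlD dlZ IH tadd0; suff -> : dl x (prodl t l r) = tzero by exact: tscale_r0.
elim: r x hx hr {f k IH} => [//|f r IH] x hx hr.
have [y hy e] := hr 0%N isT; have {}e : f = tvec rb by move: hy e; case: y => //= _ ->.
rewrite [prodl _ _ _]/= e dl_vec_mul // (negbTE hx) t0add IH ?tmul0r ?tscale_r0 //.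
  by rewrite (can2_eq (irtriK rb) (rtriK rb)) rtriE.
by move=> i; apply: (hr i.+1).
Qed.

Lemma LCS_b_z_not_gen_deg1 : t ^+ 6 != 1 ->
  let z := tadd (tadd (sv ra ** sv rb) (tscale (- t) (sv rc ** sv ra)))
             (tscale t (sv rb ** sv rc)) in
  let C := gen (fun f => f = sv rb \/ f = z) in
  LCS t l C /\ ~ gen_deg1 t l C.
Proof.
move=> h6 z; set S := (fun f => _) => C.
pose k := s * s * (1 + t * l).
(* If t l were -1, then t^6 = (t l)^2 would be 1. *)
have k0 : k != 0.
  rewrite !mulf_neq0 // addrC addr_eq0; apply: contra h6 => /eqP h.
  have -> : t ^+ 6 = (t * l) ^+ 2 by rewrite exprMn hlt -exprD.
  by rewrite h sqrrN expr1n.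
have zE : z = tscale k (tword K [:: ra; rb]).
  rewrite /z !tmulZl !tmulZr !vec_vec // !rtriE /Defs.qc /=.
  by apply: functional_extensionality => w; rewrite /tadd /tscale /k; ring.
have dz x : dl x z = tscale (if x == ra then k else 0) (tvec rb).
  rewrite zE; apply: functional_extensionality => w.
  rewrite /dl /tscale /tword /tvec eqseq_cons.
  by case: (x == ra); rewrite //= mulr0 mul0r.
have zB : Bnich z.
  by do ![apply: gen_add => //]; try apply: gen_scale; apply: gen_mul; apply: Bnich_sv.
have zh : homog 2 z.
  rewrite zE; apply: homog_scale => w hw; rewrite /tword.
  by case: eqP => // e; rewrite e in hw.
split.
  apply: gen_LCS => // [f [->|->]|f [->|->]|f [->|->]|f x [->|->]].
  - exact: Bnich_sv.
  - exact: zB.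
  - by exists 1%N; apply: homog_sv.
  - by exists 2%N.
  - by exists (gdeg [:: rb]); apply: homG_sv.
  - exists (gdeg [:: ra; rb]); rewrite zE; apply: homG_scale => w; rewrite /tword.
    by case: (w =P _) => [-> _|_]; [apply: geq_refl|rewrite eqxx].
  - exact: dl_sv.
  by rewrite dz; apply: gen_scale; apply: gen_sv; left.
move=> h; have /h hz : C z by apply: gen_in; right.
(* The degree one part of [C] contains no letter but [b], so generation in degree one would make [z]
   a polynomial in [b]; but deleting [a] from [z] leaves a nonzero multiple of [b]. *)
have hb : gen (vecs (among [:: Lb])) z.
  apply: gen_vecs1 hz => g x hg hx; apply: gen_letter0 hg => f [->|->].
    by rewrite /tscale /tvec eqseq_cons; case: x hx => //= _; rewrite mulr0.
  by rewrite zh.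
have := gen_b_dl hb (isT : ra != rb) => /(congr1 (fun f => f [:: rb])).
by rewrite dz eqxx /tscale /tvec eqxx mulr1 /tzero => /eqP; rewrite (negbTE k0).
Qed.

Section EngineCases.
Variables (p q : Z) (qt q1 ql qlt : co) (tau : K).
Notation cK := (cK tau).
Notation evT := (evT t l tau).
Hypotheses (htau : tau ^+ 2 = zK K p * tau + zK K q)
  (hqt : cK qt = t) (hq1 : cK q1 = 1) (hql : cK ql = l) (hqlt : cK qlt = l / t).

Lemma der_checkP n T G x : der_check p q qt q1 ql qlt n T G x -> dl (ol x) (evT T) = evT G.
Proof.
move=> /andP [h1 h2]; have := zeroT_ok htau hqt hq1 hql hqlt h1 h2.
rewrite evT_plus (evT_tder htau hqt hq1 hql hqlt) (evT_scal t l htau).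
have -> : cK (Zneg xH, Z0) = -1 by rewrite /cK /zK /= mul0r addr0.
move=> h; apply: functional_extensionality => w.
have := congr1 (fun f => f w) h; rewrite /tadd /tscale /tzero mulN1r => /eqP.
by rewrite subr_eq0 => /eqP.
Qed.

Definition z_trie (k1 k2 : co) : trie :=
  tplus (tplus (wordT c1 [:: Lc; Lb; La]) (wordT k1 [:: La; Lc; Lb]))
    (wordT k2 [:: Lb; La; Lc]).

Definition z_der (x : letter) : trie :=
  match x with
  | Lc => wordT (Zpos 2, Z0) [:: Lb; La]
  | Ld => wordT (Zpos 2, Z0) [:: La; Lb]
  | _ => TE
  end.

Definition z_check k1 k2 : bool :=
  let w := wordT c1 [:: Lc; Lb; La] in
  [&& all (fun x => der_check p q qt q1 ql qlt 2 (z_trie k1 k2) (z_der x) x) letters,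
      vanT p q qt q1 ql qlt [:: La; Lb] 3 w &
      czero (cadd (pairT p q qt q1 ql qlt w (z_trie k1 k2)) (Zneg 2, Z0))].

Lemma LCS_a_b_z_not_gen_deg1 k1 k2 : (2%:R : K) != 0 ->
  cK k1 = - l -> cK k2 = l ^+ 2 -> z_check k1 k2 ->
  let z := tadd (tadd (sv rc ** sv rb ** sv ra) (tscale (- l) (sv ra ** sv rc ** sv rb)))
             (tscale (l ^+ 2) (sv rb ** sv ra ** sv rc)) in
  let C := gen (fun f => [\/ f = sv ra, f = sv rb | f = z]) in
  LCS t l C /\ ~ gen_deg1 t l C.
Proof.
move=> h2 hk1 hk2 /and3P [/all_letters hd hv hp] z; set S := (fun f => _) => C.
have zE : z = tscale (s ^+ 3) (evT (z_trie k1 k2)).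
  rewrite /z_trie !evT_plus !evT_word hk1 hk2 cK1 tscale1 /= !tmul1r // /z.
  rewrite !(tmulZl, tmulZr) !tmulA // !tscaleDr !tscaleA.
  by apply: functional_extensionality => w; rewrite /tadd /tscale; ring.
have S_ab f : gen (vecs ab) f -> C f.
  apply: gen_sub => g [x hx ->]; case: x hx => //= _.
    by apply: gen_sv; constructor 1.
  by apply: gen_sv; constructor 2.
have zB : Bnich z by rewrite zE; apply: gen_scale; apply: evT_Bnich.
have z3 : homog 3 z.
  have h3 x y w : homog 3 (sv x ** sv y ** sv w).
    by apply: (@homog_mul _ _ _ 2 1); [apply: (@homog_mul _ _ _ 1 1)|]; apply: homog_sv.
  by do ![apply: homog_add => //]; apply: homog_scale.
(* The three monomials of [z] have the same group degree, as [gen_LCS] requires: the rack relations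
   turn acb into bac and bac into cba. *)
have zG : homG (gdeg [:: rc; rb; ra]) z.
  have h3 x y w : homG (gdeg [:: x; y; w]) (sv x ** sv y ** sv w).
    rewrite -[gdeg _]/((gdeg [:: x] ++ gdeg [:: y]) ++ gdeg [:: w]).
    by apply: homG_mul; [apply: homG_mul|]; apply: homG_sv.
  have rel x y : geq (gdeg [:: x; y]) (gdeg [:: rtri x y; x]) by exact: geq_rel.
  have relr x y w : geq (gdeg [:: x; y; w]) (gdeg [:: rtri x y; x; w]).
    by apply: (geq_cat (rel x y)); apply: geq_refl.
  have g1 : geq (gdeg [:: rb; ra; rc]) (gdeg [:: rc; rb; ra]).
    apply: (@geq_trans _ (gdeg [:: rb; rd; ra])).
      by apply: geq_cons; have := rel ra rc; rewrite rtriE.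
    by have := relr rb rd ra; rewrite rtriE.
  have g2 : geq (gdeg [:: ra; rc; rb]) (gdeg [:: rb; ra; rc]).
    apply: (@geq_trans _ (gdeg [:: ra; rd; rc])).
      by apply: geq_cons; have := rel rc rb; rewrite rtriE.
    by have := relr ra rd rc; rewrite rtriE.
  apply: homG_add; [apply: homG_add|]; first exact: h3.
    by apply: homG_scale; apply: homG_geq (h3 _ _ _); apply: geq_trans g2 g1.
  by apply: homG_scale; apply: homG_geq (h3 _ _ _).
split.
  apply: gen_LCS => // [f [] ->|f [] ->|f [] ->|f x [] ->].
  - exact: Bnich_sv.
  - exact: Bnich_sv.
  - exact: zB.
  - by exists 1%N; apply: homog_sv.
  - by exists 1%N; apply: homog_sv.
  - by exists 3%N.
  - by exists (gdeg [:: ra]); apply: homG_sv.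
  - by exists (gdeg [:: rb]); apply: homG_sv.
  - by exists (gdeg [:: rc; rb; ra]).
  - exact: dl_sv.
  - exact: dl_sv.
  have [y ->] := olP x; rewrite zE dlZ (@der_checkP 2 _ (z_der y)).
    by apply: gen_scale; apply: S_ab; apply: letT_gen; case: y.
  exact: hd.
move=> h; have /h hz : C z by apply: gen_in; constructor 3.
have hab : gen (vecs ab) z.
  apply: gen_vecs1 hz => g x hg hx; apply: gen_letter0 hg => f [] ->.
  - by rewrite /tscale /tvec eqseq_cons; case: x hx => //= _; rewrite mulr0.
  - by rewrite /tscale /tvec eqseq_cons; case: x hx => //= _; rewrite mulr0.
  by rewrite z3.
have := vanT_gen ht hlt htau hqt hq1 hql hqlt (isT : homT 3 (wordT c1 [:: Lc; Lb; La])) hv hab.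
rewrite zE apTZ -(pairT_ok htau hqt hq1 hql hqlt).
have := czeroP tau hp; rewrite cKD => /eqP; rewrite addr_eq0 => /eqP ->.
have -> : cK (Zneg 2, Z0) = - 2%:R by rewrite /cK /zK /= mul0r addr0.
by move/eqP; rewrite opprK mulf_eq0 expf_eq0 /= (negbTE hs) (negbTE h2).
Qed.
End EngineCases.
End Cases.

(** * The case t = 1, l = -1 *)

Section Case3.
Variables (K : fieldType) (s : K).
Hypotheses (hK : [pchar K] =i pred0) (hs : s != 0).
Notation t := (1 : K).
Notation l := (-1 : K).
Notation gen := (gen t l).
Notation vecs := (@vecs K).
Notation sv x := (tscale s (tvec K x)).
Notation ab := (among [:: La; Lb]).

Let ht : t != 0. Proof. exact: oner_neq0. Qed.
Let hl : l != 0. Proof. by rewrite oppr_eq0 oner_eq0. Qed.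
Let hlt : l ^+ 2 = t ^+ 4. Proof. by rewrite sqrrN !expr1n. Qed.

Lemma zeta_spec : exists z : seq rk -> K,
  [/\ homog 11 z, forall x, gen (vecs ab) (dl x z),
      gen (vecs (among [:: La; Lb; Lc])) z & ~ gen (vecs ab) z].
Proof.
(* All coefficients are integers here, so [tau], [p] and [q] are set to 0. *)
pose ck := cK (0 : K).
have hc1 : ck c1 = t by exact: cK1.
have hcm1 : ck cm1 = l by rewrite /ck /cK /zK /= mul0r addr0.
have hcm2 : ck cm1 = l / t by rewrite divr1.
have htau : (0 : K) ^+ 2 = zK K Z0 * 0 + zK K Z0 by rewrite expr0n mulr0 add0r.
have /and3P [/all_letters hz0 hz1 hz2] := zeta_checkT.
have /and3P [hp1 hp2 hp3] := phi_checkT.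
exists (evT t l 0 zeta); split.
- exact: evT_homog hz1.
- move=> x; have [y ->] := olP x; have /andP [h1 h2] := hz0 y.
  rewrite (der_checkP htau hc1 hc1 hcm1 hcm2 h1).
  exact: letT_gen h2.
- exact: letT_gen hz2.
(* The functional vanishes on products of [a] and [b], while its value at [zeta] is a nonzero
   integer, hence nonzero in characteristic 0. *)
move/(vanT_gen ht hlt htau hc1 hc1 hcm1 hcm2 hp1 hp2).
rewrite -(pairT_ok htau hc1 hc1 hcm1 hcm2) /cK mulr0 addr0 => /eqP; apply/negP.
by apply: zK_neq0 (negbTE hp3).
Qed.

Lemma extension_degree11 :
  let C := gen (fun f => f = sv ra \/ f = sv rb) in
  LCS t l C /\
  exists z, extension t l C 11 z /\ gen (fun f => [\/ f = sv ra, f = sv rb | f = sv rc]) z.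
Proof.
move=> C.
have CE : C = gen (vecs ab).
  apply: genP => f [].
  - by move->; apply: gen_scale; apply: gen_in; exists La.
  - by move->; apply: gen_scale; apply: gen_in; exists Lb.
  by move=> x hx ->; apply: (gen_sv _ _ hs); case: x hx => //= _; [left|right].
have [zeta0 [hom0 hd zeta_abc nzeta]] := zeta_spec.
have vecG P f : vecs P f -> exists p, homG p f.
  by move=> [x _ ->]; exists (gdeg [:: ol x]); apply: homG_vec.
have vecN P f : vecs P f -> exists n, homog n f.
  by move=> [x _ ->]; exists 1%N; apply: homog_vec.
have vecB P f : vecs P f -> Bnich t l f by move=> [x _ ->]; apply: Bnich_vec.
have LCS_C : LCS t l C.
  rewrite CE; apply: gen_LCS => //.
  - exact: vecB.
  - exact: vecN.
  - exact: vecG.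
  by move=> f x [y _ ->]; apply: vec_dl.
have nC : ~ C zeta0 by rewrite CE.
(* The group homogeneity of [zeta0] has not been established, and [gen_LCS] requires it; so [zeta0]
   is replaced by one of its components that still lies outside [C]. Its derivatives stay in [C] by
   [dl_gproj]. *)
have [w0 hw0] : exists w0, ~ C (gproj w0 zeta0).
  apply: gproj_notin nC.
  - by exists 11%N => w hw; apply: hom0; rewrite gtn_eqF.
  - by rewrite CE; apply: gen_zero.
  - by move=> f g; apply: (lcs_add LCS_C).
pose z := gproj w0 zeta0.
have zabc : gen (vecs (among [:: La; Lb; Lc])) z.
  by apply: gen_gproj zeta_abc => // f; apply: vecG.
have zB : Bnich t l z by apply: gen_sub zabc => f; apply: vecB.
have z11 : homog 11 z.
  move=> w hw; rewrite /z /gproj hom0 //.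
  by case: (excluded_middle_informative _).
split=> //; exists z; split; last first.
  apply: gen_sub zabc => f [x hx ->]; apply: (gen_sv _ _ hs).
  by case: x hx => //= _; [constructor 1|constructor 2|constructor 3].
split=> //; split=> //; split=> //.
(* [C] contains inhomogeneous elements, so the algebra is presented by the letters [a], [b] and by
   [z], which are homogeneous. *)
have -> : gen (fun g => C g \/ g = z) = gen (fun g => vecs ab g \/ g = z).
  apply: genP => f [].
  - by rewrite CE; apply: gen_sub => g hg; apply: gen_in; left.
  - by move->; apply: gen_in; right.
  - by move=> hf; apply: gen_in; left; rewrite CE; apply: gen_in.
  - by move->; apply: gen_in; right.
apply: gen_LCS => // [f [/vecB //|-> //]|f [/vecN //|->]|f [/vecG //|->]|f x [[y _ ->]|->]].
- by exists 11%N.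
- by exists (gdeg w0); apply: homG_gproj.
- exact: vec_dl.
apply: (@gen_sub _ _ _ (vecs ab)) => [g hg|]; first by apply: gen_in; left.
have [->|[w1 ->]] := dl_gproj x w0 zeta0; first exact: gen_zero.
by apply: gen_gproj => //; apply: vecG.
Qed.
End Case3.

Theorem mainTheorem16 (K : closedFieldType) (hK : [pchar K] =i pred0)
  (t l s : K) (ht : t != 0) (hl : l != 0) (hlt : l ^+ 2 = t ^+ 4) (hs : s != 0) :
  let va := tscale s (tvec K ra) in
  let vb := tscale s (tvec K rb) in
  let vc := tscale s (tvec K rc) in
  let mul := tmul t l in
  (* (1) *)
  (t ^+ 6 != 1 ->
     let z := tadd (tadd (mul va vb) (tscale (- t) (mul vc va))) (tscale t (mul vb vc)) in
     let C := gen t l (fun f => f = vb \/ f = z) in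
     LCS t l C /\ ~ gen_deg1 t l C) /\
  (* (2) *)
  ((t = -1 /\ l = 1) \/ (t ^+ 2 - t + 1 = 0 /\ l = - t^-1) ->
     let z := tadd (tadd (mul (mul vc vb) va) (tscale (- l) (mul (mul va vc) vb)))
                   (tscale (l ^+ 2) (mul (mul vb va) vc)) in
     let C := gen t l (fun f => [\/ f = va, f = vb | f = z]) in
     LCS t l C /\ ~ gen_deg1 t l C) /\
  (* (3) *)
  (t = 1 /\ l = -1 ->
     let C := gen t l (fun f => f = va \/ f = vb) in
     LCS t l C /\
     exists z, extension t l C 11 z /\ gen t l (fun f => [\/ f = va, f = vb | f = vc]) z) /\
  (* (4) *)
  (t ^+ 2 + t + 1 = 0 /\ l = - t^-1 ->
     forall C, LCS t l C -> gen_deg1 t l C).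
Proof.
have two0 : (2%:R : K) != 0 by rewrite ((pcharf0P K).1 hK).
split; first exact: LCS_b_z_not_gen_deg1.
split; last split.
- case=> [[e1 e2]|[e1 e2]].
  (* Integer coefficients with [tau = 0]; here l / t = -1, and the coefficients -l and l^2 of [z]
     are -1 and 1. *)
  + apply: (@LCS_a_b_z_not_gen_deg1 K t l s ht hl hlt hs Z0 Z0 cm1 c1 c1 cm1 0 _ _ _ _ _ cm1 c1) => //.
    * by rewrite expr0n mulr0 add0r.
    * by rewrite e1 /cK /zK /= mul0r addr0.
    * by rewrite cK1.
    * by rewrite e2 cK1.
    * by rewrite e1 e2 /cK /zK /= mul0r addr0 invrN1 mul1r.
    * by rewrite e2 /cK /zK /= mul0r addr0.
    * by rewrite e2 cK1 expr1n.
  + have t2 : t ^+ 2 = t - 1 by apply/eqP; rewrite -subr_eq0 -e1; apply/eqP; ring.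
    have lE : l = t - 1.
      by rewrite e2; apply: (mulIf ht); rewrite mulNr mulVf // mulrBl -expr2 t2; ring.
    (* Here [tau = t] with t^2 = t - 1. As l = t - 1 = t^2, one has l / t = t, and the coefficients
       of [z] are -l = 1 - t and l^2 = -t. *)
    apply: (@LCS_a_b_z_not_gen_deg1 K t l s ht hl hlt hs (Zpos xH) (Zneg xH) w_t c1 (Zneg xH, Zpos xH) w_t t
      _ _ _ _ _ (Zpos xH, Zneg xH) (Z0, Zneg xH)) => //.
    * by rewrite t2 /zK /= mul1r.
    * by rewrite /cK /zK /= add0r mul1r.
    * by rewrite cK1.
    * by rewrite /cK /zK /= mul1r lE addrC.
    * by rewrite /cK /zK /= add0r mul1r; apply: (mulIf ht); rewrite divfK // lE -expr2.
    * by rewrite /cK /zK /= mulN1r lE opprB.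
    * by rewrite /cK /zK /= add0r mulN1r lE sqrrB t2; ring.
- by move=> [-> ->]; apply: extension_degree11.
- move=> [e1 e2] C hC; apply: LCS_deg1 => //; exact: KSgen_all.
Qed.
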